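(* Let $n\ge0$, let $M$ be a smooth manifold of dimension $n+3$, let $\mathcal{D}$ be a Goursat structure on $M$, and let $q\in M$. Then there exist a point $p\in\mathbb{R}^2\times(S^1)^{n+1}$, open neighborhoods $U$ of $q$ in $M$ and $W$ of $p$ in $\mathbb{R}^2\times(S^1)^{n+1}$, and a smooth diffeomorphism $\varphi:U\to W$ with $\varphi(q)=p$, such that $\varphi_*\mathcal{D}$ coincides on $W$ with the distribution spanned by the $n$-trailer system $(\tau_1^n,\tau_2^n)$. That is, any Goursat structure on a manifold of dimension $n+3$ is equivalent, in a small enough neighborhood of any point $q$, to the $n$-trailer considered around a suitably chosen point $p$ of its configuration space.
   Context: A rank-$k$ distribution $\mathcal{D}$ on a smooth manifold $M$ assigns smoothly to each $x\in M$ a $k$-dimensional linear subspace $\mathcal{D}(x)\subset T_xM$. Two distributions $\mathcal{D}$ on $M$ and $\tilde{\mathcal{D}}$ on $\tilde M$ are equivalent if there is a smooth diffeomorphism $\varphi:M\to\tilde M$ with $(\varphi_*\mathcal{D})(\tilde x)=\tilde{\mathcal{D}}(\tilde x)$ for each $\tilde x\in\tilde M$. The derived flag of $\mathcal{D}$ is the sequence of modules of vector fields defined by $\mathcal{D}^{(0)}=\mathcal{D}$ and $\mathcal{D}^{(i+1)}=\mathcal{D}^{(i)}+[\mathcal{D}^{(i)},\mathcal{D}^{(i)}]$ for $i\ge0$. A Goursat structure on a manifold $M$ of dimension $m\ge3$ is a rank-two distribution $\mathcal{D}$ such that, for $0\le i\le m-2$, $\dim\mathcal{D}^{(i)}(x)=i+2$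 for every $x\in M$. The $n$-trailer system. On $\mathbb{R}^2\times S^1$ with coordinates $(\xi_1,\xi_2,\theta_0)$ let $\tau_1^0=\frac{\partial}{\partial\theta_0}$, $\tau_2^0=\sin(\theta_0)\frac{\partial}{\partial\xi_2}+\cos(\theta_0)\frac{\partial}{\partial\xi_1}$. Inductively, for $n\ge1$, on $\mathbb{R}^2\times(S^1)^{n+1}$ (the configuration space) with coordinates $(\xi_1,\xi_2,\theta_0,\ldots,\theta_n)$ let $$\tau_1^n=\tfrac{\partial}{\partial\theta_n},\qquad \tau_2^n=\sin(\theta_n-\theta_{n-1})\,\tau_1^{n-1}+\cos(\theta_n-\theta_{n-1})\,\tau_2^{n-1},$$ where $\tau_1^{n-1},\tau_2^{n-1}$ on the right are lifted to $\mathbb{R}^2\times(S^1)^{n+1}$ by keeping their components (independent of $\theta_n$) and taking the $\partial/\partial\theta_n$-component to be $0$. The pair $(\tau_1^n,\tau_2^n)$ is the $n$-trailer system; it is pointwise linearly independent and spans a rank-two distribution. *)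

(* Defs.v *)
From HB Require Import structures.
From mathcomp Require Import all_boot all_order all_algebra.
From mathcomp Require Import all_classical all_reals all_analysis.
From mathcomp Require Import ring lra.
Set Implicit Arguments.
Unset Strict Implicit.
Unset Printing Implicit Defensive.
Import Order.TTheory GRing.Theory Num.Theory.
Import numFieldNormedType.Exports.
Local Open Scope classical_set_scope.
Local Open Scope ring_scope.

Definition iter_derive (R : realType) (V W : normedModType R)
    (vs : seq V) (f : V -> W) : V -> W :=
  foldr (fun v (g : V -> W) => 'D_v g) f vs.

(* [f] is C^infty on the open set [U]: all its iterated directional
   derivatives are Frechet differentiable at the points of [U]. *)
Definition smooth_on (R : realType) (V W : normedModType R)
    (U : set V) (f : V -> W) : Prop :=
  forall (vs : seq V) (x : V), U x -> differentiable (iter_derive vs f) x.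

Record chart (R : realType) (d : nat) (M : topologicalType) := Chart {
  cdom : set M;
  cmap :> M -> 'rV[R]_d;
  cinv : 'rV[R]_d -> M;
  open_cdom : open cdom;
  open_cmap : open (cmap @` cdom);
  continuous_cmap : forall x, cdom x -> {for x, continuous cmap};
  continuous_cinv : forall y, (cmap @` cdom) y -> {for y, continuous cinv};
  cmapK : forall x, cdom x -> cinv (cmap x) = x }.

Definition smooth_compatible (R : realType) (d : nat) (M : topologicalType)
    (c c' : chart R d M) : Prop :=
  smooth_on (c @` (cdom c `&` cdom c')) (c' \o cinv c).

(* [chart_at] only fixes, at each point, the chart in which tangent vectors are
   written: see [tangent_in]. *)
Record manifold (R : realType) (d : nat) := Manifold {
  carrier :> topologicalType;
  atlas : set (chart R d carrier);
  chart_at : carrier -> chart R d carrier;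
  chart_at_atlas : forall x, atlas (chart_at x);
  chart_at_dom : forall x, cdom (chart_at x) x;
  atlas_compatible :
    forall c c', atlas c -> atlas c' -> smooth_compatible c c';
  manifold_hausdorff : hausdorff_space carrier;
  manifold_second_countable : @second_countable carrier }.

Definition smooth_map_on (R : realType) (d e : nat)
    (M : manifold R d) (N : manifold R e) (U : set M) (f : M -> N) : Prop :=
  (forall x, U x -> {for x, continuous f}) /\
  forall (c : chart R d M) (c' : chart R e N), atlas c -> atlas c' ->
    smooth_on (c @` (cdom c `&` U `&` f @^-1` cdom c')) (c' \o f \o cinv c).

Definition smooth_function (R : realType) (d : nat) (M : manifold R d)
    (f : M -> R) : Prop :=
  forall c : chart R d M, atlas c ->
    smooth_on (c @` cdom c) (f \o cinv c : 'rV[R]_d -> R^o).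

(* The tangent space T_x M is identified with R^d by means of the chart
   [chart_at x]; a vector field is thus a function [M -> 'rV[R]_d], and a
   distribution a function [M -> {vspace 'rV[R]_d}].  [tangent_in c x v] is the
   coordinate vector, in the chart [c], of the tangent vector [v] at [x]. *)
Definition tangent_in (R : realType) (d : nat) (M : manifold R d)
    (c : chart R d M) (x : M) (v : 'rV[R]_d) : 'rV[R]_d :=
  'd (c \o cinv (chart_at x)) (chart_at x x) v.

Definition tangent_map (R : realType) (d e : nat)
    (M : manifold R d) (N : manifold R e) (f : M -> N) (x : M) :
    'rV[R]_d -> 'rV[R]_e :=
  'd (chart_at (f x) \o f \o cinv (chart_at x)) (chart_at x x).

Definition local_rep (R : realType) (d : nat) (M : manifold R d)
    (c : chart R d M) (X : M -> 'rV[R]_d) (y : 'rV[R]_d) : 'rV[R]_d :=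
  tangent_in c (cinv c y) (X (cinv c y)).

Definition smooth_vf_on (R : realType) (d : nat) (M : manifold R d)
    (U : set M) (X : M -> 'rV[R]_d) : Prop :=
  forall c : chart R d M, atlas c ->
    smooth_on (c @` (cdom c `&` U)) (local_rep c X).

Definition lie_bracket (R : realType) (d : nat) (M : manifold R d)
    (X Y : M -> 'rV[R]_d) (x : M) : 'rV[R]_d :=
  let c := chart_at x in
  'd (local_rep c Y) (c x) (local_rep c X (c x))
  - 'd (local_rep c X) (c x) (local_rep c Y (c x)).

Definition smooth_distribution (R : realType) (d : nat) (M : manifold R d) (k : nat)
    (D : M -> {vspace 'rV[R]_d}) : Prop :=
  (forall x, \dim (D x) = k) /\
  forall x, exists (U : set M) (X : 'I_k -> M -> 'rV[R]_d),
    [/\ open U, U x, forall j, smooth_vf_on U (X j) &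
        forall y, U y -> D y = <<[seq X j y | j : 'I_k]>>%VS].

Definition sections (R : realType) (d : nat) (M : manifold R d)
    (D : M -> {vspace 'rV[R]_d}) : set (M -> 'rV[R]_d) :=
  [set X | smooth_vf_on [set: M] X /\ forall x, X x \in D x].

(* S + [S, S], where [S, S] is the C^infty(M)-module generated by the
   brackets of elements of S. *)
Definition bracket_step (R : realType) (d : nat) (M : manifold R d)
    (S : set (M -> 'rV[R]_d)) : set (M -> 'rV[R]_d) :=
  [set X | exists (Y : M -> 'rV[R]_d) (m : nat) (f : 'I_m -> M -> R)
             (A B : 'I_m -> M -> 'rV[R]_d),
     [/\ S Y, forall j, smooth_function (f j), forall j, S (A j),
         forall j, S (B j) &
         forall x, X x = Y x + \sum_j f j x *: lie_bracket (A j) (B j) x]].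

Definition derived_flag (R : realType) (d : nat) (M : manifold R d)
    (D : M -> {vspace 'rV[R]_d}) (i : nat) : set (M -> 'rV[R]_d) :=
  iter i (@bracket_step R d M) (sections D).

Definition subspace_of_dim (R : realType) (d : nat) (S : set 'rV[R]_d)
    (k : nat) : Prop :=
  exists V : {vspace 'rV[R]_d}, [set` V] = S /\ \dim V = k.

Definition goursat (R : realType) (d : nat) (M : manifold R d)
    (D : M -> {vspace 'rV[R]_d}) : Prop :=
  [/\ (3 <= d)%N, smooth_distribution 2 D &
      forall (i : nat) (x : M), (i <= d - 2)%N ->
        subspace_of_dim [set X x | X in derived_flag D i] (i + 2)].

(* [phi] and [psi] are only meaningful on [U] and [W]. *)
Definition diffeo_on (R : realType) (d e : nat)
    (M : manifold R d) (N : manifold R e) (U : set M) (W : set N)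
    (phi : M -> N) (psi : N -> M) : Prop :=
  [/\ phi @` U = W, forall x, U x -> psi (phi x) = x,
      smooth_map_on U phi & smooth_map_on W psi].

Definition push_distribution (R : realType) (d e : nat)
    (M : manifold R d) (N : manifold R e) (phi : M -> N) (psi : N -> M)
    (D : M -> {vspace 'rV[R]_d}) (w : N) : {vspace 'rV[R]_e} :=
  (linfun (tangent_map phi (psi w)) @: D (psi w))%VS.

Section topological_facts.

Lemma row_entry_continuous (T : topologicalType) (m : nat) (j : 'I_m) :
  continuous (fun v : 'rV[T]_m => v ord0 j).
Proof.
move=> v A vA; exists (fun i k => if k == j then A else setT).
- by move=> i k; case: eqP => [->|_]; [rewrite (ord1 i)|exact: filterT].
- by move=> w /(_ ord0 j); rewrite eqxx.
Qed.

Lemma row_continuous (X T : topologicalType) (m : nat) (f : X -> 'rV[T]_m)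
    (x : X) :
  (forall j, {for x, continuous (fun y => f y ord0 j)}) ->
  {for x, continuous f}.
Proof.
move=> fc A [P fP PA].
have : \forall y \near x, forall j, P ord0 j (f y ord0 j).
  by apply: filter_forall => j; apply: fc; exact: fP.
apply: filterS => y Py; apply: PA => i j; rewrite (ord1 i); exact: Py.
Qed.

Lemma hausdorff_separated (T : topologicalType) :
  (forall x y : T, x != y -> exists (V : topologicalType) (f : T -> V),
     [/\ hausdorff_space V, continuous f & f x != f y]) ->
  hausdorff_space T.
Proof.
move=> sep; rewrite open_hausdorff => x y /sep[V [f [+ fc fxy]]].
rewrite open_hausdorff => /(_ _ _ fxy)[[A B] /=].
rewrite !inE => -[Ax By] [oA oB AB].
exists (f @^-1` A, f @^-1` B) => /=; first by rewrite !inE.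
split; [exact: open_comp|exact: open_comp|].
by rewrite -preimage_setI AB preimage_set0.
Qed.

Lemma second_countable_real (R : realType) : @second_countable R.
Proof.
exists ((fun a : rat * rat => `]ratr a.1, ratr a.2[%classic : set R)
    @` [set: rat * rat]).
  apply: sub_countable (card_image_le _ _) _; exact: countableP.
split=> [_ [a _ <-]|x A]; first exact: interval_open.
case/nbhs_ballP => e /= e0 xA.
have [a] := @rat_in_itvoo R (x - e) x ltac:(lra).
rewrite in_itv /= => /andP[a1 a2].
have [b] := @rat_in_itvoo R x (x + e) ltac:(lra).
rewrite in_itv /= => /andP[b1 b2].
exists `]ratr a, ratr b[%classic.
  by split; [exists (a, b)|rewrite /= in_itv /= a2 b1].
move=> y /=; rewrite in_itv /= => /andP[ay yb]; apply: xA.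
by rewrite /ball /= ltr_distl; apply/andP; split; lra.
Qed.

Lemma second_countable_prod (T U : topologicalType) :
  @second_countable T -> @second_countable U -> @second_countable (T * U)%type.
Proof.
move=> [B cB [oB bB]] [C cC [oC bC]].
exists [set b.1 `*` b.2 | b in B `*` C].
  by apply: sub_countable (card_image_le _ _) _; exact: countableX.
split=> [_ [[b c] [/= /oB ob /oC oc] <-]|[x y] A].
  rewrite (_ : _ `*` _ = fst @^-1` b `&` snd @^-1` c)//; apply: openI.
    by apply: open_comp => // ? _; exact: cvg_fst.
  by apply: open_comp => // ? _; exact: cvg_snd.
move=> [[P Q] /= [/bB[b [Bb bx] bP] /bC[c [Cc cy] cQ]] PQA].
exists (b `*` c); first by split=> //; exists (b, c).
by move=> [z w] [/= bz cw]; apply: PQA; split; [exact: bP|exact: cQ].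
Qed.

Lemma second_countable_set_type (T : topologicalType) (A : set T) :
  @second_countable T -> @second_countable (set_type A).
Proof.
move=> [B cB [oB bB]]; exists [set set_val @^-1` b | b in B].
  by apply: sub_countable (card_image_le _ _) _.
split=> [_ [b /oB ob <-]|x U]; first by exists b.
move=> [_ [[V oV <-] Vx] VU].
have /bB[b [Bb bx] bV] : nbhs (set_val x) V by exact: open_nbhs_nbhs.
exists (set_val @^-1` b); first by split=> //; exists b.
by move=> y by_; apply: VU; exact: bV.
Qed.

Lemma second_countable_row (T : topologicalType) (m : nat) :
  @second_countable T -> @second_countable 'rV[T]_m.
Proof.
move=> [B cB [oB bB]].
have [B0|/set0P B0] := eqVneq B set0.
  have T0 (x : T) : False.
    by have [b []] := bB x setT filterT; rewrite B0.
  case: m => [|m].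
    exists [set setT]; first exact: countable1.
    split=> [_ ->|v A [P _ PA]]; first exact: openT.
    by exists setT => //; move=> w _; apply: PA => i [].
  exists set0; first exact: countable0.
  by split=> [//|v]; case: (T0 (v ord0 ord0)).
have /pfcard_geP[B1|[g]] := cB; first by move/set0P: B0; rewrite B1 eqxx.
pose box (k : 'rV[nat]_m) := [set v : 'rV[T]_m | forall j, g (k ord0 j) (v ord0 j)].
exists (range box).
  by apply: sub_countable (card_image_le _ _) _; exact: countableP.
have gB k : B (g k) by exact: (@funS _ _ _ _ g k I).
split=> [_ [k _ <-]|v A [P vP PA]].
  rewrite openE => w kw; rewrite /interior /=.
  suff : \forall z \near w, box k z by [].
  have := @filter_forall 'rV[T]_m 'I_m (fun j (z : 'rV[T]_m) =>
    g (k ord0 j) (z ord0 j)) (nbhs w) (nbhs_filter w); apply => j.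
  apply: (@row_entry_continuous T m j w).
  by apply: open_nbhs_nbhs; split; [exact: oB|exact: kw].
have ex j : exists k, g k (v ord0 j) /\ g k `<=` P ord0 j.
  have [b [Bb bv] bP] := bB _ _ (vP ord0 j).
  by have [k _ gk] := @surj _ _ _ _ g b Bb; exists k; rewrite gk.
have /choice[k kP] := ex.
exists (box (\row_j k j)).
  by split=> [|j]; [exists (\row_j k j)|rewrite mxE; case: (kP j)].
move=> w bw; apply: PA => i j; rewrite (ord1 i).
by apply: (kP j).2; have := bw j; rewrite mxE.
Qed.

End topological_facts.

Section smooth_facts.
Variables (R : realType) (V W : normedModType R).

Lemma near_eq_iter_derive (f g : V -> W) (vs : seq V) (x : V) :
  {near x, f =1 g} -> {near x, iter_derive vs f =1 iter_derive vs g}.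
Proof.
move=> fg; elim: vs => [//|v vs IH] /=.
move: IH => /near_join; apply: filterS => y.
exact: near_eq_derive.
Qed.

Lemma near_eq_differentiable (f g : V -> W) (x : V) :
  {near x, f =1 g} -> differentiable g x -> differentiable f x.
Proof.
move=> fg dg.
have fgx : f x = g x by exact: nbhs_singleton fg.
have [dgc dgo] := (diff_locallyP _ _).1 dg.
have fo : f \o shift x = cst (f x) + 'd g x +o_ 0 id.
  apply/eqaddoP => e e0; move/eqaddoP: dgo => /(_ e e0).
  apply: filterS2; last first.
    have := fg; rewrite (near_shift 0 x) /=; exact.
  move=> h; rewrite /= subr0 addrC => fgh.
  by rewrite !fctE /= fgx [h + x]addrC fgh.
have dfg : 'd f x = 'd g x :> (V -> W) by exact: diff_unique.
by apply/diff_locallyP; rewrite dfg.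
Qed.

Lemma near_eq_smooth_on (U : set V) (f : V -> W) :
  (forall x, U x -> exists2 g, smooth_on [set: V] g & {near x, f =1 g}) ->
  smooth_on U f.
Proof.
move=> h vs x /h[g sg fg].
by apply: near_eq_differentiable (near_eq_iter_derive vs fg) _; exact: sg.
Qed.

Lemma translation_smooth (a : V) : smooth_on [set: V] (fun x => x + a).
Proof.
move=> vs x _.
case: vs => [|v vs] /=; first by apply: differentiableD.
suff [c /= ->] : exists c,
    iter_derive (v :: vs) (fun x : V => x + a) = cst c by [].
elim: vs v => [v|w vs IH v] /=.
  exists v; apply/funext => y /=.
  by rewrite deriveD// derive_id derive_cst addr0.
by have [c /= ->] := IH w; exists 0; apply/funext => y /=; rewrite derive_cst.
Qed.

End smooth_facts.

Definition circle (R : realType) : Type :=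
  set_type [set z : R * R | z.1 ^+ 2 + z.2 ^+ 2 = 1].

HB.instance Definition _ (R : realType) := Topological.on (circle R).

Section circle_charts.
Variable R : realType.
Implicit Types (b : bool) (z : circle R) (t : R).

Lemma circle_pt_subproof t :
  (cos t, sin t) \in [set z : R * R | z.1 ^+ 2 + z.2 ^+ 2 = 1].
Proof. by rewrite inE /= cos2Dsin2. Qed.

Definition circle_pt t : circle R := exist _ (cos t, sin t) (circle_pt_subproof t).

(* Angular coordinate around the angle 0 ([b = false]) or pi ([b = true]). *)
Definition angle_center b : R := if b then pi else 0.

Definition circle_dom b : set (circle R) :=
  [set z | (set_val z).1 != (if b then 1 else -1)].

Definition angle b z : R :=
  let: (x, y) := set_val z in
  if b then pi + 2 * atan (- y / (1 - x)) else 2 * atan (y / (1 + x)).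

Lemma circleP z : (set_val z).1 ^+ 2 + (set_val z).2 ^+ 2 = 1.
Proof. by have := valP z; rewrite inE. Qed.

Lemma cos_sin_atan2 (x y : R) : x != -1 -> x ^+ 2 + y ^+ 2 = 1 ->
  cos (2 * atan (y / (1 + x))) = x /\ sin (2 * atan (y / (1 + x))) = y.
Proof.
move=> x1 xy; set w := y / (1 + x).
have x10 : 1 + x != 0 by rewrite addrC addr_eq0.
have c0 : cos (atan w) != 0.
  by apply/lt0r_neq0/cos_gt0_pihalf; rewrite atan_gtNpi2 atan_ltpi2.
have c2 : cos (atan w) ^+ 2 = (1 + x) / 2.
  rewrite -[LHS]invrK cos2_tan2 // atanK /w.
  apply: (mulfI (_ : (1 + (y / (1 + x)) ^+ 2) != 0)).
    by rewrite gt_eqF// ltr_pwDl// sqr_ge0.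
  rewrite divff ?gt_eqF ?ltr_pwDl ?sqr_ge0//.
  have -> : 1 + (y / (1 + x)) ^+ 2 = ((1 + x) ^+ 2 + y ^+ 2) / (1 + x) ^+ 2.
    by field.
  have -> : (1 + x) ^+ 2 + y ^+ 2 = 2 * (1 + x).
    by rewrite -[y ^+ 2](addKr (x ^+ 2)) xy; ring.
  by field; rewrite x10.
have sE : sin (atan w) = w * cos (atan w).
  by rewrite -{2}[w]atanK /tan divfK.
split.
  by rewrite mulr_natl cos_mulr2n c2 -mulr_natl; field.
rewrite mulr_natl sin_mulr2n sE mulrCA -expr2 c2 -mulr_natl /w.
by field; rewrite x10.
Qed.

Lemma angleK b z : circle_dom b z -> circle_pt (angle b z) = z.
Proof.
move=> zb; apply: val_inj => /=; have := circleP z; move: zb.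
rewrite /circle_dom /angle set_valE /=; case: (\val z) => x y /=.
case: b => x1 xy; last by have [-> ->] := cos_sin_atan2 x1 xy.
have [||c s] := @cos_sin_atan2 (- x) (- y).
- by rewrite eqr_opp.
- by rewrite !sqrrN.
by rewrite [pi + _]addrC cosDpi sinDpi c s !opprK.
Qed.

Lemma angle_bound b z :
  angle_center b - pi < angle b z < angle_center b + pi.
Proof.
rewrite /angle; case: (set_val z) => x y.
have aP (w : R) : - (pi / 2) < atan w < pi / 2.
  by rewrite atan_gtNpi2 atan_ltpi2.
case: b => /=.
  by have /andP[? ?] := aP (- y / (1 - x)); apply/andP; split; lra.
by have /andP[? ?] := aP (y / (1 + x)); apply/andP; split; lra.
Qed.

Lemma atan_half t : - pi < t < pi ->
  cos t != -1 /\ 2 * atan (sin t / (1 + cos t)) = t.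
Proof.
move=> tpi; pose u := t / 2.
have tE : t = u *+ 2 by rewrite /u -mulr_natl; field.
have upi : - (pi / 2) < u < pi / 2.
  by move: tpi => /andP[? ?]; apply/andP; split; rewrite /u; lra.
have c0 : cos u != 0 by rewrite gt_eqF// cos_gt0_pihalf.
have -> : cos t = 2 * cos u ^+ 2 - 1 by rewrite tE cos_mulr2n mulr_natl.
split.
  by rewrite -subr_eq0 opprK subrK mulf_neq0// expf_neq0.
have -> : sin t / (1 + (2 * cos u ^+ 2 - 1)) = tan u.
  rewrite tE sin_mulr2n -mulr_natl /tan; field.
  by rewrite c0 [1 + _]addrC subrK mulf_neq0// expf_neq0.
by rewrite tanK ?in_itv//= /u; field.
Qed.

Lemma circle_ptK b t : angle_center b - pi < t < angle_center b + pi ->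
  circle_dom b (circle_pt t) /\ angle b (circle_pt t) = t.
Proof.
rewrite /circle_dom /angle set_valE /=; case: b => /= tb; last first.
  by move: tb; rewrite sub0r add0r => /atan_half[? ->].
have [|] := @atan_half (t - pi).
  by move: tb => /andP[? ?]; apply/andP; split; lra.
have -> : cos t = - cos (t - pi) by rewrite -cosDpi subrK.
have -> : sin t = - sin (t - pi) by rewrite -sinDpi subrK.
by rewrite !opprK => c1 ->; rewrite eqr_oppLR; split=> //; ring.
Qed.

Lemma angle_change b b' t : angle_center b - pi < t < angle_center b + pi ->
  circle_dom b' (circle_pt t) ->
  exists a, \forall u \near t, angle b' (circle_pt u) = u + a.
Proof.
have shift (a : R) : (forall u, circle_pt (u + a) = circle_pt u) ->
    angle_center b' - pi < t + a < angle_center b' + pi ->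
    exists a, \forall u \near t, angle b' (circle_pt u) = u + a.
  move=> pa /andP[ta1 ta2]; exists a.
  have : \forall u \near t, u \in `](angle_center b' - pi - a),
      (angle_center b' + pi - a)[.
    by apply: near_in_itvoo; rewrite in_itv /=; apply/andP; split; lra.
  apply: filterS => u; rewrite in_itv /= => /andP[u1 u2]; rewrite -pa.
  by apply: (circle_ptK _).2; apply/andP; split; lra.
have pt0 u : circle_pt (u + 0) = circle_pt u by rewrite addr0.
have pt1 u : circle_pt (u + pi *+ 2) = circle_pt u.
  by apply: val_inj => /=; rewrite cosD2pi sinD2pi.
have pt2 u : circle_pt (u - pi *+ 2) = circle_pt u by rewrite -pt1 subrK.
have pi0 := pi_gt0 R.
move=> /andP[t1 t2]; rewrite /circle_dom set_valE /= => tb'.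
case: b b' shift t1 t2 tb' => -[] /= shift t1 t2 tb'.
- by apply: (shift 0 pt0); apply/andP; split; lra.
- have [tpi|tpi|tpi] := ltgtP t pi; last by rewrite tpi cospi eqxx in tb'.
    by apply: (shift 0 pt0); apply/andP; split; lra.
  by apply: (shift _ pt2); apply/andP; split; lra.
- have [t0|t0|t0] := ltgtP t 0; last by rewrite t0 cos0 eqxx in tb'.
    by apply: (shift _ pt1); apply/andP; split; lra.
  by apply: (shift 0 pt0); apply/andP; split; lra.
- by apply: (shift 0 pt0); apply/andP; split; lra.
Qed.

Lemma set_val_continuous : continuous (set_val : circle R -> R * R).
Proof. exact: initial_continuous. Qed.

Lemma circle_pt_continuous : continuous circle_pt.
Proof.
apply: (@continuous_comp_initial _ R (R * R)%type set_val circle_pt) => t /=.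
rewrite (_ : set_val \o circle_pt = fun u => (cos u, sin u)) //=.
exact: (cvg_pair (@continuous_cos R t) (@continuous_sin R t)).
Qed.

Lemma fst_circle_continuous : continuous (fun z => (set_val z).1).
Proof.
by move=> z; apply: continuous_comp; [exact: set_val_continuous|exact: cvg_fst].
Qed.

Lemma snd_circle_continuous : continuous (fun z => (set_val z).2).
Proof.
by move=> z; apply: continuous_comp; [exact: set_val_continuous|exact: cvg_snd].
Qed.

Lemma circle_dom_open b : open (circle_dom b).
Proof.
have /continuousP := fst_circle_continuous.
by move=> /(_ [set x | x != (if b then 1 else -1)]); apply; exact: open_neq.
Qed.

Lemma angle_continuous b z : circle_dom b z -> {for z, continuous (angle b)}.
Proof.
rewrite /circle_dom /= => zb.
have xc : {for z, continuous (fun z => (set_val z).1)}.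
  exact: fst_circle_continuous.
have yc : {for z, continuous (fun z => (set_val z).2)}.
  exact: snd_circle_continuous.
rewrite (_ : angle b = fun z => let x := (set_val z).1 in
    let y := (set_val z).2 in
    if b then pi + 2 * atan (- y / (1 - x)) else 2 * atan (y / (1 + x))).
  case: b zb => /= zb.
    apply: continuousD; first exact: cst_continuous.
    apply: continuousM; first exact: cst_continuous.
    apply: (@continuous_comp _ _ _ (fun z => - (set_val z).2 / (1 - (set_val z).1)));
      last exact: continuous_atan.
    apply: continuousM; first exact: continuousN.
    apply: continuousV; first by rewrite subr_eq0 eq_sym.
    by apply: continuousB => //; exact: cst_continuous.
  apply: continuousM; first exact: cst_continuous.
  apply: (@continuous_comp _ _ _ (fun z => (set_val z).2 / (1 + (set_val z).1)));
    last exact: continuous_atan.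
  apply: continuousM => //.
  apply: continuousV; first by rewrite addrC addr_eq0.
  by apply: continuousD => //; exact: cst_continuous.
by apply/funext => w; rewrite /angle; case: (set_val w).
Qed.

End circle_charts.

Section trailer_configuration_space.
Variables (R : realType) (n : nat).

Definition config : topologicalType := ('rV[R]_2 * 'rV[circle R]_n.+1)%type.

Implicit Types (b : {ffun 'I_n.+1 -> bool}) (x : config).

Definition config_dom b : set config :=
  [set x : config | forall i, circle_dom (b i) (x.2 ord0 i)].

(* The coordinates are (xi_1, xi_2, theta_0, ..., theta_n). *)
Definition config_map b x : 'rV[R]_n.+3 :=
  row_mx x.1 (\row_i angle (b i) (x.2 ord0 i)).

Definition config_inv (v : 'rV[R]_(2 + n.+1)) : config :=
  (lsubmx v, \row_i circle_pt (rsubmx v ord0 i)).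

Definition config_image b : set 'rV[R]_n.+3 :=
  [set v : 'rV[R]_(2 + n.+1) | forall i,
    angle_center R (b i) - pi < v ord0 (rshift 2 i) < angle_center R (b i) + pi].

Lemma config_mapK b x : config_dom b x -> config_inv (config_map b x) = x.
Proof.
case: x => xi th xb; rewrite /config_inv /config_map row_mxKl row_mxKr.
by congr pair; apply/rowP => i; rewrite !mxE angleK.
Qed.

Lemma config_map_image b x : config_image b (config_map b x).
Proof. by move=> i; rewrite row_mxEr mxE; exact: angle_bound. Qed.

Lemma config_inv_dom b v : config_image b v -> config_dom b (config_inv v).
Proof. by move=> vb i; rewrite !mxE; exact: (circle_ptK (vb i)).1. Qed.

Lemma config_invK b v : config_image b v -> config_map b (config_inv v) = v.
Proof.
move=> vb; apply: etrans (@hsubmxK _ 1 2 n.+1 v).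
rewrite /config_map /config_inv /=; congr row_mx.
by apply/rowP => i; rewrite !mxE (circle_ptK (vb i)).2.
Qed.

Lemma config_imageE b : config_map b @` config_dom b = config_image b.
Proof.
apply/seteqP; split=> [_ [x _ <-]|v vb]; first exact: config_map_image.
by exists (config_inv v); [exact: config_inv_dom|exact: config_invK].
Qed.

Lemma config_dom_open b : open (config_dom b).
Proof.
rewrite openE => x xb; rewrite /interior /=.
have := @filter_forall config 'I_n.+1 (fun i y =>
  circle_dom (b i) (y.2 ord0 i)) (nbhs x) (nbhs_filter x); apply => i.
have c : {for x, continuous (fun y : config => y.2 ord0 i)}.
  apply: (@continuous_comp _ _ _ snd (fun v : 'rV[circle R]_n.+1 => v ord0 i)).
    exact: cvg_snd.
  exact: row_entry_continuous.
by apply: c; apply: open_nbhs_nbhs; split; [exact: circle_dom_open|exact: xb].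
Qed.

Lemma config_image_open b : open (config_image b).
Proof.
rewrite openE => v vb; rewrite /interior /=.
have := @filter_forall 'rV[R]_(2 + n.+1) 'I_n.+1 (fun i w =>
  angle_center R (b i) - pi < w ord0 (rshift 2 i) < angle_center R (b i) + pi)
  (nbhs (v : 'rV[R]_(2 + n.+1))) (nbhs_filter _); apply => i.
have := @near_in_itvoo R (angle_center R (b i) - pi) (angle_center R (b i) + pi)
  ((v : 'rV[R]_(2 + n.+1)) ord0 (rshift 2 i)).
rewrite in_itv /= => /(_ (vb i)) vn.
have := @row_entry_continuous R (2 + n.+1) (rshift 2 i) v _ vn.
apply: (@filterS _ _ (nbhs_filter _)) => w.
by rewrite /= in_itv.
Qed.

Lemma config_map_continuous b x : config_dom b x ->
  {for x, continuous (config_map b)}.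
Proof.
move=> xb; apply: (@row_continuous _ _ (2 + n.+1)) => j.
rewrite -[j](@splitK 2 n.+1); case: (fintype.split (j : 'I_(2 + n.+1))) => i /=.
  rewrite (_ : (fun y => _) = fun y : config => y.1 ord0 i); last first.
    by apply/funext => y; rewrite row_mxEl.
  apply: (@continuous_comp _ _ _ fst (fun v : 'rV[R]_2 => v ord0 i)).
    exact: cvg_fst.
  exact: row_entry_continuous.
rewrite (_ : (fun y => _) = fun y : config => angle (b i) (y.2 ord0 i));
  last first.
  by apply/funext => y; rewrite row_mxEr mxE.
apply: (@continuous_comp _ _ _ (fun y : config => y.2 ord0 i)).
  apply: (@continuous_comp _ _ _ snd (fun v : 'rV[circle R]_n.+1 => v ord0 i)).
    exact: cvg_snd.
  exact: row_entry_continuous.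
exact: angle_continuous.
Qed.

Lemma config_inv_continuous : continuous config_inv.
Proof.
move=> v.
have c1 : {for v, continuous (lsubmx : 'rV[R]_(2 + n.+1) -> 'rV[R]_2)}.
  apply: row_continuous => j.
  rewrite (_ : (fun y => _) = fun y : 'rV[R]_(2 + n.+1) => y ord0 (lshift n.+1 j)).
    exact: row_entry_continuous.
  by apply/funext => y; rewrite mxE.
have c2 : {for v, continuous (fun v : 'rV[R]_(2 + n.+1) =>
    \row_i circle_pt (rsubmx v ord0 i))}.
  apply: row_continuous => j.
  rewrite (_ : (fun y => _) = @circle_pt R \o
    fun y : 'rV[R]_(2 + n.+1) => y ord0 (rshift 2 j)); last first.
    by apply/funext => y /=; rewrite !mxE.
  apply: continuous_comp; first exact: row_entry_continuous.
  exact: circle_pt_continuous.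
exact: (cvg_pair c1 c2).
Qed.

Definition config_chart b : chart R n.+3 config.
Proof.
apply: (@Chart R n.+3 config (config_dom b) (config_map b) config_inv).
- exact: config_dom_open.
- by rewrite config_imageE; exact: config_image_open.
- exact: config_map_continuous.
- by move=> y _; exact: config_inv_continuous.
- exact: config_mapK.
Defined.

Definition config_chart_at x : chart R n.+3 config :=
  config_chart [ffun i => (set_val (x.2 ord0 i)).1 < 0].

Lemma config_chart_at_dom x : cdom (config_chart_at x) x.
Proof.
move=> i; rewrite /circle_dom /= ffunE; set c := (set_val _).1.
by case: ltP => c0; apply/eqP => cE; move: c0; rewrite cE; lra.
Qed.

Lemma config_compatible b b' :
  smooth_compatible (config_chart b) (config_chart b').
Proof.
apply: near_eq_smooth_on => _ [x [/= xb xb'] <-].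
set v : 'rV[R]_(2 + n.+1) := config_map b x.
have h i : exists a, \forall u \near v ord0 (rshift 2 i),
    angle (b' i) (circle_pt u) = u + a.
  apply: (@angle_change _ (b i)); first exact: config_map_image.
  by rewrite row_mxEr mxE angleK.
have /choice[a aP] := h.
exists (fun w : 'rV[R]_(2 + n.+1) => w + row_mx 0 (\row_i a i)).
  exact: translation_smooth.
have := @filter_forall 'rV[R]_(2 + n.+1) 'I_n.+1 (fun i w =>
  angle (b' i) (circle_pt (w ord0 (rshift 2 i))) = w ord0 (rshift 2 i) + a i)
  (nbhs v) (nbhs_filter v).
move=> /(_ (fun i => @row_entry_continuous R (2 + n.+1) (rshift 2 i) v _ (aP i))).
apply: (@filterS _ _ (nbhs_filter _)) => w wa /=.
rewrite -[in RHS](@hsubmxK _ 1 2 n.+1 w) add_row_mx addr0 /config_map /=.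
apply: (congr1 (row_mx (lsubmx (w : 'rV[R]_(2 + n.+1))))).
by apply/rowP => i; rewrite !mxE wa.
Qed.

Lemma config_hausdorff : hausdorff_space config.
Proof.
apply: hausdorff_separated => -[x z] [x' z']; rewrite xpair_eqE negb_and.
have [->/= zz'|xx' _] := eqVneq x x'; last first.
  by exists 'rV[R]_2, fst; split=> //; move=> ?; exact: cvg_fst.
have [i zi] : exists i, z ord0 i != z' ord0 i.
  apply/existsP; apply: contraNT zz'; rewrite negb_exists => /forallP zz'.
  by apply/eqP/rowP => i; apply/eqP; rewrite -[_ == _]negbK zz'.
exists (R * R)%type, (fun y : config => set_val (y.2 ord0 i)).
split=> /=.
- exact: norm_hausdorff.
- move=> y; apply: (@continuous_comp _ _ _ (fun y : config => y.2 ord0 i)).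
    apply: (@continuous_comp _ _ _ snd (fun v : 'rV[circle R]_n.+1 => v ord0 i)).
      exact: cvg_snd.
    exact: row_entry_continuous.
  exact: set_val_continuous.
- by rewrite (inj_eq val_inj).
Qed.

Lemma config_second_countable : @second_countable config.
Proof.
apply: second_countable_prod; apply: second_countable_row.
  exact: second_countable_real.
apply: second_countable_set_type.
by apply: second_countable_prod; exact: second_countable_real.
Qed.

Definition trailer_space : manifold R n.+3.
Proof.
apply: (@Manifold R n.+3 config (range config_chart) config_chart_at).
- by move=> x; exists [ffun i => (set_val (x.2 ord0 i)).1 < 0].
- exact: config_chart_at_dom.
- by move=> _ _ [b _ <-] [b' _ <-]; exact: config_compatible.
- exact: config_hausdorff.
- exact: config_second_countable.
Defined.

End trailer_configuration_space.

(* The fields (tau_1^n, tau_2^n) in the coordinates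
   (xi_1, xi_2, theta_0, ..., theta_n); [lift_field] extends a field by a zero
   component along a new last coordinate. *)
Definition lift_field (R : realType) (m : nat) (X : 'rV[R]_m -> 'rV[R]_m)
    (v : 'rV[R]_m.+1) : 'rV[R]_m.+1 :=
  \row_j (if unlift ord_max j is Some k then X (col' ord_max v) ord0 k else 0).

Fixpoint trailer_coord (R : realType) (n : nat) :
    ('rV[R]_n.+3 -> 'rV[R]_n.+3) * ('rV[R]_n.+3 -> 'rV[R]_n.+3) :=
  match n with
  | 0 =>
    ((fun=> delta_mx ord0 ord_max),
     (fun v : 'rV[R]_3 => sin (v ord0 ord_max) *: delta_mx ord0 1
                          + cos (v ord0 ord_max) *: delta_mx ord0 0))
  | n'.+1 =>
    let tau := trailer_coord R n' in
    ((fun=> delta_mx ord0 ord_max),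
     (fun v : 'rV[R]_n'.+4 =>
        let a := v ord0 ord_max - col' ord_max v ord0 ord_max in
        sin a *: lift_field tau.1 v + cos a *: lift_field tau.2 v))
  end.

(* The transition maps of [trailer_space] are locally translations and the
   components of the trailer fields are 2pi-periodic: the components below do
   not depend on the chart. *)
Definition trailer_tau1 (R : realType) (n : nat) (x : trailer_space R n) :
    'rV[R]_n.+3 :=
  (trailer_coord R n).1 (chart_at x x).

Definition trailer_tau2 (R : realType) (n : nat) (x : trailer_space R n) :
    'rV[R]_n.+3 :=
  (trailer_coord R n).2 (chart_at x x).

Definition trailer_distribution (R : realType) (n : nat)
    (x : trailer_space R n) : {vspace 'rV[R]_n.+3} :=
  <<[:: trailer_tau1 x; trailer_tau2 x]>>%VS.

(* Main.v *)
(* Induction on n.  Near q the Goursat condition provides a frame F_0, ..., F_(n+2)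
   of smooth fields, D spanned by F_0 and F_1, whose first k + 1 rows span the flag
   step k - 1.  When n > 0 (and, formally, already for n = 0, starting from the
   whole tangent space of the plane) some combination of F_0 and F_1 is a Cauchy
   characteristic of the rank-three step D + [D, D]; take it as F_0 and straighten
   it, by its flow, to the last coordinate field.  The rows F_1, F_2 modulo F_0, and
   then successive brackets, become independent of the last coordinate, and project
   to a Goursat frame of one variable less, modelled by g on the (n-1)-trailer.
   The projection of F_1 is then r (sin a tau_1 + cos a tau_2) for a smooth
   angle a, which moves along F_0 because [F_0, F_1] is not in D.  Using
   a + theta_(n-1) as the last coordinate together with g gives the n-trailer.

   Inverse functions and flows are obtained as fixed points of a parametrised
   contraction, in 'rV and in the space of bounded continuous functions, whose
   smooth dependence on the parameter follows by differentiating the fixed-point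
   equation. *)
Require Import Defs.
From HB Require Import structures.
From mathcomp Require Import all_boot all_order all_algebra.
From mathcomp Require Import all_classical all_reals all_analysis.
From mathcomp Require Import ring lra.
From mathcomp Require Import perm.
Set Implicit Arguments.
Unset Strict Implicit.
Unset Printing Implicit Defensive.
Import Order.TTheory GRing.Theory Num.Theory.
Import numFieldNormedType.Exports.
Local Open Scope classical_set_scope.
Local Open Scope ring_scope.

(** * Smooth maps *)

Section differential_estimates.
Context {R : realType}.
Implicit Types V W : normedModType R.

(** The invariants behind the induction are the coordinates [cfb] of the brackets of the frame in
    the frame itself. Changes of frame that are block triangular along the flag preserve the shape
    of these coordinates, so rows can be replaced one at a time. Making the three rows of D + [D, D]
    independent of the last coordinate mixes rows 1 and 2, and the plane D is lost from the new
    frame. This is why the weaker condition [LG 2] exists, and why F_1 is followed beside the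
    normalised frame. Dropping row 0 then shifts the indices by one and turns [LG 2] back into
    [LG 1]. The induction only asks for a map with injective differential that sends D into the
    plane of the model; equality of the planes comes at the end from dimensions. It runs on R^(n+3)
    with real angles, so that no circle enters and the image point is free; the periodicity of the
    model brings the result down to the configuration space. Operators never carry a norm: bounds
    are stated vector by vector, and smoothness through tangent maps, so the same calculus serves
    row vectors and function spaces. *)

Lemma linear_norm_bound V W (f : {linear V -> W}) : continuous f ->
  exists2 k : R, 0 < k & forall h, `|f h| <= k * `|h|.
Proof.
move=> /(_ 0) /continuous_linear_bounded -/(_ 0) /linear_boundedP[y [yr fy]].
exists (`|y| + 1); first by rewrite ltr_pwDr.
by move=> h; apply: fy; rewrite ltr_pwDr// ler_norm.
Qed.

Lemma linear_continuous_norm V W (f : {linear V -> W}) (k : R) :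
  (forall h, `|f h| <= k * `|h|) -> continuous f.
Proof.
move=> fk; apply: bounded_linear_continuous; apply/linear_boundedP.
exists k; split; first exact: num_real.
move=> r kr x; apply: le_trans (fk x) _.
by apply: ler_wpM2r => //; exact: ltW.
Qed.

Lemma differentiable_eps V W (f : V -> W) (x : V) : differentiable f x ->
  forall e : R, 0 < e ->
    \forall h \near (0 : V), `|f (x + h) - f x - 'd f x h| <= e * `|h|.
Proof.
move=> /diff_locallyP[_ /eqaddoP fo] e e0; have := fo e e0.
apply: filterS => h; rewrite !fctE /= [h + x]addrC.
by rewrite opprD addrA.
Qed.

Lemma differentiable_epsP V W (f L : V -> W) (x : V) (k : R) :
  linear L -> (forall h, `|L h| <= k * `|h|) ->
  (forall e : R, 0 < e ->
    \forall h \near (0 : V), `|f (x + h) - f x - L h| <= e * `|h|) ->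
  differentiable f x /\ 'd f x = L :> (V -> W).
Proof.
move=> Llin Lk fo.
pose Lm := GRing.isLinear.Build R V W _ L Llin.
pose LL : {linear V -> W} := HB.pack L Lm.
have Lc : continuous (LL : V -> W) by apply: (@linear_continuous_norm _ _ LL k) => h; exact: Lk.
have fL : f \o shift x = cst (f x) + (LL : V -> W) +o_ 0 id.
  apply/eqaddoP => e e0; apply: filterS (fo e e0) => h.
  by rewrite !fctE /= [h + x]addrC opprD addrA.
have dE : 'd f x = LL :> (V -> W) by exact: diff_unique.
by split; [apply/diff_locallyP; rewrite dE | exact: dE].
Qed.

Lemma diff_norm_bound V W (f : V -> W) (x : V) : differentiable f x ->
  exists2 k : R, 0 < k & forall h, `|'d f x h| <= k * `|h|.
Proof. by move=> fd; apply: linear_norm_bound; exact: diff_continuous. Qed.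

Lemma near_eq_diff V W (f g : V -> W) (x : V) :
  {near x, f =1 g} -> differentiable g x -> 'd f x = 'd g x :> (V -> W).
Proof.
move=> fg gd; have fd := near_eq_differentiable fg gd.
by apply/funext => v; rewrite -!deriveE// (near_eq_derive v fg).
Qed.

End differential_estimates.

Section Ck.
Context {R : realType}.
Implicit Types V W X : normedModType R.

(* The tangent map [z |-> 'd f z.1 z.2] replaces the differential valued in a
   space of operators, so that no norm on operators is needed. *)
Fixpoint Ck (k : nat) V W (U : set V) (f : V -> W) : Prop :=
  match k with
  | 0 => forall x, U x -> {for x, continuous f}
  | k'.+1 => (forall x, U x -> differentiable f x) /\
      @Ck k' (V * V)%type W [set z | U z.1] (fun z => 'd f (z.1) (z.2))
  end.

Definition Cinf V W (U : set V) (f : V -> W) := forall k, Ck k U f.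

Lemma open_fst (S T : topologicalType) (U : set S) :
  open U -> open [set z : S * T | U z.1].
Proof.
move=> oU; rewrite (_ : [set z | _] = fst @^-1` U)//.
by apply: open_comp => // z _; exact: cvg_fst.
Qed.

Lemma CkS k V W (U : set V) (f : V -> W) : Ck k.+1 U f -> Ck k U f.
Proof.
elim: k V W U f => [|k IH] V W U f [fd df].
  by move=> x Ux; apply: differentiable_continuous; exact: fd.
by split => //; apply: IH.
Qed.

Lemma Ck_sub k V W (U U' : set V) (f : V -> W) :
  U' `<=` U -> Ck k U f -> Ck k U' f.
Proof.
elim: k V W U U' f => [|k IH] V W U U' f UU'; first by move=> fc x /UU'; exact: fc.
move=> [fd df]; split; first by move=> x /UU'; exact: fd.
by apply: IH df => z; exact: UU'.
Qed.

Lemma Ck_eq k V W (U : set V) (f g : V -> W) : open U ->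
  (forall x, U x -> f x = g x) -> Ck k U g -> Ck k U f.
Proof.
elim: k V W U f g => [|k IH] V W U f g oU fg.
  move=> gc x Ux.
  have nfg : {near x, f =1 g}.
    by apply: filterS (open_nbhs_nbhs (conj oU Ux)); exact: fg.
  rewrite /prop_for /continuous_at (fg x Ux).
  apply: cvg_trans (gc x Ux); apply: near_eq_cvg.
  by apply: filterS nfg => y ->.
move=> [gd dg].
have nfg x : U x -> {near x, f =1 g}.
  by move=> Ux; apply: filterS (open_nbhs_nbhs (conj oU Ux)); exact: fg.
split=> [x Ux|]; first by apply: near_eq_differentiable (nfg x Ux) _; exact: gd.
apply: IH dg; first exact: open_fst.
by move=> z Uz; rewrite (near_eq_diff (nfg _ Uz))//; exact: gd.
Qed.

Lemma Ck_linear k V W (U : set V) (f : {linear V -> W}) :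
  continuous f -> Ck k U f.
Proof.
elim: k V W U f => [|k IH] V W U f fc; first by move=> x _; exact: fc.
split; first by move=> x _; exact: linear_differentiable.
pose g : V * V -> W := f \o snd.
have gl : linear g by move=> a u v; rewrite /g /= linearP.
pose gm := GRing.isLinear.Build R (V * V)%type W _ g gl.
pose G : {linear (V * V)%type -> W} := HB.pack g gm.
rewrite (_ : (fun z => _) = G); last first.
  by apply/funext => z; rewrite (diff_lin _ fc).
apply: IH => z; apply: (@continuous_comp _ _ _ snd f); first exact: cvg_snd.
exact: fc.
Qed.

Lemma Ck_linearP k V W (U : set V) (f : V -> W) :
  linear f -> continuous f -> Ck k U f.
Proof.
move=> fl fc; pose fm := GRing.isLinear.Build R V W _ f fl.
by pose F : {linear V -> W} := HB.pack f fm; exact: (@Ck_linear k V W U F).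
Qed.

Lemma Ck_fst k V W (U : set (V * W)) : Ck k U (@fst V W).
Proof. by apply: Ck_linearP => // z; exact: cvg_fst. Qed.

Lemma Ck_snd k V W (U : set (V * W)) : Ck k U (@snd V W).
Proof. by apply: Ck_linearP => // z; exact: cvg_snd. Qed.

Lemma Ck_id k V (U : set V) : Ck k U id.
Proof. by apply: Ck_linearP => // z; exact: cvg_id. Qed.

Lemma Ck_cst k V W (U : set V) (c : W) : Ck k U (cst c).
Proof.
elim: k V W U c => [|k IH] V W U c; first by move=> x _; exact: cvg_cst.
split; first by move=> x _; exact: differentiable_cst.
rewrite (_ : (fun z => _) = cst 0); first exact: IH.
by apply/funext => z; rewrite diff_cst.
Qed.

Lemma Ck_pair k V W X (U : set V) (f : V -> W) (g : V -> X) : open U ->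
  Ck k U f -> Ck k U g -> Ck k U (fun x => (f x, g x)).
Proof.
elim: k V W X U f g => [|k IH] V W X U f g oU.
  by move=> fc gc x Ux; apply: cvg_pair; [exact: fc|exact: gc].
move=> [fd df] [gd dg]; split=> [x Ux|].
  by apply: differentiable_pair; [exact: fd|exact: gd].
apply: Ck_eq (IH _ _ _ _ _ _ (open_fst oU) df dg); first exact: open_fst.
by move=> z Uz; rewrite diff_pair//; [exact: fd|exact: gd].
Qed.

Lemma Ck_comp k V W X (U : set V) (U' : set W) (f : V -> W) (g : W -> X) :
  open U -> (forall x, U x -> U' (f x)) ->
  Ck k U f -> Ck k U' g -> Ck k U (g \o f).
Proof.
elim: k V W X U U' f g => [|k IH] V W X U U' f g oU UU'.
  move=> fc gc x Ux; apply: continuous_comp; first exact: fc.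
  by apply: gc; exact: UU'.
move=> [fd df] [gd dg]; split=> [x Ux|].
  by apply: differentiable_comp; [exact: fd|apply: gd; exact: UU'].
have oU1 : open [set z : V * V | U z.1] by exact: open_fst.
pose h (z : V * V) := (f z.1, 'd f (z.1) (z.2)).
have hk : Ck k [set z : V * V | U z.1] h.
  apply: Ck_pair => //.
  have : Ck k [set z : V * V | U z.1] (f \o fst).
    apply: (IH _ _ _ _ U) => //; first exact: Ck_fst.
    by apply: CkS.
  by [].
have := IH _ _ _ _ [set z : W * W | U' z.1] _ _ oU1 _ hk dg.
move=> /(_ (fun z => UU' z.1)).
apply: Ck_eq => // z Uz.
by rewrite diff_comp//; [exact: fd|apply: gd; exact: UU'].
Qed.

Lemma Ck_add k V W (U : set V) (f g : V -> W) : open U ->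
  Ck k U f -> Ck k U g -> Ck k U (fun x => f x + g x).
Proof.
move=> oU fk gk.
have pl : linear (fun z : W * W => z.1 + z.2).
  by move=> a u v /=; rewrite scalerDr addrACA.
have pc : continuous (fun z : W * W => z.1 + z.2).
  by move=> z; apply: cvgD; [exact: cvg_fst|exact: cvg_snd].
exact: (Ck_comp oU (fun _ _ => I) (Ck_pair oU fk gk) (Ck_linearP k setT pl pc)).
Qed.

Lemma diff_bilinear V W X (B : V -> W -> X) (z : V * W) :
  (forall a u u' w, B (a *: u + u') w = a *: B u w + B u' w) ->
  (forall a u w w', B u (a *: w + w') = a *: B u w + B u w') ->
  (exists K : R, forall u w, `|B u w| <= K * `|u| * `|w|) ->
  differentiable (fun z => B z.1 z.2) z /\
    'd (fun z => B z.1 z.2) z = (fun h => B (z.1) (h.2) + B (h.1) (z.2))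
      :> (V * W -> X).
Proof.
move=> Bl Br [K BK].
have BDl u u' w : B (u + u') w = B u w + B u' w.
  by rewrite -[u in LHS]scale1r Bl scale1r.
have BDr u w w' : B u (w + w') = B u w + B u w'.
  by rewrite -[w in LHS]scale1r Br scale1r.
have B0l w : B 0 w = 0 by apply: (addIr (B 0 w)); rewrite -BDl !add0r.
have B0r u : B u 0 = 0 by apply: (addIr (B u 0)); rewrite -BDr !add0r.
have BZl a u w : B (a *: u) w = a *: B u w by rewrite -[a *: u]addr0 Bl B0l addr0.
have BZr a u w : B u (a *: w) = a *: B u w by rewrite -[a *: w]addr0 Br B0r addr0.
pose K' := `|K| + 1.
have K'0 : 0 < K' by rewrite ltr_pwDr.
have BK' u w : `|B u w| <= K' * `|u| * `|w|.
  apply: le_trans (BK u w) _; rewrite -!mulrA ler_wpM2r ?mulr_ge0//.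
  by apply: le_trans (ler_norm K) _; rewrite lerDl.
apply: (@differentiable_epsP _ _ _ _ _ _ (K' * `|z| * 2)).
- move=> a u v /=; rewrite Br Bl scalerDr.
    by rewrite [X in _ = X]addrACA.
- move=> h; apply: le_trans (ler_normD _ _) _.
    have h1 : `|h.1| <= `|h| by rewrite prod_normE le_max lexx.
    have h2 : `|h.2| <= `|h| by rewrite prod_normE le_max lexx orbT.
    have z1 : `|z.1| <= `|z| by rewrite prod_normE le_max lexx.
    have z2 : `|z.2| <= `|z| by rewrite prod_normE le_max lexx orbT.
    rewrite mulrAC mulr_natr mulr2n; apply: lerD.
      apply: le_trans (BK' _ _) _; rewrite -!mulrA ler_pM2l//.
      by apply: ler_pM.
    apply: le_trans (BK' _ _) _; rewrite -!mulrA ler_pM2l//.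
    by rewrite [`|z| * _]mulrC; apply: ler_pM.
- move=> e e0.
    have hK := @nbhs0_le R (V * W)%type (e / K') (divr_gt0 e0 K'0).
    apply: filterS hK => h hK.
    (* The remainder is exactly [B h.1 h.2], which is quadratic in [h]. *)
    have -> : B (z + h).1 (z + h).2 - B z.1 z.2 - (B z.1 h.2 + B h.1 z.2) =
        B h.1 h.2.
      rewrite /= BDl !BDr -addrA -opprD !addrA [_ + B h.1 h.2 - _]addrAC.
      by rewrite subrr add0r.
    apply: le_trans (BK' _ _) _.
    have h1 : `|h.1| <= `|h| by rewrite prod_normE le_max lexx.
    have h2 : `|h.2| <= `|h| by rewrite prod_normE le_max lexx orbT.
    apply: (@le_trans _ _ (K' * `|h| * `|h|)).
      by rewrite -!mulrA ler_pM2l//; apply: ler_pM.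
    by rewrite ler_wpM2r// mulrC -ler_pdivlMr//.
Qed.

Lemma Ck_bilinear k V W X (U : set (V * W)) (B : V -> W -> X) :
  (forall a u u' w, B (a *: u + u') w = a *: B u w + B u' w) ->
  (forall a u w w', B u (a *: w + w') = a *: B u w + B u w') ->
  (exists K : R, forall u w, `|B u w| <= K * `|u| * `|w|) ->
  open U -> Ck k U (fun z => B z.1 z.2).
Proof.
move=> Bl Br BK; have dB z := diff_bilinear z Bl Br BK.
move=> oU; elim: k U oU => [|k IH] U oU.
  by move=> x _; apply: differentiable_continuous; case: (dB x).
split; first by move=> x _; case: (dB x).
have H : Ck k [set z : (V * W) * (V * W) | U z.1]
    (fun z => B z.1.1 z.2.2 + B z.2.1 z.1.2).
  have oU1 := @open_fst _ (V * W)%type _ oU.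
  have fs (S S' T T' : normedModType R) (O : set ((S * T) * (S' * T'))) :
      Ck k O (fun z => z.1.1) /\ Ck k O (fun z => z.2.1) /\
      Ck k O (fun z => z.1.2) /\ Ck k O (fun z => z.2.2).
    do !split; apply: Ck_linearP => //;
      move=> z; apply: (@continuous_comp _ _ _ _ _ z);
      by [exact: cvg_fst|exact: cvg_snd].
  have [f11 [f21 [f12 f22]]] := fs _ _ _ _ [set z : (V * W) * (V * W) | U z.1].
  apply: Ck_add => //.
    exact: (Ck_comp oU1 (fun _ _ => I) (Ck_pair oU1 f11 f22) (IH setT openT)).
  exact: (Ck_comp oU1 (fun _ _ => I) (Ck_pair oU1 f21 f12) (IH setT openT)).
apply: Ck_eq H; first exact: open_fst.
by move=> z _; case: (dB z.1) => _ ->.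
Qed.

Lemma diff_scale V W (a : V -> R) (f : V -> W) (x v : V) :
  differentiable a x -> differentiable f x ->
  'd (fun y => a y *: f y) x v = a x *: 'd f x v + 'd a x v *: f x.
Proof.
move=> ad fd.
have [|||sd sE] := @diff_bilinear R W W (fun a w => a *: w) (a x, f x).
- by move=> b u u' w; rewrite scalerDl scalerA.
- by move=> b u w w'; rewrite scalerDr !scalerA mulrC.
- by exists 1 => u w; rewrite mul1r normrZ.
have pd : differentiable (fun y => (a y, f y)) x by exact: differentiable_pair.
pose S (z : R * W) := z.1 *: z.2.
have E : 'd (S \o (fun y => (a y, f y))) x =
  'd S (a x, f x) \o 'd (fun y => (a y, f y)) x :> (V -> W) by exact: diff_comp.
rewrite [LHS](congr1 (fun F => F v) E) /=.
have pE := diff_pair ad fd.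
have pv : 'd (fun y => (a y, f y)) x v = ('d a x v, 'd f x v).
  exact: (congr1 (fun F => F v) pE).
rewrite pv; exact: (congr1 (fun F => F ('d a x v, 'd f x v)) sE).
Qed.

Lemma Ck_scale k V W (U : set V) (a : V -> R) (f : V -> W) : open U ->
  Ck k U a -> Ck k U f -> Ck k U (fun x => a x *: f x).
Proof.
move=> oU ak fk.
have H : Ck k [set: R * W] (fun z => z.1 *: z.2).
  apply: Ck_bilinear => //.
  - by move=> b u u' w; rewrite scalerDl scalerA.
  - by move=> b u w w'; rewrite scalerDr !scalerA mulrC.
  - by exists 1 => u w; rewrite mul1r normrZ.
  - exact: openT.
exact: (Ck_comp oU (fun _ _ => I) (Ck_pair oU ak fk) H).
Qed.

Lemma Cinf_tangent V W (U : set V) (f : V -> W) : Cinf U f <->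
  (forall x, U x -> differentiable f x) /\
  Cinf [set z : V * V | U z.1] (fun z => 'd f (z.1) (z.2)).
Proof.
split=> [fi|[fd df] [|k]]; last by split => //; exact: df.
  by split; [case: (fi 1)|move=> k; case: (fi k.+1)].
by move=> x /fd; exact: differentiable_continuous.
Qed.

End Ck.

Section Cinf_rules.
Context {R : realType}.
Implicit Types V W X : normedModType R.

Lemma Cinf_sub V W (U U' : set V) (f : V -> W) :
  U' `<=` U -> Cinf U f -> Cinf U' f.
Proof. by move=> UU' fi k; exact: Ck_sub UU' (fi k). Qed.

Lemma Cinf_eq V W (U : set V) (f g : V -> W) : open U ->
  (forall x, U x -> f x = g x) -> Cinf U g -> Cinf U f.
Proof. by move=> oU fg gi k; exact: Ck_eq oU fg (gi k). Qed.

Lemma Cinf_differentiable V W (U : set V) (f : V -> W) x :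
  Cinf U f -> U x -> differentiable f x.
Proof. by move=> /(_ 1)[fd _] /fd. Qed.

Lemma Cinf_continuous V W (U : set V) (f : V -> W) x :
  Cinf U f -> U x -> {for x, continuous f}.
Proof. by move=> /(_ 0); apply. Qed.

Lemma Cinf_linear V W (U : set V) (f : V -> W) :
  linear f -> continuous f -> Cinf U f.
Proof. by move=> fl fc k; exact: Ck_linearP. Qed.

Lemma Cinf_id V (U : set V) : Cinf U id.
Proof. by move=> k; exact: Ck_id. Qed.

Lemma Cinf_fst V W (U : set (V * W)) : Cinf U (@fst V W).
Proof. by move=> k; exact: Ck_fst. Qed.

Lemma Cinf_snd V W (U : set (V * W)) : Cinf U (@snd V W).
Proof. by move=> k; exact: Ck_snd. Qed.

Lemma Cinf_cst V W (U : set V) (c : W) : Cinf U (fun=> c).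
Proof. by move=> k; exact: Ck_cst. Qed.

Section open_domain.
Variables (V : normedModType R) (U : set V).
Hypothesis oU : open U.

Lemma Cinf_pair W X (f : V -> W) (g : V -> X) :
  Cinf U f -> Cinf U g -> Cinf U (fun x => (f x, g x)).
Proof. by move=> fi gi k; exact: Ck_pair. Qed.

Lemma Cinf_comp W X (U' : set W) (f : V -> W) (g : W -> X) :
  (forall x, U x -> U' (f x)) ->
  Cinf U f -> Cinf U' g -> Cinf U (fun x => g (f x)).
Proof. by move=> UU' fi gi k; exact: (Ck_comp oU UU' (fi k) (gi k)). Qed.

Lemma Cinf_add W (f g : V -> W) :
  Cinf U f -> Cinf U g -> Cinf U (fun x => f x + g x).
Proof. by move=> fi gi k; exact: Ck_add. Qed.

Lemma Cinf_scale W (a : V -> R) (f : V -> W) :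
  Cinf U a -> Cinf U f -> Cinf U (fun x => a x *: f x).
Proof. by move=> fi gi k; exact: Ck_scale. Qed.

Lemma Cinf_opp W (f : V -> W) : Cinf U f -> Cinf U (fun x => - f x).
Proof.
move=> fi; apply: Cinf_eq oU _ (Cinf_scale (@Cinf_cst _ _ _ (-1 : R)) fi).
by move=> x _; rewrite scaleN1r.
Qed.

Lemma Cinf_subr W (f g : V -> W) :
  Cinf U f -> Cinf U g -> Cinf U (fun x => f x - g x).
Proof. by move=> fi gi; apply: Cinf_add => //; exact: Cinf_opp. Qed.

Lemma Cinf_sum W (I : Type) (r : seq I) (P : pred I) (f : I -> V -> W) :
  (forall i, P i -> Cinf U (f i)) -> Cinf U (fun x => \sum_(i <- r | P i) f i x).
Proof.
move=> fi; elim: r => [|i r IH].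
  by apply: Cinf_eq oU _ (@Cinf_cst _ _ _ 0) => x _; rewrite big_nil.
case Pi : (P i); last by apply: Cinf_eq oU _ IH => x _; rewrite big_cons Pi.
apply: Cinf_eq oU _ (Cinf_add (fi i Pi) IH) => x _.
by rewrite big_cons Pi.
Qed.

Lemma Cinf_mul (f g : V -> R) :
  Cinf U f -> Cinf U g -> Cinf U (fun x => f x * g x).
Proof. exact: Cinf_scale. Qed.

Lemma Cinf_prod (I : Type) (r : seq I) (P : pred I) (f : I -> V -> R) :
  (forall i, P i -> Cinf U (f i)) -> Cinf U (fun x => \prod_(i <- r | P i) f i x).
Proof.
move=> fi; elim: r => [|i r IH].
  by apply: Cinf_eq oU _ (@Cinf_cst V R U 1) => x _; rewrite big_nil.
case Pi : (P i); last by apply: Cinf_eq oU _ IH => x _; rewrite big_cons Pi.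
apply: Cinf_eq oU _ (Cinf_mul (fi i Pi) IH) => x _.
by rewrite big_cons Pi.
Qed.

End open_domain.

Lemma Ck_real_derive k (U : set R) (f f' : R -> R) : open U ->
  (forall x, U x -> is_derive x 1 f (f' x)) -> Ck k U f' -> Ck k.+1 U f.
Proof.
move=> oU ff' f'k.
have fd x : U x -> differentiable f x.
  by move=> /ff'[fd _]; apply/derivable1_diffP.
split=> //.
have oU1 := @open_fst _ R _ oU.
have H : Ck k [set z : R * R | U z.1] (fun z => z.2 *: f' z.1).
  apply: Ck_scale => //; first exact: Ck_snd.
  have F := @Ck_fst R k R R [set z : R * R | U z.1].
  exact: (@Ck_comp R k _ _ _ _ U fst f' oU1 (fun _ h => h) F f'k).
apply: Ck_eq oU1 _ H => z Uz.
have [fz fE] := ff' _ Uz.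
by rewrite deriv1E// derive1E fE.
Qed.

Lemma Cinf_sin_cos (U : set R) : open U -> Cinf U (@sin R) /\ Cinf U (@cos R).
Proof.
(* Both at once, since each is the derivative of the other up to sign. *)
move=> oU; suff H k : Ck k U (@sin R) /\ Ck k U (@cos R).
  by split=> k; case: (H k).
elim: k => [|k [sk ck]].
  by split=> x _; [exact: continuous_sin|exact: continuous_cos].
split.
  apply: (@Ck_real_derive _ _ _ (@cos R)) => // x _; exact: is_derive_sin.
apply: (@Ck_real_derive _ _ _ (fun x => - sin x)) => //.
apply: (@Ck_eq _ _ _ _ _ _ (fun x => (-1 : R) *: (sin x : R))) => //.
  by move=> x _; rewrite scaleN1r.
by apply: Ck_scale => //; exact: Ck_cst.
Qed.

Lemma open_neq0 : open [set x : R | x != 0].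
Proof. exact: open_neq. Qed.

(** The derivative is a polynomial in the inverse itself, so each order of smoothness gives the next
    one. *)
Lemma Cinf_inv : Cinf [set x : R | x != 0] (@GRing.inv R).
Proof.
elim=> [|k IH]; first by move=> x /= x0; exact: inv_continuous.
apply: (@Ck_real_derive _ _ _ (fun x => - (x^-1 * x^-1))).
- exact: open_neq0.
- move=> x /= x0.
  have H := @is_deriveV R (fun y => y) x 1 1 x0 (is_derive_id _ _).
  apply: (is_derive_eq H).
  by rewrite /GRing.scale /= mulr1 expr2 invfM.
- apply: (@Ck_eq _ _ _ _ _ _ (fun x : R => (-1 : R) *: (x^-1 *: (x^-1 : R)))).
  + exact: open_neq0.
  + by move=> x _; rewrite scaleN1r.
  + apply: Ck_scale; [exact: open_neq0|exact: Ck_cst|].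
    by apply: Ck_scale => //; exact: open_neq0.
Qed.

Lemma Cinf_invr V (U : set V) (f : V -> R) : open U ->
  (forall x, U x -> f x != 0) -> Cinf U f -> Cinf U (fun x => (f x)^-1).
Proof. by move=> oU f0 fi; exact: (@Cinf_comp _ _ oU _ _ [set x | x != 0] f _ f0 fi Cinf_inv). Qed.

Lemma Cinf_atan : Cinf setT (@atan R).
Proof.
have H : Cinf setT (fun x : R => (1 + x ^+ 2)^-1).
  apply: Cinf_invr; first exact: openT.
    by move=> x _; rewrite gt_eqF// ltr_pwDl// sqr_ge0.
  apply: Cinf_add; [exact: openT|exact: Cinf_cst|].
  by apply: Cinf_mul; [exact: openT|exact: Cinf_id|exact: Cinf_id].
case=> [|k]; first by move=> x _; exact: continuous_atan.
by apply: (@Ck_real_derive _ _ _ (fun x : R => (1 + x ^+ 2)^-1)) => //; exact: openT.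
Qed.

End Cinf_rules.

Section matrix_valued.
Context {R : realType}.
Implicit Types V W : normedModType R.

Lemma mx_coord_Cinf m n (U : set 'M[R]_(m, n)) i j :
  Cinf U (fun M : 'M[R]_(m, n) => M i j : R).
Proof.
apply: Cinf_linear; first by move=> a u v; rewrite !mxE.
exact: coord_continuous.
Qed.

(** The map is a finite combination of coordinate functions with constant coefficients, so linearity
    alone gives smoothness. *)
Lemma Cinf_linear_mx W m n (U : set 'M[R]_(m, n)) (f : 'M[R]_(m, n) -> W) :
  linear f -> Cinf U f.
Proof.
move=> fl; pose fm := GRing.isLinear.Build R _ _ _ f fl.
pose F : {linear 'M[R]_(m, n) -> W} := HB.pack f fm.
apply: (@Cinf_sub _ _ _ setT) => //.
apply: (@Cinf_eq _ _ _ setT _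
  (fun M : 'M[R]_(m, n) => \sum_i \sum_j M i j *: f (delta_mx i j))).
- exact: openT.
- move=> M _; rewrite {1}(matrix_sum_delta M) [LHS](linear_sum F).
  apply: eq_bigr => i _; rewrite linear_sum; apply: eq_bigr => j _.
  by rewrite linearZ.
- apply: Cinf_sum; first exact: openT.
  move=> i _; apply: Cinf_sum; first exact: openT.
  move=> j _; apply: Cinf_scale; first exact: openT.
    exact: mx_coord_Cinf.
  exact: Cinf_cst.
Qed.

Lemma Cinf_mxP V m n (U : set V) (f : V -> 'M[R]_(m, n)) : open U ->
  (forall i j, Cinf U (fun x => f x i j : R)) -> Cinf U f.
Proof.
move=> oU fi; apply: (@Cinf_eq _ _ _ _ _
  (fun x => \sum_i \sum_j f x i j *: delta_mx i j)) => //.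
  by move=> x _; exact: matrix_sum_delta.
apply: Cinf_sum => // i _; apply: Cinf_sum => // j _.
by apply: Cinf_scale => //; exact: Cinf_cst.
Qed.

Lemma Cinf_coord V m n (U : set V) (f : V -> 'M[R]_(m, n)) i j : open U ->
  Cinf U f -> Cinf U (fun x => f x i j : R).
Proof.
move=> oU fi; exact: (Cinf_comp oU (fun _ _ => I) fi (@mx_coord_Cinf m n setT i j)).
Qed.

Lemma Cinf_mulmx V m n p (U : set V) (f : V -> 'M[R]_(m, n))
    (g : V -> 'M[R]_(n, p)) : open U ->
  Cinf U f -> Cinf U g -> Cinf U (fun x => f x *m g x).
Proof.
move=> oU fi gi; apply: Cinf_mxP => // i j.
apply: (@Cinf_eq _ _ _ _ _ (fun x => \sum_k f x i k * g x k j)) => //.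
  by move=> x _; rewrite mxE.
by apply: Cinf_sum => // k _; apply: Cinf_mul => //; apply: Cinf_coord.
Qed.

Lemma Cinf_det V n (U : set V) (f : V -> 'M[R]_n) : open U ->
  Cinf U f -> Cinf U (fun x => \det (f x) : R).
Proof.
move=> oU fi; apply: Cinf_sum => // s _; apply: Cinf_mul => //.
  exact: Cinf_cst.
by apply: Cinf_prod => // i _; apply: Cinf_coord.
Qed.

(** Cramer's rule: the determinant and the cofactors are polynomial in the entries. *)
Lemma Cinf_invmx V n (U : set V) (f : V -> 'M[R]_n) : open U ->
  (forall x, U x -> f x \in unitmx) ->
  Cinf U f -> Cinf U (fun x => invmx (f x)).
Proof.
move=> oU fu fi; apply: (@Cinf_eq _ _ _ _ _
  (fun x => (\det (f x))^-1 *: \adj (f x))) => //.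
  by move=> x Ux; rewrite /invmx fu.
apply: Cinf_scale => //.
  apply: Cinf_invr => //; last exact: Cinf_det.
  by move=> x /fu; rewrite unitmxE unitfE.
apply: Cinf_mxP => // i j.
apply: (@Cinf_eq _ _ _ _ _ (fun x => cofactor (f x) j i)) => //.
  by move=> x _; rewrite mxE.
apply: Cinf_mul => //; first exact: Cinf_cst.
apply: Cinf_det => //; apply: Cinf_mxP => // k l.
apply: (@Cinf_eq _ _ _ _ _ (fun x => f x (lift j k) (lift i l))) => //.
  by move=> x _; rewrite !mxE.
exact: Cinf_coord.
Qed.

End matrix_valued.

Section directional_derivatives.
Context {R : realType}.
Implicit Types V W X : normedModType R.

Lemma Cinf_diff_dir V W X (U : set V) (U' : set W) (f : W -> X)
    (g h : V -> W) : open U -> (forall x, U x -> U' (g x)) ->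
  Cinf U' f -> Cinf U g -> Cinf U h -> Cinf U (fun x => 'd f (g x) (h x) : X).
Proof.
move=> oU UU' /Cinf_tangent[_ df] gi hi.
exact: (Cinf_comp oU _ (Cinf_pair oU gi hi) df).
Qed.

Lemma Cinf_derive V W (U : set V) (f : V -> W) v : open U ->
  Cinf U f -> Cinf U ('D_v f).
Proof.
move=> oU fi; apply: (@Cinf_eq _ _ _ _ _ (fun x => 'd f x v)) => //.
  by move=> x Ux; rewrite deriveE//; exact: Cinf_differentiable Ux.
apply: (@Cinf_diff_dir V V W U U f (fun x => x) (fun=> v)) => //.
  exact: Cinf_id.
exact: Cinf_cst.
Qed.

Lemma Cinf_smooth_on V W (U : set V) (f : V -> W) : open U ->
  Cinf U f -> smooth_on U f.
Proof.
move=> oU fi vs x Ux.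
suff : Cinf U (iter_derive vs f) by move=> /Cinf_differentiable; exact.
by elim: vs => [//|v vs IH] /=; exact: Cinf_derive.
Qed.

Lemma diff_sum_coord W m (f : 'rV[R]_m -> W) (x v : 'rV[R]_m) :
  differentiable f x ->
  'd f x v = \sum_j v 0 j *: 'D_(delta_mx 0 j) f x.
Proof.
move=> fd; rewrite {1}(row_sum_delta v) linear_sum; apply: eq_bigr => j _.
by rewrite linearZ deriveE.
Qed.

(** In finite dimension the tangent map is the sum of the partial derivatives weighted by the
    coordinates of the vector. So the directional notion [smooth_on], used for manifolds, yields the
    tangent-map notion [Cinf]; [Cinf_smooth_on] is the converse. *)
Lemma smooth_on_Cinf W m (U : set 'rV[R]_m) (f : 'rV[R]_m -> W) : open U ->
  smooth_on U f -> Cinf U f.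
Proof.
move=> oU fs k; elim: k f fs => [|k IH] f fs.
  by move=> x Ux; apply: differentiable_continuous; exact: (fs [::]).
have fd x : U x -> differentiable f x by move=> Ux; exact: (fs [::]).
split=> //; have oU1 := @open_fst _ 'rV[R]_m _ oU.
apply: (@Ck_eq _ _ _ _ _ _
  (fun z : 'rV[R]_m * 'rV[R]_m => \sum_j z.2 0 j *: 'D_(delta_mx 0 j) f z.1)) => //.
  by move=> z Uz; rewrite diff_sum_coord//; exact: fd.
elim: (index_enum _) => [|j r IHr].
  by apply: (Ck_eq oU1 _ (@Ck_cst _ _ _ _ _ 0)) => z _; rewrite big_nil.
have H : Ck k [set z : 'rV[R]_m * 'rV[R]_m | U z.1]
    (fun z => z.2 0 j *: 'D_(delta_mx 0 j) f z.1).
  apply: Ck_scale => //.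
    have C := @mx_coord_Cinf R 1 m setT 0 j k.
    have F := @Ck_snd R k _ _ [set z : 'rV[R]_m * 'rV[R]_m | U z.1].
    exact: (@Ck_comp R k _ _ _ _ setT snd (fun M : 'rV[R]_m => M 0 j : R) oU1 (fun _ _ => I) F C).
  have : Ck k U ('D_(delta_mx 0 j) f).
    apply: IH => vs x Ux.
    (* [rcons] puts the new direction innermost, so the iterated derivatives of a partial derivative
       of [f] are iterated derivatives of [f]. *)
    have := fs (rcons vs (delta_mx 0 j)) x Ux.
    by rewrite /iter_derive -cats1 foldr_cat.
  have F := @Ck_fst R k _ _ [set z : 'rV[R]_m * 'rV[R]_m | U z.1].
  exact: (@Ck_comp R k _ _ _ _ U fst _ oU1 (fun _ h => h) F).
apply: (Ck_eq oU1 _ (Ck_add oU1 H IHr)) => z _.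
by rewrite big_cons.
Qed.

End directional_derivatives.

(** * Mean value estimates and strict differentiability *)

Section mean_value.
Context {R : realType}.
Implicit Types V W : normedModType R.

Lemma mx_norm_leP m n (M : 'M[R]_(m, n)) (K : R) : 0 <= K ->
  (forall i j, `|M i j| <= K) -> `|M| <= K.
Proof.
move=> K0 MK; rewrite /Num.norm /= mx_normrE; by apply/bigmax_leP; split => // -[i j] _; exact: MK.
Qed.

Lemma mx_coord_norm_le m n (M : 'M[R]_(m, n)) i j : `|M i j| <= `|M|.
Proof.
rewrite [leRHS]/Num.norm /= mx_normrE.
exact: (@le_bigmax _ _ _ 0 (fun ij : 'I_m * 'I_n => `|M ij.1 ij.2|) (i, j)).
Qed.

Lemma norm_fst_le V W (z : V * W) : `|z.1| <= `|z|.
Proof. by rewrite prod_normE le_max lexx. Qed.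

Lemma norm_snd_le V W (z : V * W) : `|z.2| <= `|z|.
Proof. by rewrite prod_normE le_max lexx orbT. Qed.

Lemma norm_pair_le V W (z : V * W) (K : R) : `|z.1| <= K -> `|z.2| <= K ->
  `|z| <= K.
Proof. by move=> h1 h2; rewrite prod_normE ge_max h1. Qed.

Lemma norm_pair_lt V W (z : V * W) (K : R) : `|z.1| < K -> `|z.2| < K ->
  `|z| < K.
Proof. by move=> h1 h2; rewrite prod_normE gt_max h1. Qed.

Lemma is_derive_line V W (f : V -> W) (x v : V) (t : R) :
  differentiable f (x + t *: v) ->
  is_derive t (1 : R) (fun s : R => f (x + s *: v)) ('d f (x + t *: v) v).
Proof.
move=> fd.
have ld : is_derive t (1 : R) (fun s : R => x + s *: v) v.
  have H : is_derive t (1 : R) (fun s : R => s *: v) v.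
    have lin : linear (fun s : R => s *: v).
      by move=> a b c; rewrite scalerDl scalerA.
    have nv h : `|h *: v| <= `|v| * `|h| by rewrite normrZ mulrC.
    have ev (e : R) : 0 < e -> \forall h \near (0 : R),
        `|(t + h) *: v - t *: v - h *: v| <= e * `|h|.
      move=> e0; apply/nbhs_ballP; exists 1 => //= h _.
      by rewrite scalerDl addrAC addrK subrr normr0 mulr_ge0// ltW.
    have [dd dE] := @differentiable_epsP R R V (fun s => s *: v)
      (fun s => s *: v) t `|v| lin nv ev.
    split; first exact: diff_derivable.
    by rewrite deriveE// dE scale1r.
  by have := is_deriveD (is_derive_cst x t 1) H; rewrite add0r; apply.
have ldd : differentiable (fun s : R => x + s *: v) t.
  by apply/derivable1_diffP; case: ld.
have cd : differentiable (f \o (fun s : R => x + s *: v)) t.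
  exact: differentiable_comp.
split; first exact: diff_derivable.
rewrite deriveE// diff_comp//=; congr ('d f _ _).
by rewrite -deriveE//; case: ld.
Qed.

(** The norm of a row is the largest absolute value of its entries, so the real mean value theorem
    applied to each entry loses no constant. *)
Lemma mean_value_norm V n (f : V -> 'rV[R]_n) (x v : V) (K : R) :
  (forall t : R, 0 <= t <= 1 -> differentiable f (x + t *: v)) ->
  (forall t : R, 0 <= t <= 1 -> `|'d f (x + t *: v) v| <= K) ->
  `|f (x + v) - f x| <= K.
Proof.
move=> fd fK.
have K0 : 0 <= K.
  by apply: le_trans (fK 0 _) => //; rewrite lexx ler01.
apply: mx_norm_leP => // i j; rewrite (ord1 i) {i}.
pose phi (t : R) : R := f (x + t *: v) 0 j.
have dphi (t : R) : 0 <= t <= 1 ->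
    is_derive t (1 : R) phi (('d f (x + t *: v) v) 0 j).
  move=> t01; have [dl dE] := is_derive_line (fd _ t01).
  have fd' : differentiable (fun s : R => f (x + s *: v)) t.
    by apply/derivable1_diffP.
  have cl : linear (fun M : 'rV[R]_n => M 0 j : R).
    by move=> a A B; rewrite !mxE.
  pose cm := GRing.isLinear.Build R _ _ _ _ cl.
  pose C : {linear 'rV[R]_n -> R} := HB.pack (fun M : 'rV[R]_n => M 0 j : R) cm.
  have cc : continuous C by exact: coord_continuous.
  have cd : differentiable (C \o (fun s : R => f (x + s *: v))) t.
    by apply: differentiable_comp => //; exact: linear_differentiable.
  split; first by apply: diff_derivable; exact: cd.
  rewrite [LHS](deriveE _ cd) diff_comp//; last exact: linear_differentiable.
  by rewrite diff_lin//= -deriveE// dE.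
have [|||c c01] := @MVT_segment R phi (fun t => ('d f (x + t *: v) v) 0 j) 0 1.
- exact: ler01.
- by move=> t; rewrite in_itv /= => /andP[t0 t1]; apply: dphi; rewrite !ltW.
- apply: derivable_within_continuous => t; rewrite in_itv /= => t01.
  by case: (dphi t t01).
rewrite /phi scale1r scale0r addr0 subr0 mulr1 => cE.
rewrite mxE [X in _ + X]mxE cE; apply: le_trans (mx_coord_norm_le _ _ _) _.
by apply: fK; move: c01; rewrite in_itv.
Qed.

(** Continuity of the differential in operator norm, extracted from the differentiability of the
    tangent map at the single point [(x, 0)]. By linearity in [w] it is enough to treat vectors of
    one fixed length. *)
Lemma diff_norm_continuous V W (U : set V) (f : V -> W) (x : V) (e : R) :
  open U -> Cinf U f -> U x -> 0 < e ->
  \forall y \near x, forall w, `|'d f y w - 'd f x w| <= e * `|w|.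
Proof.
move=> oU /Cinf_tangent[_ dfi] Ux e0.
pose g (z : V * V) := 'd f (z.1) (z.2).
have gd : differentiable g (x, 0) by exact: (Cinf_differentiable dfi).
have e3 : 0 < e / 3 by rewrite divr_gt0.
have /nbhs_normP[d /= d0 dP] := differentiable_eps gd e3.
have {}dP (h : V * V) : `|h| < d ->
    `|g ((x, 0) + h) - g (x, 0) - 'd g (x, 0) h| <= e / 3 * `|h|.
  by move=> hd; apply: dP; rewrite /= sub0r normrN.
have d2 : 0 < d / 2 by rewrite divr_gt0.
have d2d : d / 2 < d by rewrite ltr_pdivrMr// ltr_pMr// ltr1n.
apply/nbhs_normP; exists (d / 2) => //= y yd w.
have [->|w0] := eqVneq w 0; first by rewrite (linear0 ('d f y)) (linear0 ('d f x)) subr0 !normr0 mulr0.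
have wn : 0 < `|w| by rewrite normr_gt0.
(* [b] is [w] rescaled to norm [d / 2], which puts the three increments [(a, b)], [(a, 0)] and
   [(0, b)] within reach of the estimate. *)
pose c := d / 2 / `|w|.
have c0 : 0 < c by rewrite divr_gt0.
pose b := c *: w; pose a := y - x.
have bn : `|b| = d / 2 by rewrite normrZ gtr0_norm// divfK// gt_eqF.
have an : `|a| < d / 2 by rewrite /a distrC.
have ab : `|((a, b) : V * V)| <= d / 2.
  by apply: norm_pair_le => /=; [exact: ltW|rewrite bn].
have a0 : `|((a, 0) : V * V)| <= d / 2.
  by apply: norm_pair_le => /=; [exact: ltW|rewrite normr0 ltW].
have b0 : `|((0, b) : V * V)| <= d / 2.
  by apply: norm_pair_le => /=; [rewrite normr0 ltW|rewrite bn].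
have gx0 u : g (u, 0) = 0 by rewrite /g linear0.
have xa : x + a = y by rewrite /a addrC subrK.
have H1 := dP (a, b) (le_lt_trans ab d2d).
have H2 := dP (a, 0) (le_lt_trans a0 d2d).
have H3 := dP (0, b) (le_lt_trans b0 d2d).
have dab : 'd g (x, 0) (a, b) = 'd g (x, 0) (a, 0) + 'd g (x, 0) (0, b).
  by rewrite -linearD /=; congr ('d g _ (_, _)); rewrite ?addr0 ?add0r.
have p1 : (x, 0) + (a, b) = (y, b) :> V * V by congr (_, _); rewrite //= add0r.
have p2 : (x, 0) + (a, 0) = (y, 0) :> V * V by congr (_, _); rewrite //= add0r.
have p3 : (x, 0) + (0, b) = (x, b) :> V * V.
  by congr (_, _); rewrite /= ?add0r ?addr0.
move: H1 H2 H3; rewrite p1 p2 p3 !gx0 !subr0 sub0r normrN dab.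
set A := g (y, b); set B := g (x, b); set p := 'd g _ _; set q := 'd g _ _.
move=> H1 H2 H3.
(* The first order terms of the three increments cancel and the tangent map vanishes at [(y, 0)];
   three errors of weight [e / 3] remain. *)
have H : `|A - B| <= e * (d / 2).
  have -> : A - B = (A - (p + q)) + p + (- (B - q)).
    by rewrite opprB opprD [A + (- p - q)]addrA [A - p - q + p]addrAC subrK addrA subrK.
  apply: le_trans (ler_normD _ _) _; rewrite normrN.
  have : e * (d / 2) = e / 3 * (d / 2) + e / 3 * (d / 2) + e / 3 * (d / 2).
    by field.
  move=> ->; apply: lerD; last first.
    by apply: le_trans H3 _; rewrite ler_pM2l.
  apply: le_trans (ler_normD _ _) _; apply: lerD.
    by apply: le_trans H1 _; rewrite ler_pM2l.
  by apply: le_trans H2 _; rewrite ler_pM2l.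
move: H; rewrite /A /B /g /= /b (linearZ_LR ('d f y)) (linearZ_LR ('d f x)).
rewrite -scalerBr normrZ gtr0_norm//.
rewrite mulrC -ler_pdivlMr// => H; apply: le_trans H _.
by rewrite /c invfM invrK mulrA -[e * _ * _]mulrA divff ?gt_eqF// mulr1.
Qed.

(** The mean value inequality for [f - 'd f x], whose differential is small near [x]. Both endpoints
    vary, which differentiability at [x] alone would not allow. *)
Lemma strictly_differentiable V n (U : set V) (f : V -> 'rV[R]_n) (x : V)
    (e : R) : open U -> Cinf U f -> U x -> 0 < e ->
  exists2 r : R, 0 < r & forall y z, `|y - x| < r -> `|z - x| < r ->
    `|f z - f y - 'd f x (z - y)| <= e * `|z - y|.
Proof.
move=> oU fi Ux e0.
have : \forall y \near x, U y /\
    forall w, `|'d f y w - 'd f x w| <= e * `|w|.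
  apply: filterI; first exact: open_nbhs_nbhs.
  exact: diff_norm_continuous Ux e0.
move=> /nbhs_normP[d /= d0 dP]; exists d => // y z yd zd.
have seg t : 0 <= t <= 1 -> `|x - (y + t *: (z - y))| < d.
  move=> /andP[t0 t1].
  have -> : x - (y + t *: (z - y)) = - ((1 - t) *: (y - x) + t *: (z - x)).
    have -> : z - y = (z - x) - (y - x) by rewrite opprB addrA subrK.
    rewrite -{1}(subrK x y) scalerBr scalerBl scale1r.
    set p := y - x; set w := z - x.
    rewrite [p + x]addrC -addrA opprD addrA subrr sub0r; congr (- _).
    by rewrite addrA addrAC.
  rewrite normrN; apply: le_lt_trans (ler_normD _ _) _.
  rewrite !normrZ (ger0_norm t0) ger0_norm ?subr_ge0//.
  have [->|tn1] := eqVneq t 1; first by rewrite subrr mul0r add0r mul1r.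
  have t1' : 0 < 1 - t by rewrite subr_gt0 lt_neqAle tn1.
  rewrite [ltRHS](_ : d = (1 - t) * d + t * d); last by ring.
  apply: ltr_leD.
    by rewrite ltr_pM2l.
  by rewrite ler_wpM2l// ltW.
pose h u := f u - 'd f x u.
have fdx : differentiable f x by exact: (Cinf_differentiable fi).
have dl : forall u, differentiable ('d f x) u.
  by move=> u; apply: linear_differentiable; exact: diff_continuous.
have dh t : 0 <= t <= 1 -> differentiable h (y + t *: (z - y)) /\
    'd h (y + t *: (z - y)) (z - y) =
      'd f (y + t *: (z - y)) (z - y) - 'd f x (z - y).
  move=> /seg/dP[Uu _].
  have fdu := Cinf_differentiable fi Uu.
  split; first by apply: differentiableB => //; exact: fdu.
  have E := diffB fdu (dl (y + t *: (z - y))).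
  rewrite [LHS](congr1 (fun F => F (z - y)) E).
  have dE : 'd ('d f x) (y + t *: (z - y)) = 'd f x :> (V -> 'rV[R]_n).
    by apply: diff_lin; exact: diff_continuous.
  exact: (congr1 (fun F => 'd f (y + t *: (z - y)) (z - y) - F (z - y)) dE).
have H := @mean_value_norm V n h y (z - y) (e * `|z - y|).
have -> : f z - f y - 'd f x (z - y) = h (y + (z - y)) - h y.
  by rewrite [y + _]addrC subrK /h linearB !opprD !opprK addrACA.
apply: H => t t01; first by case: (dh t t01).
by case: (dh t t01) => _ ->; case: (dP _ (seg t t01)) => _; apply.
Qed.

End mean_value.

(** * Symmetry of second derivatives *)

Section second_derivatives.
Context {R : realType}.
Implicit Types V W : normedModType R.

Lemma real_mean_value_le (phi phi' : R -> R) (s K : R) : 0 <= s ->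
  (forall t, 0 <= t <= s -> is_derive t 1 phi (phi' t)) ->
  (forall t, 0 <= t <= s -> `|phi' t| <= K) ->
  `|phi s - phi 0| <= K * s.
Proof.
move=> s0 dphi phiK.
have [|||c cs ->] := @MVT_segment R phi phi' 0 s.
- exact: s0.
- by move=> t; rewrite in_itv /= => /andP[t0 t1]; apply: dphi; rewrite !ltW.
- apply: derivable_within_continuous => t; rewrite in_itv /= => t01.
  by case: (dphi t t01).
rewrite subr0 normrM (ger0_norm s0) ler_wpM2r//; apply: phiK.
by move: cs; rewrite in_itv.
Qed.

(* The second difference of [f] along [a] and [b] is [s ^+ 2 * c + o(s ^+ 2)]
   with [c] a mixed derivative; being symmetric in [a] and [b], it determines
   both mixed derivatives. *)
Lemma second_difference V (U : set V) (f : V -> R) (x a b : V) (e : R) :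
  open U -> Cinf U f -> U x -> 0 < e ->
  \forall s \near (0 : R)^'+,
    `|f (x + s *: a + s *: b) - f (x + s *: a) - (f (x + s *: b) - f x)
      - s ^+ 2 * 'd (fun y => 'd f y a) x b| <= e * s ^+ 2.
Proof.
move=> oU fi Ux e0; pose g y := 'd f y a.
have gi : Cinf U g.
  by apply: (@Cinf_diff_dir R V V R U U f (fun y => y) (fun=> a)) => //;
    [exact: Cinf_id|exact: Cinf_cst].
have gd : differentiable g x := Cinf_differentiable gi Ux.
pose M := 2 * `|a| + `|b| + 1.
have M0 : 0 < M by rewrite ltr_wpDl// addr_ge0// mulr_ge0.
have [d0 /= d00 dU] : exists2 d : R, 0 < d & forall h, `|h| < d -> U (x + h).
  have /nbhs_normP[d /= d0 dU] := open_nbhs_nbhs (conj oU Ux).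
  by exists d => // h hd; apply: dU; rewrite /= opprD addrA subrr sub0r normrN.
have eM : 0 < e / M by rewrite divr_gt0.
have /nbhs_normP[d1 /= d10 dP] := differentiable_eps gd eM.
have {}dP h : `|h| < d1 -> `|g (x + h) - g x - 'd g x h| <= e / M * `|h|.
  by move=> hd; apply: dP; rewrite /= sub0r normrN.
near=> s.
have s0 : 0 < s by near: s; exact: nbhs_right_gt.
have sM0 : s * M < d0.
  by rewrite -ltr_pdivlMr//; near: s; apply: nbhs_right_lt; rewrite divr_gt0.
have sM1 : s * M < d1.
  by rewrite -ltr_pdivlMr//; near: s; apply: nbhs_right_lt; rewrite divr_gt0.
pose c := 'd g x b.
have ha t : 0 <= t <= s -> `|t *: a| <= s * `|a|.
  by move=> /andP[t0 ts]; rewrite normrZ ger0_norm// ler_wpM2r.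
have hab t : 0 <= t <= s -> `|t *: a + s *: b| <= s * `|a| + s * `|b|.
  move=> ts; apply: le_trans (ler_normD _ _) _; apply: lerD; first exact: ha.
  by rewrite normrZ gtr0_norm.
have aM : s * `|a| < s * M.
  rewrite ltr_pM2l// /M; have := normr_ge0 a; have := normr_ge0 b; lra.
have abM : s * `|a| + s * `|b| < s * M.
  rewrite -mulrDr ltr_pM2l// /M; have := normr_ge0 a; have := normr_ge0 b; lra.
(* The quantity to bound is [phi s - phi 0]. The mean value inequality along [a] reduces it to first
   differences of [g], for which differentiability at [x] is enough. *)
pose phi (t : R) : R := f (x + s *: b + t *: a) - f (x + t *: a) - t * (s * c).
pose phi' (t : R) : R := g (x + s *: b + t *: a) - g (x + t *: a) - s * c.
have dphi t : 0 <= t <= s -> is_derive t 1 phi (phi' t).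
  move=> ts; have U1 : U (x + t *: a).
    by apply: dU; apply: le_lt_trans (ha t ts) (lt_trans aM sM0).
  have U2 : U (x + s *: b + t *: a).
    rewrite -addrA [s *: b + _]addrC.
    by apply: dU; apply: le_lt_trans (hab t ts) (lt_trans abM sM0).
  have D1 := is_derive_line (Cinf_differentiable fi U2).
  have D2 := is_derive_line (Cinf_differentiable fi U1).
  have D3 : is_derive t (1 : R) (fun t : R => t * (s * c)) (s * c).
    have := @is_deriveM R R (fun t => t) (cst (s * c)) t 1 _ _
      (is_derive_id _ _) (is_derive_cst _ _ _).
    move=> H; apply: is_derive_eq H _.
    by rewrite scaler0 add0r /GRing.scale /= mulr1.
  have D12 := is_deriveB D1 D2.
  exact: (is_deriveB D12 D3).
have phiK t : 0 <= t <= s -> `|phi' t| <= e * s.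
  move=> ts.
  have H1 := dP (t *: a) (le_lt_trans (ha t ts) (lt_trans aM sM1)).
  have H2 := dP _ (le_lt_trans (hab t ts) (lt_trans abM sM1)).
  have -> : phi' t = (g (x + (t *: a + s *: b)) - g x - 'd g x (t *: a + s *: b))
      - (g (x + t *: a) - g x - 'd g x (t *: a)).
    have xab : x + s *: b + t *: a = x + (t *: a + s *: b).
      by rewrite -addrA [s *: b + _]addrC.
    have dE : 'd g x (t *: a + s *: b) = 'd g x (t *: a) + s * c.
      have L := linearZ_LR ('d g x) s b; rewrite (linearD ('d g x)).
      exact: (congr1 (fun u => 'd g x (t *: a) + u) L).
    have rg (p q r u v : R) : p - q - v = (p - r - (u + v)) - (q - r - u) by ring.
    by rewrite /phi' xab dE; exact: rg.
  apply: le_trans (ler_normB _ _) _.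
  apply: le_trans (lerD H2 H1) _; rewrite -mulrDr.
  apply: (@le_trans _ _ (e / M * (s * M))); last first.
    by rewrite mulrCA divfK ?gt_eqF// mulrC.
  rewrite ler_pM2l//; apply: le_trans (lerD (hab t ts) (ha t ts)) _.
  have -> : s * `|a| + s * `|b| + s * `|a| = s * (2 * `|a| + `|b|) by ring.
  by rewrite ler_pM2l// /M lerDl.
have := real_mean_value_le (ltW s0) dphi phiK.
rewrite /phi !scale0r !addr0 mul0r subr0 expr2 mulrA.
rewrite -[x + s *: b + s *: a]addrA [s *: b + _]addrC addrA.
have rg (p q r t u : R) : p - q - u - (r - t) = p - q - (r - t) - u by ring.
rewrite [X in `|X| <= _]rg => H; apply: le_trans H _; by rewrite mulrA.
Unshelve. all: by end_near. Qed.

Lemma schwarz_real V (U : set V) (f : V -> R) (x a b : V) :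
  open U -> Cinf U f -> U x ->
  'd (fun y => 'd f y a) x b = 'd (fun y => 'd f y b) x a.
Proof.
move=> oU fi Ux; set c := LHS; set c' := RHS.
apply/eqP; rewrite -subr_eq0 -normr_le0; apply/ler_addgt0Pl => e e0.
rewrite addr0.
have e2 : 0 < e / 2 by rewrite divr_gt0.
near (0 : R)^'+ => s.
have s0 : 0 < s by near: s; exact: nbhs_right_gt.
have H1 : `|f (x + s *: a + s *: b) - f (x + s *: a) - (f (x + s *: b) - f x)
      - s ^+ 2 * c| <= e / 2 * s ^+ 2.
  by near: s; exact: (second_difference a b oU fi Ux e2).
have H2 : `|f (x + s *: b + s *: a) - f (x + s *: b) - (f (x + s *: a) - f x)
      - s ^+ 2 * c'| <= e / 2 * s ^+ 2.
  by near: s; exact: (second_difference b a oU fi Ux e2).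
have s2 : 0 < s ^+ 2 by rewrite exprn_gt0.
rewrite -(ler_pM2r s2) -[s ^+ 2 in leLHS]gtr0_norm// -normrM.
move: H1 H2; rewrite -[x + s *: b + s *: a]addrA [s *: b + _]addrC addrA.
set p := f _; set q := f _; set r := f (x + s *: b); set t := f x => H1 H2.
have rg (p' q' r' t' u c1 c2 : R) : (c1 - c2) * u =
  (p' - r' - (q' - t') - u * c2) - (p' - q' - (r' - t') - u * c1) by ring.
rewrite [X in `|X| <= _](rg p q r t).
apply: le_trans (ler_normB _ _) _; apply: le_trans (lerD H2 H1) _.
by rewrite -mulrDl -splitr.
Unshelve. all: by end_near. Qed.

Lemma diff_coord V m n (f : V -> 'M[R]_(m, n)) (x v : V) i j :
  differentiable f x ->
  'd (fun y => f y i j : R) x v = ('d f x v) i j.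
Proof.
move=> fd.
have cl : linear (fun M : 'M[R]_(m, n) => M i j : R).
  by move=> a A B; rewrite !mxE.
pose cm := GRing.isLinear.Build R _ _ _ _ cl.
pose C : {linear 'M[R]_(m, n) -> R} :=
  HB.pack (fun M : 'M[R]_(m, n) => M i j : R) cm.
have cc : continuous C by exact: coord_continuous.
have E : 'd (C \o f) x = 'd C (f x) \o 'd f x :> (V -> R).
  by rewrite diff_comp//; exact: linear_differentiable.
rewrite [LHS](congr1 (fun F => F v) E).
have dC : 'd C (f x) = C :> ('M[R]_(m, n) -> R) := diff_lin _ cc.
exact: (congr1 (fun F => F ('d f x v)) dC).
Qed.

Lemma schwarz V m n (U : set V) (f : V -> 'M[R]_(m, n)) (x a b : V) :
  open U -> Cinf U f -> U x ->
  'd (fun y => 'd f y a) x b = 'd (fun y => 'd f y b) x a.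
Proof.
move=> oU fi Ux; apply/matrixP => i j.
have fdi c : Cinf U (fun y => 'd f y c).
  by apply: (@Cinf_diff_dir R V V _ U U f (fun y => y) (fun=> c)) => //;
    [exact: Cinf_id|exact: Cinf_cst].
have H c d : ('d (fun y => 'd f y c) x d) i j =
    'd (fun y => 'd (fun z => f z i j : R) y c) x d.
  rewrite -diff_coord; last exact: Cinf_differentiable Ux.
  apply: (congr1 (fun F => F d)); apply: near_eq_diff.
    apply: filterS (open_nbhs_nbhs (conj oU Ux)) => y Uy.
    by rewrite diff_coord//; exact: Cinf_differentiable Uy.
  apply: (@Cinf_differentiable _ _ _ U) => //.
  apply: (@Cinf_diff_dir R V V _ U U _ (fun y => y) (fun=> c)) => //.
  - exact: Cinf_coord.
  - exact: Cinf_id.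
  - exact: Cinf_cst.
rewrite !H; apply: (@schwarz_real _ U) => //; exact: Cinf_coord.
Qed.

End second_derivatives.

(** * Fixed points of parametrised contractions *)

Section implicit_regularity.
Context {R : realType}.
Implicit Types V W P C : normedModType R.

(** In its second argument the tangent map is linear, hence equal to its own derivative there. *)
Lemma diff_tangent_snd V W (U : set V) (f : V -> W) (y z v : V) :
  Cinf U f -> U y ->
  'd (fun p : V * V => 'd f (p.1) (p.2)) (y, z) (0, v) = 'd f y v.
Proof.
move=> fi Uy; have [fd0 dfi] := (Cinf_tangent U f).1 fi.
pose g (p : V * V) := 'd f (p.1) (p.2).
have gd : differentiable g ((y, z) + (0 : R) *: (0, v)).
  by rewrite scale0r addr0; exact: (Cinf_differentiable dfi).
have [_ dE] := is_derive_line gd.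
rewrite [LHS](_ : _ = 'd g ((y, z) + (0 : R) *: (0, v)) (0, v)); last first.
  by rewrite scale0r addr0.
rewrite -dE.
have -> : (fun s : R => g ((y, z) + s *: (0, v))) =
          (fun s : R => 'd f y (z + s *: v)).
  by apply/funext => s; rewrite /g /= scaler0 addr0.
have dc : continuous ('d f y) by apply: diff_continuous; exact: fd0.
have lc : differentiable ('d f y) (z + (0 : R) *: v).
  exact: linear_differentiable.
have [_ ->] := is_derive_line lc.
have E : 'd ('d f y) (z + (0 : R) *: v) = 'd f y :> (V -> W) := diff_lin _ dc.
exact: (congr1 (fun F => F v) E).
Qed.

(** The partial differential in [C] is an isomorphism with bounded inverse, written without an
    operator norm: bounded below and onto. *)
Definition solvable_diff P C (F : P * C -> C) (y : P * C) :=
  (exists2 K : R, 0 < K & forall z, `|z| <= K * `|'d F y (0, z)|) /\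
  forall w, exists z, 'd F y (0, z) = w.

(** [L] is the derivative that implicit differentiation predicts: the partial differential in [P]
    followed by minus the inverse of the one in [C]. *)
Lemma implicit_differential P C (F : P * C -> C) (y : P * C) :
  differentiable F y -> solvable_diff F y ->
  exists L : P -> C, [/\ linear L, exists2 k : R, 0 < k &
    forall h, `|L h| <= k * `|h|, forall w, 'd F y (w, L w) = 0 &
    forall w z, 'd F y (w, z) = 0 -> z = L w].
Proof.
move=> Fd [[K K0 hK] hS].
have Dadd a b c d : 'd F y (a + b, c + d) = 'd F y (a, c) + 'd F y (b, d).
  by rewrite -(linearD ('d F y)).
have DZ a t t' : 'd F y (a *: t, a *: t') = a *: 'd F y (t, t').
  exact: (linearZ_LR ('d F y) a (t, t')).
have /choice[L LP] w : exists z, 'd F y (w, z) = 0.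
  have [z zE] := hS (- 'd F y (w, 0)); exists z.
  by rewrite -[w]addr0 -[z]add0r Dadd zE subrr.
have uniq w z : 'd F y (w, z) = 0 -> z = L w.
  move=> H; apply/eqP; rewrite -subr_eq0 -normr_le0.
  apply: le_trans (hK _) _.
  have -> : 'd F y (0, z - L w) = 0.
    rewrite -[X in (X, _)](subrr w) Dadd H add0r.
    by rewrite -scaleN1r -[- L w]scaleN1r DZ LP scaler0.
  by rewrite normr0 mulr0.
have Llin : linear L.
  move=> a u v; apply/esym/uniq.
  by rewrite Dadd DZ !LP scaler0 addr0.
exists L; split=> //.
have [k k0 hk] := diff_norm_bound Fd.
exists (K * k); first exact: mulr_gt0.
move=> h; apply: le_trans (hK _) _; rewrite -mulrA ler_pM2l//.
have -> : 'd F y (0, L h) = - 'd F y (h, 0).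
  apply/eqP; rewrite -subr_eq0 opprK addrC -Dadd addr0 add0r.
  by apply/eqP; exact: LP.
rewrite normrN; apply: le_trans (hk _) _; rewrite ler_pM2l//.
by apply: norm_pair_le => //=; rewrite normr0.
Qed.

(** Let [D] be the increment of [u]. As [F] takes the same value at both ends, ['d F] at [(h, D)] is
    of higher order; it vanishes at [(h, L h)], so [D - L h] is small against [|h| + |D|], and the
    part in [|D|] is absorbed. *)
Lemma implicit_differentiable P C (F : P * C -> C) (u : P -> C) (p : P)
    (c : C) (L : P -> C) :
  {for p, continuous u} -> (\forall p' \near p, F (p', u p') = c) ->
  differentiable F (p, u p) -> solvable_diff F (p, u p) ->
  linear L -> (exists2 k : R, 0 < k & forall h, `|L h| <= k * `|h|) ->
  (forall w, 'd F (p, u p) (w, L w) = 0) ->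
  differentiable u p /\ 'd u p = L :> (P -> C).
Proof.
move=> uc Fc Fd [[K K0 hK] hS] Llin [k k0 hk] LP; set y := (p, u p).
apply: (@differentiable_epsP R P C u L p k) => // e e0.
(* The bound 1/2 absorbs [|D|] and gives [|D| <= (2 k + 1) |h|]; the second bound then brings the
   remainder below [e |h|]. *)
pose d := Num.min (2^-1) (e / (3 + 2 * k)).
have k3 : 0 < 3 + 2 * k by rewrite addr_gt0// mulr_gt0.
have d0 : 0 < d by rewrite lt_min invr_gt0 ltr0n divr_gt0.
have d2 : d <= 2^-1 by rewrite ge_min lexx.
have de : d <= e / (3 + 2 * k) by rewrite ge_min lexx orbT.
have dK0 : 0 < d / K by rewrite divr_gt0.
have /nbhs_normP[r /= r0 rP] := differentiable_eps Fd dK0.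
have Fcy : F y = c by exact: nbhs_singleton Fc.
have cu : \forall p' \near p, `|u p - u p'| < r.
  by move/cvgrPdist_lt : uc; apply.
have cp : \forall p' \near p, `|p - p'| < r.
  by apply/nbhs_normP; exists r.
have : \forall p' \near p, [/\ F (p', u p') = c, `|u p - u p'| < r &
    `|p - p'| < r].
  near=> p'; split; near: p'; [exact: Fc|exact: cu|exact: cp].
rewrite (near_shift 0 p) /= => H; near=> h.
have : [/\ F (h + p, u (h + p)) = c, `|u p - u (h + p)| < r & `|p - (h + p)| < r].
  by near: h; move: H; apply: filterS => h; rewrite /= subr0.
rewrite [h + p]addrC => -[Fh uh ph].
pose D := u (p + h) - u p.
have Dr : `|((h, D) : P * C)| < r.
  apply: norm_pair_lt => /=; last by rewrite /D distrC.
  by move: ph; rewrite opprD addrA subrr sub0r normrN.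
have := rP (h, D); rewrite /= sub0r normrN => /(_ Dr).
have -> : (p, u p) + (h, D) = (p + h, u (p + h)).
  by congr (_, _); rewrite /= /D addrC subrK.
rewrite -/y Fh Fcy subrr sub0r normrN => FD.
have FDL : 'd F y (h, D) = 'd F y (0, D - L h).
  have -> : (h, D) = (h, L h) + (0, D - L h) :> P * C.
    by congr (_, _); rewrite /= ?addr0// addrC subrK.
  by rewrite (linearD ('d F y)) LP add0r.
have D1 : `|D - L h| <= d * (`|h| + `|D|).
  apply: le_trans (hK _) _; rewrite -FDL.
  rewrite -(ler_pM2l K0) in FD; apply: le_trans FD _.
  rewrite mulrA mulrCA divff ?gt_eqF// mulr1 ler_pM2l//.
  by apply: norm_pair_le => /=; rewrite ?lerDl ?lerDr.
have D2 : `|D| <= (2 * k + 1) * `|h| + 0.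
  have H1 : `|D| <= `|L h| + `|D - L h|.
    by rewrite -{1}(subrK (L h) D) addrC ler_normD.
  have H2 : d * (`|h| + `|D|) <= 2^-1 * (`|h| + `|D|).
    by rewrite ler_wpM2r// addr_ge0.
  have := hk h; move: D1 H1 H2; set a := `|D|; set b := `|h|.
  set q := `|D - L h|; set s := `|L h|; set t := d * (_ + _).
  lra.
apply: le_trans D1 _; apply: (@le_trans _ _ (d * ((3 + 2 * k) * `|h|))).
  rewrite ler_pM2l//; have := normr_ge0 h; lra.
rewrite mulrA ler_wpM2r// -ler_pdivlMr//.
Unshelve. all: by end_near. Qed.

(** Continuity in the point and the vector jointly, which is the form that [Ck] requires of the
    tangent map. *)
Lemma implicit_diff_continuous P C (F : P * C -> C) (u : P -> C) (O : set P)
    (Om : set (P * C)) (v : P * P -> C) (p w : P) :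
  open O -> open Om -> Cinf Om F -> O p ->
  (forall p', O p' -> Om (p', u p')) -> {for p, continuous u} ->
  solvable_diff F (p, u p) ->
  (forall p' w', O p' -> 'd F (p', u p') (w', v (p', w')) = 0) ->
  {for (p, w), continuous v}.
Proof.
move=> oO oOm Fi Op Ou uc [[K K0 hK] _] vP; set y := (p, u p).
have Fd : differentiable F y by apply: (Cinf_differentiable Fi); exact: Ou.
have [k k0 hk] := diff_norm_bound Fd.
apply/cvgrPdist_le => e e0 /=.
(* [m] dominates the known part of [|z.2| + |b|]; the unknown part [|a - b|] is absorbed by the
   factor 1/2 in [d]. *)
pose m := `|w| + 1 + `|v (p, w)|.
have m0 : 0 < m by rewrite ltr_wpDr// ltr_wpDl.
pose d := Num.min (2^-1) (e / (4 * m)).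
have d0 : 0 < d.
  by rewrite lt_min invr_gt0 ltr0n divr_gt0// mulr_gt0.
have d2 : d <= 2^-1 by rewrite ge_min lexx.
have de : d * m <= e / 4.
  rewrite -ler_pdivlMr//; apply: le_trans (_ : e / (4 * m) <= _).
    by rewrite ge_min lexx orbT.
  by rewrite invfM mulrA.
have dK0 : 0 < d / K by rewrite divr_gt0.
have opn : \forall y' \near y, forall z, `|'d F y' z - 'd F y z| <= d / K * `|z|.
  by apply: (diff_norm_continuous oOm Fi) => //; exact: Ou.
have cy : {for p, continuous (fun p' => (p', u p'))}.
  by apply: cvg_pair => //; exact: cvg_id.
have {}opn : \forall p' \near p, forall z,
    `|'d F (p', u p') z - 'd F y z| <= d / K * `|z| by exact: (cy _ opn).
have q0 : 0 < e / (4 * (K * k)) by rewrite divr_gt0// !mulr_gt0.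
have n1 : \forall z \near (p, w), O z.1 /\ (forall t,
    `|'d F (z.1, u z.1) t - 'd F y t| <= d / K * `|t|).
  have : \forall p' \near p, O p' /\ (forall t,
    `|'d F (p', u p') t - 'd F y t| <= d / K * `|t|).
    by apply: filterI => //; exact: open_nbhs_nbhs.
  exact: (@cvg_fst _ _ (nbhs p) (nbhs w) _).
have n2 : \forall z \near (p, w), `|w - z.2| < Num.min 1 (e / (4 * (K * k))).
  have : \forall w' \near w, `|w - w'| < Num.min 1 (e / (4 * (K * k))).
    by apply/nbhs_normP; exists (Num.min 1 (e / (4 * (K * k)))); rewrite //= lt_min ltr01.
  exact: (@cvg_snd _ _ (nbhs p) (nbhs w) _).
near=> z.
have [Oz Hz] : O z.1 /\ (forall t,
    `|'d F (z.1, u z.1) t - 'd F y t| <= d / K * `|t|) by near: z.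
have : `|w - z.2| < Num.min 1 (e / (4 * (K * k))) by near: z.
rewrite lt_min => /andP[w1 w2].
have vz := vP z.1 z.2 Oz; rewrite -surjective_pairing in vz.
have vy := vP p w Op; rewrite -/y in vy.
set a := v (p, w); set b := v z.
have Dadd s t s' t' : 'd F y (s + t, s' + t') = 'd F y (s, s') + 'd F y (t, t').
  by rewrite -(linearD ('d F y)).
have E : 'd F y (0, a - b) = - 'd F y (w - z.2, 0)
    - ('d F y (z.2, b) - 'd F (z.1, u z.1) (z.2, b)).
  rewrite vz subr0 -opprD -Dadd subrK add0r.
  have : 'd F y ((0, a - b) + (w, b)) = 'd F y (w, a).
    by congr ('d F y (_, _)); rewrite /= ?add0r ?subrK.
  rewrite (linearD ('d F y)) vy => H.
  by apply/eqP; rewrite -subr_eq0 opprK H.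
have bn : `|b| <= `|a - b| + `|a|.
  by rewrite -{1}(subrK a b) [leRHS]addrC distrC addrC ler_normD.
have zn : `|z.2| <= `|w| + 1.
  rewrite -[z.2](subKr w); apply: le_trans (ler_normB _ _) _.
  by rewrite lerD2l ltW.
have H1 : `|a - b| <= K * (k * `|w - z.2| + d / K * (`|z.2| + `|b|)).
  apply: le_trans (hK _) _; rewrite ler_pM2l// E.
  apply: le_trans (ler_normB _ _) _; rewrite normrN; apply: lerD.
    apply: le_trans (hk _) _; rewrite ler_pM2l//.
    by apply: norm_pair_le => //=; rewrite normr0.
  rewrite distrC; apply: le_trans (Hz _) _; rewrite ler_pM2l//.
  by apply: norm_pair_le => /=; rewrite ?lerDl ?lerDr.
have H2 : K * (k * `|w - z.2|) <= e / 4.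
  rewrite mulrA mulrC -ler_pdivlMr ?mulr_gt0// ltW//.
  by apply: lt_le_trans w2 _; rewrite invfM mulrA.
have H3 : K * (d / K * (`|z.2| + `|b|)) = d * (`|z.2| + `|b|).
  by rewrite mulrA mulrCA divff ?gt_eqF// mulr1.
have H4 : d * (`|z.2| + `|b|) <= d * m + d * `|a - b|.
  rewrite -mulrDr ler_pM2l// /m -/a; move: bn zn; lra.
have H5 : d * `|a - b| <= 2^-1 * `|a - b| by rewrite ler_wpM2r.
move: H1; rewrite mulrDr H3; move: H2 H4 H5 de.
set X := `|a - b|; set q1 := K * _; set q2 := d * _; set q3 := d * X; set q4 := d * m.
lra.
Unshelve. all: by end_near. Qed.

End implicit_regularity.

Section implicit_smooth.
Context {R : realType}.
Implicit Types V W X P C : normedModType R.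

Lemma diff_comp_linear V W X (f : W -> X) (s : V -> W) (x : V) :
  linear s -> continuous s -> differentiable f (s x) ->
  forall h, 'd (fun y => f (s y)) x h = 'd f (s x) (s h).
Proof.
move=> sl sc fd h.
pose sm := GRing.isLinear.Build R V W _ s sl.
pose S : {linear V -> W} := HB.pack s sm.
have dS : 'd s x = S :> (V -> W) by exact: (@diff_lin _ _ _ S x sc).
have sd : differentiable s x by exact: (@linear_differentiable _ _ _ S x sc).
have E : 'd (f \o s) x = 'd f (s x) \o 'd s x :> (V -> X) by exact: diff_comp.
rewrite [LHS](congr1 (fun F => F h) E) /=; congr ('d f _ _).
exact: (congr1 (fun F => F h) dS).
Qed.

(** Induction on [k]: the pair made of [u] and its tangent map solves an equation of the same kind
    over [P * P], whose function [F'] pairs [F] with its own tangent map. At order 0 the claim is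
    the assumed continuity. *)
Lemma Ck_implicit k P C (O : set P) (Om : set (P * C)) (F : P * C -> C)
    (u : P -> C) (c : C) :
  open O -> open Om -> Cinf Om F ->
  (forall p, O p -> [/\ Om (p, u p), {for p, continuous u}, F (p, u p) = c &
                        solvable_diff F (p, u p)]) ->
  Ck k O u.
Proof.
elim: k P C O Om F u c => [|k IH] P C O Om F u c oO oOm Fi uP.
  by move=> p Op; case: (uP p Op).
have Fd p : O p -> differentiable F (p, u p).
  by move=> Op; apply: (Cinf_differentiable Fi); case: (uP p Op).
have LP p : O p -> [/\ differentiable u p,
    forall w, 'd F (p, u p) (w, 'd u p w) = 0 &
    forall w z, 'd F (p, u p) (w, z) = 0 -> z = 'd u p w].
  move=> Op; have [_ uc _ sd] := uP p Op.
  have [L [Llin Lb L0 Lu]] := implicit_differential (Fd p Op) sd.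
  have Fc : \forall p' \near p, F (p', u p') = c.
    by apply: filterS (open_nbhs_nbhs (conj oO Op)) => p' Op'; case: (uP p' Op').
  have [du ->] := implicit_differentiable uc Fc (Fd p Op) sd Llin Lb L0.
  by [].
split; first by move=> p Op; case: (LP p Op).
pose v (z : P * P) := 'd u (z.1) (z.2).
have vc z : O z.1 -> {for z, continuous v}.
  move=> Oz; have [_ uc _ sd] := uP _ Oz; rewrite (surjective_pairing z).
  apply: (implicit_diff_continuous oO oOm Fi Oz _ uc sd).
    by move=> p' Op'; case: (uP p' Op').
  by move=> p' w' Op'; case: (LP p' Op').
pose Om' := [set z : (P * P) * (C * C) | Om (z.1.1, z.2.1)].
pose s1 (z : (P * P) * (C * C)) : P * C := (z.1.1, z.2.1).
pose s2 (z : (P * P) * (C * C)) : P * C := (z.1.2, z.2.2).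
have s1l : linear s1 by [].
have s2l : linear s2 by [].
have c11 : continuous (fun z : (P * P) * (C * C) => z.1.1).
  by move=> z; apply: (@continuous_comp _ _ _ fst fst z); exact: cvg_fst.
have c21 : continuous (fun z : (P * P) * (C * C) => z.2.1).
  by move=> z; apply: (@continuous_comp _ _ _ snd fst z);
    [exact: cvg_snd|exact: cvg_fst].
have c12 : continuous (fun z : (P * P) * (C * C) => z.1.2).
  by move=> z; apply: (@continuous_comp _ _ _ fst snd z);
    [exact: cvg_fst|exact: cvg_snd].
have c22 : continuous (fun z : (P * P) * (C * C) => z.2.2).
  by move=> z; apply: (@continuous_comp _ _ _ snd snd z); exact: cvg_snd.
have s1c : continuous s1 by move=> z; apply: cvg_pair; [exact: c11|exact: c21].
have s2c : continuous s2 by move=> z; apply: cvg_pair; [exact: c12|exact: c22].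
have oOm' : open Om'.
  rewrite (_ : Om' = s1 @^-1` Om)//.
  by apply: open_comp => // z _; exact: s1c.
pose s12 (z : (P * P) * (C * C)) := (s1 z, s2 z).
have s12l : linear s12 by [].
have s12c : continuous s12 by move=> z; exact: (cvg_pair (s1c z) (s2c z)).
pose G (y : (P * C) * (P * C)) : C := 'd F (y.1) (y.2).
have Gi : Cinf [set y : (P * C) * (P * C) | Om y.1] G by case/Cinf_tangent : Fi.
have Fs1 : Cinf Om' (fun z => F (s1 z)).
  by apply: (@Cinf_comp _ _ _ oOm' _ _ Om) => //; exact: Cinf_linear.
have Gs : Cinf Om' (fun z => G (s12 z)).
  apply: (@Cinf_comp _ _ _ oOm' _ _ [set y | Om y.1]) => //.
  exact: Cinf_linear.
pose F' (z : (P * P) * (C * C)) : C * C := (F (s1 z), G (s12 z)).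
have Fi' : Cinf Om' F' by exact: Cinf_pair.
pose u' (z : P * P) : C * C := (u z.1, v z).
have oO1 : open [set z : P * P | O z.1] by exact: open_fst.
suff u'k : Ck k [set z : P * P | O z.1] u'.
  exact: (@Ck_comp R k _ _ _ _ setT u' snd oO1 (fun _ _ => I) u'k
    (@Ck_snd R k C C setT)).
apply: (IH _ _ _ Om' F' u' (c, 0)) => //.
move=> [p w] /= Op; have [Omp uc Fc [[K K0 hK] hS]] := uP p Op; split.
- exact: Omp.
- apply: cvg_pair; last exact: vc.
  by apply: (@continuous_comp _ _ _ fst u (p, w)); [exact: cvg_fst|exact: uc].
- have [_ H _] := LP p Op; rewrite /F' /s1 /= Fc; congr (_, _).
  exact: H.
set y0 := ((p, w), u' (p, w)).
(* The partial differential of [F'] is block triangular, with the invertible partial differential of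
   [F] twice on the diagonal. *)
have Dz (a b : C) : 'd F' y0 (0, (a, b)) = ('d F (p, u p) (0, a),
   'd G ((p, u p), (w, v (p, w))) ((0, a), 0) + 'd F (p, u p) (0, b)).
  rewrite /F' diff_pair; first last.
  - exact: (Cinf_differentiable Gs).
  - exact: (Cinf_differentiable Fs1).
  congr (_, _).
    by rewrite (diff_comp_linear s1l s1c)//; exact: Fd.
  rewrite (diff_comp_linear s12l s12c); last exact: (Cinf_differentiable Gi).
  rewrite -(diff_tangent_snd (w, v (p, w)) (0, b) Fi Omp) -(linearD ('d G _)).
  congr ('d G _ _); congr (_, _); congr (_, _); rewrite /= ?addr0 ?add0r//.
have gd : differentiable G ((p, u p), (w, v (p, w))).
  exact: (Cinf_differentiable Gi).
have [k0 k00 hk0] := diff_norm_bound gd.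
split; last first.
  move=> [a' b']; have [a aE] := hS a'.
  have [b bE] := hS (b' - 'd G ((p, u p), (w, v (p, w))) ((0, a), 0)).
  by exists (a, b); rewrite Dz aE bE addrC subrK.
(* Back substitution: [|a| <= K N], then [|b| <= K (N + k0 K N)]; this constant dominates both
   bounds. *)
exists (K * (1 + k0 * K) + K).
  by rewrite addr_gt0// mulr_gt0// addr_gt0// mulr_gt0.
move=> [a b]; set N := `|'d F' _ _|.
have N1 : `|'d F (p, u p) (0, a)| <= N.
  by apply: le_trans (norm_fst_le _); rewrite Dz.
have N2 : `|'d G ((p, u p), (w, v (p, w))) ((0, a), 0)
    + 'd F (p, u p) (0, b)| <= N.
  by apply: le_trans (norm_snd_le _); rewrite Dz.
have N0 : 0 <= N by exact: normr_ge0.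
have Ha : `|a| <= K * N.
  by apply: le_trans (hK _) _; rewrite ler_pM2l.
have Hb : `|b| <= K * (N + k0 * (K * N)).
  apply: le_trans (hK _) _; rewrite ler_pM2l//.
  set g := 'd G _ _ in N2; set f := 'd F _ _ in N2 *.
  have -> : f = (g + f) - g by rewrite addrC addKr.
  apply: le_trans (ler_normB _ _) _; apply: lerD => //.
  apply: le_trans (hk0 _) _; rewrite ler_pM2l//; apply: le_trans Ha.
  by do 2?[apply: norm_pair_le => //=]; rewrite ?normr0.
apply: norm_pair_le => /=.
  apply: le_trans Ha _; rewrite mulrDl lerDr.
  by rewrite !mulr_ge0 ?addr_ge0 ?mulr_ge0// ltW.
apply: le_trans Hb _.
have -> : (K * (1 + k0 * K) + K) * N = K * (N + k0 * (K * N)) + K * N by ring.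
by rewrite lerDl mulr_ge0// ltW.
Qed.

End implicit_smooth.

Section contraction_family.
Context {R : realType}.

Lemma contraction_fixed_point (C : completeNormedModType R) (x0 : C) (r : R)
    (T : C -> C) : 0 <= r ->
  (forall x, `|x - x0| <= r -> `|T x - x0| <= r) ->
  (forall x y, `|x - x0| <= r -> `|y - x0| <= r ->
     `|T x - T y| <= 2^-1 * `|x - y|) ->
  exists2 x, `|x - x0| <= r & T x = x.
Proof.
move=> r0 TU TL; pose U : set C := [set x | `|x - x0| <= r].
pose Tm := isFun.Build _ _ U U T TU.
pose TT : {fun U >-> U} := HB.pack T Tm.
have [|||p Up pE] := @banach_fixed_point R C U TT.
- exists (2^-1)%:nng; split; first by rewrite /= invf_lt1 ?ltr1n.
  by move=> [x y] [/= Ux Uy]; exact: TL.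
- have -> : U = (fun x => `|x - x0|) @^-1` [set t | t <= r] by [].
  apply: closed_comp; last exact: closed_le.
  move=> x _; apply: (@continuous_comp _ _ _ (fun x => x - x0) Num.norm).
    by apply: cvgB; [exact: cvg_id|exact: cvg_cst].
  exact: norm_continuous.
- by exists x0; rewrite /U /= subrr normr0.
by exists p.
Qed.

(** The differential is a limit of difference quotients, so it inherits the contraction factor. *)
Lemma lipschitz_diff_snd (P C : normedModType R) (Om : set (P * C))
    (T : P * C -> C) (p : P) (v : C) : open Om -> Om (p, v) ->
  (forall v v', Om (p, v) -> Om (p, v') ->
     `|T (p, v) - T (p, v')| <= 2^-1 * `|v - v'|) ->
  differentiable T (p, v) -> forall z, `|'d T (p, v) (0, z)| <= 2^-1 * `|z|.
Proof.
move=> oOm Omv TL Td z; apply/ler_addgt0Pl => e e0.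
pose m := `|z| + 1; have m0 : 0 < m by rewrite ltr_wpDl.
have em : 0 < e / m by rewrite divr_gt0.
have /nbhs_normP[d /= d0 dP] := differentiable_eps Td em.
have /nbhs_normP[d1 /= d10 d1P] := open_nbhs_nbhs (conj oOm Omv).
near (0 : R)^'+ => s.
have s0 : 0 < s by near: s; exact: nbhs_right_gt.
have sz : `|((0, s *: z) : P * C)| <= s * m.
  apply: norm_pair_le => /=; first by rewrite normr0 mulr_ge0 ?ltW.
  by rewrite normrZ gtr0_norm// ler_pM2l// lerDl.
have sd : s * m < d.
  by rewrite -ltr_pdivlMr//; near: s; apply: nbhs_right_lt; rewrite divr_gt0.
have sd1 : s * m < d1.
  by rewrite -ltr_pdivlMr//; near: s; apply: nbhs_right_lt; rewrite divr_gt0.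
have := dP (0, s *: z); rewrite /= sub0r normrN => /(_ (le_lt_trans sz sd)).
have pE : (p, v) + (0, s *: z) = (p, v + s *: z) :> P * C.
  by congr (_, _); rewrite /= addr0.
have Om2 : Om (p, v + s *: z).
  rewrite -pE; apply: d1P; rewrite /= opprD addrA subrr sub0r normrN.
  exact: le_lt_trans sz sd1.
have dE : 'd T (p, v) (0, s *: z) = s *: 'd T (p, v) (0, z).
  rewrite -(linearZ_LR ('d T (p, v)) s (0, z)); congr ('d T _ _).
  by congr (_, _); rewrite /= scaler0.
rewrite pE dE => H1; have H2 := TL _ _ Om2 Omv.
rewrite addrAC subrr add0r normrZ gtr0_norm// in H2.
rewrite addrC -(ler_pM2l s0) mulrDr.
move: H1 H2; set t := T _ - T _; set D := 'd T _ _ => H1 H2.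
have -> : s * `|D| = `|t - (t - s *: D)| by rewrite subKr normrZ gtr0_norm.
apply: le_trans (ler_normB _ _) _; apply: lerD.
  by apply: le_trans H2 _; rewrite mulrCA.
apply: le_trans H1 _; apply: (@le_trans _ _ (e / m * (s * m))).
  by rewrite ler_pM2l.
by rewrite mulrCA divfK ?gt_eqF.
Unshelve. all: by end_near. Qed.

(** Uniform contraction principle. Smooth dependence comes from [Ck_implicit] applied to
    [z.2 - T z], whose partial differential is the identity minus a map of norm at most 1/2. *)
Lemma contraction_family (P : normedModType R) (C : completeNormedModType R)
    (Om : set (P * C)) (T : P * C -> C) (p0 : P) (u0 : C) :
  open Om -> Om (p0, u0) -> Cinf Om T -> T (p0, u0) = u0 ->
  (forall p v v', Om (p, v) -> Om (p, v') ->
     `|T (p, v) - T (p, v')| <= 2^-1 * `|v - v'|) ->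
  exists (O : set P) (r : R) (u : P -> C),
    [/\ open O /\ O p0, 0 < r, Cinf O u,
        forall p v, O p -> `|v - u0| < r -> Om (p, v) &
        forall p, O p -> [/\ `|u p - u0| < r, T (p, u p) = u p &
          forall v, `|v - u0| < r -> T (p, v) = v -> v = u p]].
Proof.
move=> oOm Om0 Ti T0 TL.
have /nbhs_normP[d /= d0 dP] := open_nbhs_nbhs (conj oOm Om0).
pose r := d / 2; have r0 : 0 < r by rewrite divr_gt0.
have rd : r < d by rewrite /r ltr_pdivrMr// ltr_pMr// ltr1n.
have inOm p v : `|p - p0| < d -> `|v - u0| <= r -> Om (p, v).
  move=> pd vr; apply: dP; apply: norm_pair_lt => /=; rewrite distrC//.
  exact: le_lt_trans vr rd.
have uu0 : `|u0 - u0| <= r by rewrite subrr normr0 ltW.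
(* On [O] the centre [u0] moves by less than [r / 2], so [T (p, _)] sends the closed ball of radius
   [r] into the open one: the fixed point lies strictly inside. *)
pose O := [set p | `|p - p0| < d /\ `|T (p, u0) - u0| < r / 2].
have Tc p v : Om (p, v) -> {for (p, v), continuous T}.
  by move=> /(Cinf_continuous Ti).
have Tcp p v : Om (p, v) -> {for p, continuous (fun p => T (p, v))}.
  move=> Opv; apply: (@continuous_comp _ _ _ (fun p => (p, v)) T).
    by apply: cvg_pair; [exact: cvg_id|exact: cvg_cst].
  exact: Tc.
have oO : open O.
  rewrite openE => p [pd pr]; rewrite /interior /=; apply: filterI.
    have c : {for p, continuous (fun p => `|p - p0|)}.
      apply: (@continuous_comp _ _ _ (fun x => x - p0) Num.norm).
        by apply: cvgB; [exact: cvg_id|exact: cvg_cst].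
      exact: norm_continuous.
    by apply: (c [set t | t < d]); exact: lt_nbhsl.
  have c : {for p, continuous (fun p => `|T (p, u0) - u0|)}.
    apply: (@continuous_comp _ _ _ (fun p => T (p, u0) - u0) Num.norm).
      by apply: cvgB; [exact: Tcp (inOm _ _ pd uu0)|exact: cvg_cst].
    exact: norm_continuous.
  by apply: (c [set t | t < r / 2]); exact: lt_nbhsl.
have O0 : O p0.
  by split; [rewrite subrr normr0|rewrite T0 subrr normr0 divr_gt0].
have ex p : exists v, O p -> `|v - u0| < r /\ T (p, v) = v.
  have [[pd pr]|nO] := pselect (O p); last by exists u0.
  have bd v : `|v - u0| <= r -> `|T (p, v) - u0| < r.
    move=> vr.
    have -> : T (p, v) - u0 = (T (p, v) - T (p, u0)) + (T (p, u0) - u0).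
      by rewrite addrA subrK.
    apply: le_lt_trans (ler_normD _ _) _.
    have H := TL p v u0 (inOm _ _ pd vr) (inOm _ _ pd uu0).
    rewrite [ltRHS](splitr r); apply: ler_ltD => //.
    by apply: le_trans H _; rewrite mulrC ler_pM2r// invr_gt0.
  have [|||v vr vE] := @contraction_fixed_point C u0 r (fun v => T (p, v)).
  - exact: ltW.
  - by move=> v /bd /ltW.
  - by move=> v v' vr v'r; apply: TL; apply: inOm.
  by exists v => _; split=> //; rewrite -vE; exact: bd.
have [u uP] := choice ex.
have uniq p v v' : O p -> `|v - u0| < r -> `|v' - u0| < r -> T (p, v) = v ->
    T (p, v') = v' -> v = v'.
  move=> [pd _] vr v'r vE v'E.
  have := TL p v v' (inOm _ _ pd (ltW vr)) (inOm _ _ pd (ltW v'r)).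
  rewrite vE v'E => H; apply/eqP; rewrite -subr_eq0 -normr_le0.
  by move: H; set t := `|_|; lra.
have uOm p : O p -> Om (p, u p).
  by move=> Op; have [ur _] := uP p Op; apply: inOm (ltW ur); case: Op.
have uc p : O p -> {for p, continuous u}.
  move=> Op; apply/cvgrPdist_lt => e e0 /=.
  have e2 : 0 < e / 2 by rewrite divr_gt0.
  have c := Tcp p (u p) (uOm p Op).
  have /cvgrPdist_lt/(_ _ e2) n1 := c.
  near=> q.
  have Oq : O q by near: q; exact: open_nbhs_nbhs.
  have H1 : `|T (p, u p) - T (q, u p)| < e / 2 by near: q; exact: n1.
  have Omq : Om (q, u p).
    by have [ur _] := uP p Op; apply: inOm (ltW ur); case: Oq.
  have H2 := TL q (u p) (u q) Omq (uOm q Oq).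
  have : `|u p - u q| <= `|T (p, u p) - T (q, u p)| + `|T (q, u p) - T (q, u q)|.
    have [_ {1}<-] := uP p Op; have [_ {1}<-] := uP q Oq.
    by rewrite -{1}(subrK (T (q, u p)) (T (p, u p))) -addrA ler_normD.
  by move: H1 H2; set a := `|_ - _|; set b := `|_ - _|; set w := `|_ - _|; lra.
exists O, r, u; split => //.
- move=> k; apply: (@Ck_implicit _ k P C O Om (fun z => z.2 - T z) u 0) => //.
    by apply: Cinf_subr => //; exact: Cinf_snd.
  move=> p Op; have [ur uE] := uP p Op; split.
  + exact: uOm.
  + exact: uc.
  + by rewrite /= uE subrr.
  have Td : differentiable T (p, u p).
    by apply: (Cinf_differentiable Ti); exact: uOm.
  have sd : differentiable (@snd P C) (p, u p).
    exact: (Cinf_differentiable (@Cinf_snd _ _ _ setT)).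
  have Dz z : 'd (fun z => z.2 - T z) (p, u p) (0, z) =
      z - 'd T (p, u p) (0, z).
    have E := diffB sd Td.
    rewrite [LHS](congr1 (fun F => F (0, z)) E).
    have E2 : 'd (@snd P C) (p, u p) = @snd P C :> (P * C -> C).
      by apply: (@diff_lin _ _ _ (@snd P C)) => z'; exact: cvg_snd.
    exact: (congr1 (fun F => F (0, z) - 'd T (p, u p) (0, z)) E2).
  have Tz := lipschitz_diff_snd oOm (uOm p Op) (TL p) Td.
  split.
    exists 2 => // z; rewrite Dz; have := Tz z.
    set t := 'd T _ _; have := ler_normD (z - t) t; rewrite subrK.
    by set a := `|_|; set b := `|_|; set w := `|_|; lra.
  (* Surjectivity is one more fixed point, that of [z |-> w + 'd T (p, u p) (0, z)]. The radius
     [2 |w|] is preserved because halving it leaves room for [w]. *)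
  move=> w; pose r' := 2 * `|w|.
  have [|||z _ zE] := @contraction_fixed_point C 0 r'
    (fun z => w + 'd T (p, u p) (0, z)).
  + by rewrite mulr_ge0.
  + move=> z; rewrite !subr0 => zr; apply: le_trans (ler_normD _ _) _.
    by have := Tz z; move: zr; rewrite /r'; lra.
  + move=> z z' _ _; rewrite opprD addrACA subrr add0r.
    have -> : 'd T (p, u p) (0, z) - 'd T (p, u p) (0, z') =
        'd T (p, u p) (0, z - z').
      rewrite -(linearB ('d T (p, u p))); congr ('d T _ _).
      by congr (_, _); rewrite /= subrr.
    exact: Tz.
  by exists z; rewrite Dz -{1}zE addrK.
- by move=> p v [pd _] vr; apply: inOm => //; exact: ltW.
- move=> p Op; have [ur uE] := uP p Op; split => // v vr vE.
  exact: uniq vE uE.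
Unshelve. all: by end_near. Qed.

End contraction_family.

(** Makes row vectors a complete normed module, so that the fixed-point theorem applies to them. *)
HB.instance Definition _ (R : realType) (m n : nat) :=
  Uniform_isComplete.Build 'M[R]_(m, n) (@mx_complete R m n).

Section inverse_function.
Context {R : realType}.

(** Solutions of [f v = y] are the fixed points of the simplified Newton map [v - B (f v - y)],
    where [B] is the inverse of the differential at [x0], kept fixed. *)
Lemma inverse_function m (U : set 'rV[R]_m) (f : 'rV[R]_m -> 'rV[R]_m)
    (x0 : 'rV[R]_m) : open U -> Cinf U f -> U x0 ->
  (forall v, 'd f x0 v = 0 -> v = 0) ->
  exists (O : set 'rV[R]_m) (g : 'rV[R]_m -> 'rV[R]_m),
    [/\ open O /\ O x0, O `<=` U, open (f @` O),
        forall x, O x -> g (f x) = x & Cinf (f @` O) g].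
Proof.
move=> oU fi Ux0 inj.
pose J : 'M[R]_m := lin1_mx ('d f x0).
have JE v : v *m J = 'd f x0 v by rewrite mul_rV_lin1.
have Ju : J \in unitmx.
  rewrite -row_free_unit -kermx_eq0; apply/eqP/row_matrixP => i.
  by rewrite row0; apply: inj; rewrite -JE -row_mul mulmx_ker row0.
pose B (v : 'rV[R]_m) : 'rV[R]_m := v *m invmx J.
have Bl : linear B by move=> a u v; rewrite /B mulmxDl scalemxAl.
have BJ v : B ('d f x0 v) = v by rewrite /B -JE mulmxK.
have B0 v : B v = 0 -> v = 0 by move=> Bv; rewrite -(mulmxKV Ju v) -/(B v) Bv mul0mx.
have BB u v : B (u - v) = B u - B v by rewrite /B mulmxBl.
have Bi : Cinf setT B by exact: Cinf_linear_mx.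
pose Bm := GRing.isLinear.Build R _ _ _ B Bl.
pose BL : {linear 'rV[R]_m -> 'rV[R]_m} := HB.pack B Bm.
have Bc : continuous BL by move=> x; exact: (Cinf_continuous Bi).
have [k k0 hk] := linear_norm_bound Bc.
(* Two values of [T] differ by [B] applied to the error of strict differentiability, and [B] has
   norm at most [k]: this tolerance yields the factor 1/2. *)
have e0 : 0 < 2^-1 / k by rewrite divr_gt0// invr_gt0.
have [r r0 rP] := strictly_differentiable oU fi Ux0 e0.
pose Om := [set z : 'rV[R]_m * 'rV[R]_m | (U `&` ball x0 r) z.2].
have oOm : open Om.
  rewrite (_ : Om = snd @^-1` (U `&` ball x0 r))//.
  apply: open_comp; first by move=> z _; exact: cvg_snd.
  by apply: openI => //; exact: ball_open.
pose T (z : 'rV[R]_m * 'rV[R]_m) := z.2 - B (f z.2 - z.1).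
have Ti : Cinf Om T.
  apply: Cinf_subr => //; first exact: Cinf_snd.
  apply: (@Cinf_comp _ _ _ oOm _ _ setT) => //.
  apply: Cinf_subr => //; last exact: Cinf_fst.
  apply: (@Cinf_comp _ _ _ oOm _ _ U) => //; last exact: Cinf_snd.
  by move=> z [].
have Tfix y v : T (y, v) = v <-> f v = y.
  rewrite /T /=; split=> [|->]; last by rewrite subrr /B mul0mx subr0.
  move=> H; apply/eqP; rewrite -subr_eq0; apply/eqP/B0.
  by rewrite -[LHS](subKr v) H subrr.
have nb (v : 'rV[R]_m) : ball x0 r v = (`|v - x0| < r).
  by rewrite -ball_normE /= distrC.
have Om0 : Om (f x0, x0) by split => //=; exact: ballxx.
have TL y v v' : Om (y, v) -> Om (y, v') ->
    `|T (y, v) - T (y, v')| <= 2^-1 * `|v - v'|.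
  move=> [_ +] [_ +]; rewrite /= !nb => vr v'r.
  have -> : T (y, v) - T (y, v') = - B (f v - f v' - 'd f x0 (v - v')).
    rewrite !BB BJ /T /= !BB.
    move: (B (f v)) (B (f v')) (B y) => a b c.
    apply/rowP => i; rewrite !mxE; ring.
  rewrite normrN; apply: le_trans (hk _) _.
  have := rP _ _ v'r vr; rewrite -(ler_pM2l k0) => H; apply: le_trans H _.
  by rewrite mulrA mulrCA divff ?mulr1// gt_eqF.
have [V [rho [u [[oO VO] rho0 ui OOm uP]]]] :=
  contraction_family oOm Om0 Ti ((Tfix _ _).2 erefl) TL.
pose O' := [set x | (U `&` ball x0 rho) x /\ V (f x)].
have fO : f @` O' = V.
  apply/seteqP; split=> [_ [x [_ Ox] <-]//|y Oy].
  have [ur /Tfix uE _] := uP y Oy; exists (u y) => //.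
  split; last by rewrite uE.
  split; last by rewrite -ball_normE /= distrC.
  by case: (OOm y (u y) Oy ur).
exists O', u; rewrite fO; split => //.
- split; last by split => //; split => //; exact: ballxx.
  rewrite openE => x [[Ux xr] Ox]; rewrite /interior /=.
  apply: filterI.
    by apply: open_nbhs_nbhs; split=> //; apply: openI => //; exact: ball_open.
  by apply: (Cinf_continuous fi Ux); exact: open_nbhs_nbhs.
- by move=> x [[]].
- move=> x [[Ux xr] Ox]; apply/esym.
  have [_ _] := uP _ Ox; apply; last exact/Tfix.
  by move: xr; rewrite -ball_normE /= distrC.
Qed.

End inverse_function.

(** * Flows of vector fields *)

Section bounded_continuous.
Context {R : realType} (V : normedModType R).

(** The functions live on the whole line, which avoids a subspace topology. For flows only the
    values on [0, 1] count, and primitives are continued constantly beyond. *)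
Definition bc_pred : {pred (R -> V)} :=
  [pred f | `[< continuous f /\ exists M : R, forall x, `|f x| <= M >]].

Record bcfun := BCFun { bcval :> R -> V; bcvalP : bcval \in bc_pred }.

HB.instance Definition _ := [isSub for bcval].
HB.instance Definition _ := [Choice of bcfun by <:].

Lemma bc_submod_closed : submod_closed bc_pred.
Proof.
split.
  apply/asboolP; split; first by move=> x; exact: cvg_cst.
  by exists 0 => x /=; rewrite normr0.
move=> a f g /asboolP[fc [M fM]] /asboolP[gc [N gN]]; apply/asboolP; split.
  move=> x; apply: (@cvgD _ _ _ _ _ (fun x => a *: f x) g); last exact: gc.
  by apply: cvgZr; exact: fc.
exists (`|a| * M + N) => x; apply: le_trans (ler_normD _ _) _.
by apply: lerD => //; rewrite normrZ ler_wpM2l.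
Qed.

HB.instance Definition _ :=
  GRing.isSubmodClosed.Build R (R -> V) bc_pred bc_submod_closed.
HB.instance Definition _ := [SubChoice_isSubLmodule of bcfun by <:].

Lemma bc_continuous (f : bcfun) : continuous f.
Proof. by have /asboolP[] := bcvalP f. Qed.

Lemma bc_bounded (f : bcfun) : exists M : R, forall x, `|f x| <= M.
Proof. by have /asboolP[] := bcvalP f. Qed.

Definition bc_norm (f : bcfun) : R := sup (range (fun x => `|f x|)).

Lemma bc_norm_ge (f : bcfun) x : `|f x| <= bc_norm f.
Proof.
apply: sup_upper_bound; last by exists x.
split; first by exists `|f 0|; exists 0.
by have [M fM] := bc_bounded f; exists M => _ [y _ <-].
Qed.

Lemma bc_norm_le (f : bcfun) (M : R) : (forall x, `|f x| <= M) -> bc_norm f <= M.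
Proof.
move=> fM; apply: ge_sup; first by exists `|f 0|; exists 0.
by move=> _ [y _ <-].
Qed.

Lemma bc_normD (f g : bcfun) : bc_norm (f + g) <= bc_norm f + bc_norm g.
Proof.
apply: bc_norm_le => x; apply: le_trans (ler_normD _ _) _.
by apply: lerD; exact: bc_norm_ge.
Qed.

Lemma bc_normZ (a : R) (f : bcfun) : bc_norm (a *: f) = `|a| * bc_norm f.
Proof.
have le (b : R) (g : bcfun) : bc_norm (b *: g) <= `|b| * bc_norm g.
  by apply: bc_norm_le => x; rewrite normrZ ler_wpM2l// bc_norm_ge.
apply/eqP; rewrite eq_le le /=.
have [->|a0] := eqVneq a 0.
  rewrite normr0 mul0r; apply: le_trans (bc_norm_ge _ 0) => //.
have := le a^-1 (a *: f); rewrite scalerA mulVf// scale1r normfV.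
by rewrite mulrC ler_pdivlMr ?normr_gt0// mulrC.
Qed.

Lemma bc_norm_eq0 (f : bcfun) : bc_norm f = 0 -> f = 0.
Proof.
move=> f0; apply/val_inj/funext => x /=; apply/eqP.
by rewrite -normr_le0 -f0 bc_norm_ge.
Qed.

HB.instance Definition _ := @Lmodule_isNormed.Build R bcfun
  bc_norm bc_normD bc_normZ bc_norm_eq0.

Lemma bc_ev_le (f : bcfun) x : `|f x| <= `|f|.
Proof. exact: bc_norm_ge. Qed.

Lemma bc_le_norm (f : bcfun) (M : R) : (forall x, `|f x| <= M) -> `|f| <= M.
Proof. exact: bc_norm_le. Qed.

(** Takes the default value 0 when [f] is not bounded and continuous. *)
Definition bc_of (f : R -> V) : bcfun := insubd (0 : bcfun) f.

Lemma bc_ofE (f : R -> V) (M : R) : continuous f -> (forall x, `|f x| <= M) ->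
  bc_of f = f :> (R -> V).
Proof.
move=> fc fM; rewrite /bc_of /insubd insubT//; apply/asboolP.
by split => //; exists M.
Qed.

End bounded_continuous.

Section bounded_continuous_complete.
Context {R : realType} (V : completeNormedModType R).

(** A Cauchy filter for the sup norm converges pointwise, and uniformly so; the limit is therefore
    continuous and bounded. *)
Lemma bc_complete (F : set_system (bcfun V)) :
  ProperFilter F -> cauchy F -> cvg F.
Proof.
move=> FF Fc.
have FcP (e : R) : 0 < e -> exists2 A, F A & forall f g, A f -> A g -> `|f - g| < e.
  move=> e0; have [[A B] /= [FA FB] AB] := Fc _ (@entourage_ball R (bcfun V) (PosNum e0)).
  exists (A `&` B); first exact: filterI.
  move=> f g [Af _] [_ Bg].
  by have := AB (f, g) (conj Af Bg); rewrite /= -ball_normE.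
have evc x : cvg ((fun f : bcfun V => f x) @ F).
  apply: cauchy_cvg => E; rewrite -entourage_ballE => -[e /= e0 eE].
  have [A FA AP] := FcP e e0.
  exists ([set y | exists2 f : bcfun V, A f & f x = y],
          [set y | exists2 f : bcfun V, A f & f x = y]).
    have H : F [set f : bcfun V | exists2 g : bcfun V, A g & g x = f x].
      by apply: filterS FA => f Af; exists f.
    by split; exact: H.
  move=> [_ _] [/= [f Af <-] [g Ag <-]]; apply: eE; rewrite /= -ball_normE /=.
  by apply: le_lt_trans (AP f g Af Ag); exact: (bc_ev_le (f - g) x).
pose h x := lim ((fun f : bcfun V => f x) @ F).
have hP (e : R) : 0 < e ->
    exists2 A, F A & forall f, A f -> forall x, `|f x - h x| <= e.
  move=> e0; have [A FA AP] := FcP e e0; exists A => // f Af x.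
  apply/ler_addgt0Pr => e' e'0.
  have /cvgrPdist_lt/(_ e' e'0) n1 := evc x.
  have [g [Ag gx]] : exists g, A g /\ `|h x - g x| < e'.
    by apply: (@filter_ex _ F); apply: filterI => //; exact: n1.
  have -> : f x - h x = (f - g) x - (h x - g x).
    by rewrite opprB addrA subrK.
  apply: le_trans (ler_normB _ _) _; apply: lerD; last exact: ltW.
  by apply: le_trans (bc_ev_le (f - g) x) _; exact/ltW/AP.
have hc : continuous h.
  move=> x; apply/cvgrPdist_lt => e e0 /=.
  have e4 : 0 < e / 4 by rewrite divr_gt0.
  have [A FA AP] := hP _ e4; have [f Af] := filter_ex FA.
  have /cvgrPdist_lt/(_ _ e4) n1 := @bc_continuous _ _ f x.
  apply: filterS n1 => y fy.
  have H1 := AP f Af x; have H2 := AP f Af y.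
  have -> : h x - h y = (h x - f x) + (f x - f y) + (f y - h y).
    by rewrite !addrA !subrK.
  apply: le_lt_trans (ler_normD _ _) _.
  apply: le_lt_trans (lerD (ler_normD _ _) (lexx _)) _.
  move: fy H1 H2; rewrite [`|f x - h x|]distrC.
  by set a := `|_|; set b := `|_|; set c := `|_|; lra.
have [A1 FA1 AP1] := hP 1 ltr01; have [f1 Af1] := filter_ex FA1.
have hM x : `|h x| <= `|f1| + 1.
  rewrite -[h x](subKr (f1 x)); apply: le_trans (ler_normB _ _) _.
  by apply: lerD; [exact: bc_ev_le|exact: AP1].
apply/cvg_ex; exists (bc_of h); apply/cvgrPdist_le => e e0.
have [A FA AP] := hP e e0; apply: filterS FA => f Af.
apply: bc_le_norm => x /=; rewrite distrC.
have := congr1 (fun F => F x) (bc_ofE hc hM) => /= hE.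
rewrite [X in `|X|](_ : _ = f x - h x); first exact: AP.
by rewrite /= -hE.
Qed.

HB.instance Definition _ := Uniform_isComplete.Build (bcfun V) bc_complete.

End bounded_continuous_complete.

(** * Superposition operators on bounded continuous functions *)

Section nemytskii.
Context {R : realType}.
Implicit Types V W : normedModType R.

(** Keeps [range_in] stable under [bc_pair]: the added tangent vector ranges over a closed ball,
    which has to be compact. *)
Definition proper_space V := forall M : R, compact [set v : V | `|v| <= M].

Lemma proper_prod V W : proper_space V -> proper_space W ->
  proper_space (V * W)%type.
Proof.
move=> pV pW M.
rewrite (_ : [set v | _] = [set v : V | `|v| <= M] `*` [set v : W | `|v| <= M]).
  exact: compact_setX.
apply/seteqP; split=> [z /= zM|z [/= z1 z2]]; last exact: norm_pair_le.
by split; [apply: le_trans zM; exact: norm_fst_le|apply: le_trans zM; exact: norm_snd_le].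
Qed.

Lemma proper_rV m : proper_space 'rV[R]_m.
Proof.
move=> M; apply: bounded_closed_compact.
  by exists M; split; [exact: num_real|move=> y My x /= xM; exact: le_trans (ltW My)].
have -> : [set v : 'rV[R]_m | `|v| <= M] = Num.norm @^-1` [set t | t <= M] by [].
apply: closed_comp; last exact: closed_le.
by move=> x _; exact: norm_continuous.
Qed.

Definition bc_pair V W (z : bcfun V * bcfun W) : bcfun (V * W)%type :=
  bc_of (fun s => (z.1 s, z.2 s)).

Lemma bc_pairE V W (z : bcfun V * bcfun W) s : bc_pair z s = (z.1 s, z.2 s).
Proof.
have H := @bc_ofE R (V * W)%type (fun s => (z.1 s, z.2 s)) `|z|.
rewrite /bc_pair H//.
  by move=> x; exact: (cvg_pair (@bc_continuous _ _ z.1 x) (@bc_continuous _ _ z.2 x)).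
move=> x; apply: norm_pair_le => /=; apply: le_trans (bc_ev_le _ _) _.
  exact: norm_fst_le.
exact: norm_snd_le.
Qed.

Lemma bcfunP V (f g : bcfun V) : (forall s, f s = g s) -> f = g.
Proof. by move=> fg; apply/val_inj/funext. Qed.

Lemma Cinf_bounded_linear V W (U : set V) (f : V -> W) (k : R) :
  linear f -> (forall h, `|f h| <= k * `|h|) -> Cinf U f.
Proof.
move=> fl fk; apply: Cinf_linear => //.
pose fm := GRing.isLinear.Build R V W _ f fl.
pose F : {linear V -> W} := HB.pack f fm.
exact: (@linear_continuous_norm _ _ _ F k fk).
Qed.

Lemma bc_addE V (f g : bcfun V) s : (f + g) s = f s + g s.
Proof. by []. Qed.

Lemma bc_scaleE V (a : R) (f : bcfun V) s : (a *: f) s = a *: f s.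
Proof. by []. Qed.

Lemma bc_subE V (f g : bcfun V) s : (f - g) s = f s - g s.
Proof. by []. Qed.

Lemma bc_pair_Cinf V W (U : set (bcfun V * bcfun W)) : Cinf U (@bc_pair V W).
Proof.
apply: (@Cinf_bounded_linear _ _ _ _ 1).
  move=> a z z'; apply: bcfunP => s.
  by rewrite bc_addE bc_scaleE !bc_pairE.
move=> z; rewrite mul1r; apply: bc_le_norm => s; rewrite bc_pairE.
apply: norm_pair_le => /=; apply: le_trans (bc_ev_le _ _) _.
  exact: norm_fst_le.
exact: norm_snd_le.
Qed.

(** The compact set makes the estimates on [X] uniform along [u]; the margin [r] makes the condition
    open for the sup norm. *)
Definition range_in V (O : set V) : set (bcfun V) :=
  [set u | exists (K : set V) (r : R), [/\ compact K, K `<=` O, 0 < r &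
     forall s y, `|y - u s| <= r -> K y]].

Lemma range_in_open V (O : set V) : open (range_in O).
Proof.
rewrite openE => u [K [r [cK KO r0 uK]]].
suff : \forall v \near u, range_in O v by [].
have r2 : 0 < r / 2 by rewrite divr_gt0.
apply/nbhs_normP; exists (r / 2) => //= v uv.
exists K, (r / 2); split=> // s y ys; apply: (uK s).
have -> : y - u s = (y - v s) - (u - v) s by rewrite opprB addrA subrK.
apply: le_trans (ler_normB _ _) _; rewrite (splitr r); apply: lerD => //.
by apply: le_trans (bc_ev_le _ _) _; exact: ltW.
Qed.

Lemma range_in_in V (O : set V) u s : range_in O u -> O (u s).
Proof.
move=> [K [r [cK KO r0 uK]]]; apply: KO; apply: (uK s).
by rewrite subrr normr0 ltW.
Qed.

Lemma range_in_pair V W (O : set V) u (h : bcfun W) : proper_space W ->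
  range_in O u -> range_in [set z : V * W | O z.1] (bc_pair (u, h)).
Proof.
move=> pW [K [r [cK KO r0 uK]]].
exists (K `*` [set w : W | `|w| <= `|h| + r]), r; split => //.
- exact: compact_setX.
- by move=> z [/KO].
- move=> s [y w]; rewrite bc_pairE /= => yw; split.
    by apply: (uK s); apply: le_trans yw; exact: (norm_fst_le (y - u s, w - h s)).
  rewrite /= -[w](subrK (h s)) addrC; apply: le_trans (ler_normD _ _) _.
  apply: lerD; first exact: bc_ev_le.
  by apply: le_trans yw; exact: (norm_snd_le (y - u s, w - h s)).
Qed.

Lemma continuous_bounded_range V W (O : set V) (X : V -> W) (u : bcfun V) :
  (forall x, O x -> {for x, continuous X}) -> range_in O u ->
  exists M : R, forall s, `|X (u s)| <= M.
Proof.
move=> Xc [K [r [cK KO r0 uK]]].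
have /compact_near_coveringP ncK := cK.
have : \forall M \near +oo, K `<=` (fun x => `|X x| <= M).
  apply: (ncK R (+oo)) => x Kx.
  exists (X @^-1` ball (X x) 1, [set M | `|X x| + 1 < M]).
    split; last by apply: nbhs_pinfty_gt; exact: num_real.
    by apply: (Xc x (KO _ Kx)); exact: nbhsx_ballx.
  move=> [y M] [/= + XM]; rewrite -ball_normE /= => Xy.
  apply: le_trans (ltW XM); rewrite -[X y](subKr (X x)).
  by apply: le_trans (ler_normB _ _) _; rewrite lerD2l ltW.
move=> H; have [M MK] := filter_ex H; exists M => s; apply: MK.
by apply: (uK s); rewrite subrr normr0 ltW.
Qed.

Definition nem V W (X : V -> W) (u : bcfun V) : bcfun W := bc_of (fun s => X (u s)).

Lemma nemE V W (O : set V) (X : V -> W) (u : bcfun V) s :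
  (forall x, O x -> {for x, continuous X}) -> range_in O u ->
  nem X u s = X (u s).
Proof.
move=> Xc uO; have [M uM] := continuous_bounded_range Xc uO.
rewrite /nem (bc_ofE _ uM)// => x.
apply: (@continuous_comp _ _ _ u X); first exact: bc_continuous.
by apply: Xc; exact: range_in_in.
Qed.

(** Strict differentiability gives the estimate on a neighbourhood of each point with one radius,
    and compactness of [K] makes the radius common. *)
Lemma uniform_diff_estimate V m (O : set V) (X : V -> 'rV[R]_m) (K : set V)
    (e : R) : open O -> Cinf O X -> compact K -> K `<=` O -> 0 < e ->
  exists2 d : R, 0 < d & forall y h, K y -> `|h| < d ->
    `|X (y + h) - X y - 'd X y h| <= e * `|h|.
Proof.
move=> oO Xi /compact_near_coveringP cK KO e0.
have e2 : 0 < e / 2 by rewrite divr_gt0.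
have H : \forall d \near (0 : R)^'+, K `<=` (fun y => forall h, `|h| < d ->
    `|X (y + h) - X y - 'd X y h| <= e * `|h|).
  apply: (cK R ((0 : R)^'+)) => x Kx.
  have [r r0 rP] := strictly_differentiable oO Xi (KO _ Kx) e2.
  have := diff_norm_continuous oO Xi (KO _ Kx) e2 => n1.
  have r2 : 0 < r / 2 by rewrite divr_gt0.
  exists ([set y | `|y - x| < r / 2 /\ forall w, `|'d X y w - 'd X x w| <= e / 2 * `|w|],
          [set d | d < r / 2]).
    split; last exact: nbhs_right_lt.
    apply: filterI => //; apply/nbhs_normP; exists (r / 2) => //= y.
    by rewrite distrC.
  move=> [y d] [/= [yr yw] dr] h hd.
  have r2r : r / 2 < r by rewrite ltr_pdivrMr// ltr_pMr// ltr1n.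
  have yh : `|y + h - x| < r.
    rewrite addrAC (splitr r); apply: le_lt_trans (ler_normD _ _) _.
    by apply: ltrD => //; exact: lt_trans dr.
  have := rP y (y + h) (lt_trans yr r2r) yh.
  rewrite [y + h - y]addrAC subrr add0r => H1; have H2 := yw h.
  have -> : X (y + h) - X y - 'd X y h =
     (X (y + h) - X y - 'd X x h) - ('d X y h - 'd X x h).
    by rewrite opprB addrA subrK.
  apply: le_trans (ler_normB _ _) _; apply: le_trans (lerD H1 H2) _.
  by rewrite -mulrDl -splitr.
have [d [d0 dP]] : exists d : R, 0 < d /\ K `<=` (fun y => forall h, `|h| < d ->
    `|X (y + h) - X y - 'd X y h| <= e * `|h|).
  apply: (@filter_ex _ ((0 : R)^'+)).
  by apply: filterI => //; exact: nbhs_right_gt.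
by exists d => // y h Ky hd; exact: dP.
Qed.

Lemma uniform_diff_bound V m (O : set V) (X : V -> 'rV[R]_m) (K : set V) :
  open O -> Cinf O X -> compact K -> K `<=` O ->
  exists2 k : R, 0 < k & forall y h, K y -> `|'d X y h| <= k * `|h|.
Proof.
move=> oO Xi /compact_near_coveringP cK KO.
have H : \forall k \near +oo, K `<=` (fun y => forall h, `|'d X y h| <= k * `|h|).
  apply: (cK R (+oo)) => x Kx.
  have [k k0 hk] := diff_norm_bound (Cinf_differentiable Xi (KO _ Kx)).
  exists ([set y | forall w, `|'d X y w - 'd X x w| <= 1 * `|w|],
          [set M | k + 1 < M]).
    split; last by apply: nbhs_pinfty_gt; exact: num_real.
    exact: (diff_norm_continuous oO Xi (KO _ Kx)).
  move=> [y M] [/= yw kM] h.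
  apply: (@le_trans _ _ ((k + 1) * `|h|)); last by rewrite ler_wpM2r// ltW.
  rewrite -['d X y h](subrK ('d X x h)) addrC mulrDl.
  by apply: le_trans (ler_normD _ _) _; apply: lerD.
have [k [k0 kP]] : exists k : R, 0 < k /\
    K `<=` (fun y => forall h, `|'d X y h| <= k * `|h|).
  apply: (@filter_ex _ (+oo : set_system R)).
  by apply: filterI => //; apply: nbhs_pinfty_gt; exact: num_real.
by exists k => // y h Ky; exact: kP.
Qed.

(** The first order estimate on [X] is uniform over the compact set that contains the range of [u],
    so it passes to the sup norm. *)
Lemma nem_diff V m (O : set V) (X : V -> 'rV[R]_m) (u : bcfun V) :
  proper_space V -> open O -> Cinf O X -> range_in O u ->
  differentiable (nem X) u /\ 'd (nem X) u =
    (fun h => nem (fun z : V * V => 'd X (z.1) (z.2)) (bc_pair (u, h)))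
      :> (bcfun V -> bcfun 'rV[R]_m).
Proof.
move=> pV oO Xi uO.
have Xc x : O x -> {for x, continuous X} := Cinf_continuous Xi.
have [_ dXi] := (Cinf_tangent O X).1 Xi.
pose g (z : V * V) := 'd X (z.1) (z.2).
have gc z : O z.1 -> {for z, continuous g} by move=> Oz; exact: (Cinf_continuous dXi).
have gE h s : nem g (bc_pair (u, h)) s = 'd X (u s) (h s).
  rewrite (@nemE _ _ [set z : V * V | O z.1])//.
    by rewrite /g bc_pairE.
  exact: range_in_pair.
have [K [r [cK KO r0 uK]]] := uO.
have us s : K (u s) by apply: (uK s); rewrite subrr normr0 ltW.
have [k k0 hk] := uniform_diff_bound oO Xi cK KO.
apply: (@differentiable_epsP _ _ _ _ _ _ k).
- move=> a h h'; apply: bcfunP => s.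
  rewrite [LHS]gE [RHS]bc_addE [X in _ = X + _]bc_scaleE.
  rewrite [X in _ = _ *: X + _]gE [X in _ = _ + X]gE.
  exact: (linearP ('d X (u s))).
- move=> h; apply: bc_le_norm => s; rewrite gE; apply: le_trans (hk _ _ (us s)) _.
  by rewrite ler_pM2l// bc_ev_le.
- move=> e e0; have [d d0 dP] := uniform_diff_estimate oO Xi cK KO e0.
  have n1 : \forall h \near (0 : bcfun V), range_in O (u + h).
    have : \forall v \near u, range_in O v.
      by apply: open_nbhs_nbhs; split => //; exact: range_in_open.
    move=> /nbhs_normP[d' d'0 dP']; apply/nbhs_normP; exists d'; first exact: d'0.
    move=> h hd; apply: dP'; move: hd.
    by rewrite /ball_ /mkset opprD addrA subrr.
  have n2 : \forall h \near (0 : bcfun V), `|h| < d by exact: nbhs0_lt.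
  apply: filterS2 n1 n2 => h hO hd.
  apply: bc_le_norm => s.
  have E1 := nemE s Xc hO; have E2 := nemE s Xc uO.
  have hs : `|h s| < d by apply: le_lt_trans hd; exact: bc_ev_le.
  have -> : (nem X (u + h) - nem X u - nem g (bc_pair (u, h))) s =
      X (u s + h s) - X (u s) - 'd X (u s) (h s).
    by rewrite [LHS]bc_subE [X in X - _]bc_subE [X in X - _ - _]E1 [X in _ - X - _]E2 [X in _ - _ - X]gE.
  apply: le_trans (dP _ _ (us s) hs) _.
  by rewrite ler_pM2l// bc_ev_le.
Qed.

(** The tangent map of [nem X] is the superposition operator of the tangent map of [X] after the
    bounded linear map [bc_pair], so the induction passes from [V] to [V * V]. *)
Lemma Ck_nem k V m (O : set V) (X : V -> 'rV[R]_m) :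
  proper_space V -> open O -> Cinf O X -> Ck k (range_in O) (nem X).
Proof.
elim: k V O X => [|k IH] V O X pV oO Xi.
  move=> u uO; apply: differentiable_continuous.
  by case: (nem_diff pV oO Xi uO).
split; first by move=> u uO; case: (nem_diff pV oO Xi uO).
have [_ dXi] := (Cinf_tangent O X).1 Xi.
have pVV := proper_prod pV pV.
have oO1 : open [set z : V * V | O z.1] by exact: open_fst.
have H := IH _ _ _ pVV oO1 dXi.
have oR : open [set z : bcfun V * bcfun V | range_in O z.1].
  by apply: open_fst; exact: range_in_open.
have C := @Ck_comp _ k _ _ _ [set z : bcfun V * bcfun V | range_in O z.1]
  (range_in [set z : V * V | O z.1]) (@bc_pair V V)
  (nem (fun z : V * V => 'd X (z.1) (z.2))) oR _ (@bc_pair_Cinf V V _ k) H.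
apply: (Ck_eq oR _ (C _)).
  by move=> [u h] /= uO; case: (nem_diff pV oO Xi uO) => _ ->.
by move=> [u h] /= uO; exact: range_in_pair.
Qed.

End nemytskii.

(** * Primitives on the unit interval *)

Section primitives.
Context {R : realType}.

(** Integrating over [-1, 2] keeps [0, 1] in the interior, so the derivative is two-sided at 0 and 1
    as well. *)
Lemma primitive_exists (g : R -> R) : continuous g ->
  exists G : R -> R, G 0 = 0 /\ forall x : R, -1 < x < 2 -> is_derive x (1 : R) G (g x).
Proof.
move=> gc; pose F x := (\int[lebesgue_measure]_(t in `[(-1 : R), x]) g t)%R.
exists (fun x => F x - F 0); split; first by rewrite subrr.
move=> x /andP[x1 x2].
have gi : lebesgue_measure.-integrable `[(-1 : R), 2] (EFin \o g).
  apply: continuous_compact_integrable; first exact: segment_compact.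
  exact: continuous_subspaceT.
have [Fd FE] := continuous_FTC1_closed x2 gi x1 (gc x).
have H : is_derive x (1 : R) F (g x) by split; [exact: Fd|rewrite -derive1E; exact: FE].
by have := is_deriveB H (is_derive_cst (F 0) x 1); rewrite subr0; apply.
Qed.

Definition clamp (s : R) : R := Num.max 0 (Num.min 1 s).

Lemma clamp_in s : 0 <= clamp s <= 1.
Proof.
rewrite /clamp le_max lexx /= ge_max ler01 /=.
by rewrite ge_min lexx.
Qed.

Lemma clamp_id s : 0 <= s <= 1 -> clamp s = s.
Proof.
by move=> /andP[s0 s1]; rewrite /clamp (min_idPr s1) (max_idPr s0).
Qed.

Lemma clampK s : clamp (clamp s) = clamp s.
Proof. by apply: clamp_id; exact: clamp_in. Qed.

Lemma clamp_continuous : continuous clamp.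
Proof.
move=> s; apply: (@continuous_max R R (fun=> 0) (fun s => Num.min 1 s)).
  exact: cvg_cst.
apply: (@continuous_min R R (fun=> 1) (fun s => s)); first exact: cvg_cst.
exact: cvg_id.
Qed.

Variable m : nat.
Local Notation C := (bcfun 'rV[R]_m).

(** The constant continuation outside [0, 1] keeps a primitive bounded. These conditions determine
    it, and the linearity of the operator of primitives follows from that uniqueness. *)
Definition is_primitive (u w : C) := [/\ w 0 = 0, forall s, w s = w (clamp s) &
  forall s : R, 0 < s < 1 -> forall j,
    is_derive s (1 : R) (fun t => w t 0 j : R) (u s 0 j)].

Lemma bc_coord_continuous (u : C) j : continuous (fun s => u s 0 j : R).
Proof.
move=> s; apply: (@continuous_comp _ _ _ u (fun M : 'rV[R]_m => M 0 j : R)).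
  exact: bc_continuous.
exact: coord_continuous.
Qed.

Lemma primitive_unique (u w w' : C) :
  is_primitive u w -> is_primitive u w' -> w = w'.
Proof.
move=> [w0 wc wd] [w'0 w'c w'd]; apply: bcfunP => s.
rewrite wc w'c; have /andP[] := clamp_in s.
move: (clamp s) => {}s s0 s1; apply/rowP => j.
have [|||c _] := @MVT_segment R (fun t => w t 0 j - w' t 0 j) (fun=> 0) 0 s.
- exact: s0.
- move=> t; rewrite in_itv /= => /andP[t0 ts].
  have t01 : 0 < t < 1 by rewrite t0 (lt_le_trans ts).
  have := is_deriveB (wd t t01 j) (w'd t t01 j).
  by rewrite subrr; apply.
- apply: continuous_subspaceT => t; apply: cvgB; exact: bc_coord_continuous.
rewrite w0 w'0 subrr subr0 mul0r => /eqP.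
by rewrite subr_eq0 => /eqP.
Qed.

(** The constant is 1 because the interval has length 1 and the norm is taken entry by entry. *)
Lemma primitive_norm_exists (u : C) :
  exists2 w : C, is_primitive u w & `|w| <= `|u|.
Proof.
have /choice[G GP] j := primitive_exists (@bc_coord_continuous u j).
pose h s : 'rV[R]_m := \row_j G j (clamp s).
have Gd j (s : R) : 0 <= s <= 1 -> is_derive s (1 : R) (G j) (u s 0 j).
  by move=> /andP[s0 s1]; case: (GP j) => _; apply; apply/andP; split; lra.
have hc : continuous h.
  move=> s; apply: row_continuous => j.
  rewrite (_ : (fun y => _) = G j \o clamp); last first.
    by apply/funext => y /=; rewrite mxE.
  apply: continuous_comp; first exact: clamp_continuous.
  apply: differentiable_continuous; apply/derivable1_diffP.
  by case: (Gd j _ (clamp_in s)).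
have hM s : `|h s| <= `|u|.
  apply: mx_norm_leP => // i j; rewrite mxE.
  have /andP[c0 c1] := clamp_in s.
  have := @real_mean_value_le R (G j) (fun t => u t 0 j) (clamp s) `|u| c0.
  rewrite (GP j).1 subr0 => H; apply: le_trans (H _ _) _.
  + by move=> t /andP[t0 tc]; apply: Gd; rewrite t0 (le_trans tc).
  + move=> t _; apply: le_trans (mx_coord_norm_le _ _ _) _; exact: bc_ev_le.
  by rewrite ler_piMr.
have wE : bc_of h = h :> (R -> 'rV[R]_m) := bc_ofE hc hM.
exists (bc_of h); last by apply: bc_le_norm => s; rewrite wE.
split.
- rewrite wE; apply/rowP => j; rewrite !mxE clamp_id ?lexx ?ler01//.
  exact: (GP j).1.
- by move=> s; rewrite wE; apply/rowP => j; rewrite !mxE clampK.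
- move=> s s01 j.
  have s01' : 0 <= s <= 1 by case/andP: s01 => *; rewrite !ltW.
  have nE : \forall t \near s, bc_of h t 0 j = G j t.
    have : \forall t \near s, t \in `]0, 1[ by apply: near_in_itvoo; rewrite in_itv.
    apply: filterS => t; rewrite in_itv /= => /andP[t0 t1].
    by rewrite wE mxE clamp_id// !ltW.
  have nE' : \forall t \near s, G j t = (bc_of h t 0 j : R).
    by apply: filterS nE => t ->.
  have D := near_eq_is_derive nE' (Gd j s s01').
  exact: D.
Qed.

Lemma primitive_operator : exists I : C -> C, [/\ linear I,
  forall u, `|I u| <= `|u|, forall u, is_primitive u (I u) &
  forall u w, is_primitive u w -> w = I u].
Proof.
have /choice[I IP] u : exists w : C, is_primitive u w /\ `|w| <= `|u|.
  by have [w wp wn] := primitive_norm_exists u; exists w.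
have Iu u w : is_primitive u w -> w = I u.
  by move=> uw; apply: primitive_unique uw _; case: (IP u).
exists I; split => //; [|by move=> u; case: (IP u)|by move=> u; case: (IP u)].
move=> a u v; apply/esym/Iu.
have [[u0 uc ud] _] := IP u; have [[v0 vc vd] _] := IP v; split.
- by rewrite bc_addE bc_scaleE u0 v0 scaler0 addr0.
- by move=> s; rewrite !bc_addE !bc_scaleE -uc -vc.
- move=> s s01 j.
  have D1 := is_deriveZ a (ud s s01 j).
  have D := is_deriveD D1 (vd s s01 j).
  have E : (a *: u + v) s 0 j = a *: (u s 0 j : R) + v s 0 j.
    by rewrite bc_addE bc_scaleE !mxE.
  rewrite E; have -> : (fun t : R => (a *: I u + I v) t 0 j) =
    (fun t => a *: (I u t 0 j : R) + I v t 0 j); last exact: D.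
  by apply/funext => t; rewrite bc_addE bc_scaleE !mxE.
Qed.

End primitives.

(** * Local flow of a smooth field *)

Section flow.
Context {R : realType} (m : nat).
Local Notation E := 'rV[R]_m.
Local Notation C := (bcfun 'rV[R]_m).

Definition bc_cst (x : E) : C := bc_of (fun=> x).

Lemma bc_cstE x s : bc_cst x s = x.
Proof. by rewrite /bc_cst (@bc_ofE _ _ _ `|x|)// => ?; exact: cvg_cst. Qed.

Lemma bc_cst_linear : linear bc_cst.
Proof.
by move=> a x y; apply: bcfunP => s; rewrite bc_addE bc_scaleE !bc_cstE.
Qed.

Lemma bc_cst_norm x : `|bc_cst x| <= 1 * `|x|.
Proof. by rewrite mul1r; apply: bc_le_norm => s; rewrite bc_cstE. Qed.

Lemma bc_ev_Cinf (U : set C) s : Cinf U (fun u : C => u s).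
Proof.
apply: (@Cinf_bounded_linear _ _ _ _ _ 1).
  by move=> a u v; rewrite bc_addE bc_scaleE.
by move=> u; rewrite mul1r bc_ev_le.
Qed.

Lemma bc_derive_range (X : E -> E) (O : set E) (u : C) (s : R) (v : E) :
  Cinf O X -> O (u s) ->
  (forall j, is_derive s (1 : R) (fun s => u s 0 j : R) (v 0 j)) ->
  forall j, is_derive s (1 : R) (fun s => X (u s) 0 j : R) ('d X (u s) v 0 j).
Proof.
move=> Xi Ous ud j.
have uder : derivable (fun s => u s : E) s 1.
  by apply/derivable_mxP => i k; rewrite (ord1 i); case: (ud k).
have udiff : differentiable (fun s => u s : E) s by apply/derivable1_diffP.
have uE : 'd (fun s => u s : E) s 1 = v.
  apply/rowP => k; rewrite -diff_coord//.
  have H : differentiable (fun s => u s 0 k : R) s.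
    by apply/derivable1_diffP; case: (ud k).
  by rewrite -[LHS]deriveE//; case: (ud k).
have Xd : differentiable X (u s) := Cinf_differentiable Xi Ous.
have cd : differentiable (X \o (fun s => u s : E)) s by exact: differentiable_comp.
have cdj : differentiable (fun s => X (u s) 0 j : R) s.
  have := @differentiable_comp _ _ _ _ (X \o (fun s => u s : E))
    (fun M : E => M 0 j : R) s cd; apply.
  exact: differentiable_coord.
split; first exact: diff_derivable.
rewrite [LHS]deriveE// [LHS](@diff_coord _ _ _ _ (X \o (fun s => u s : E)))//.
have cE : 'd (X \o (fun s => u s : E)) s = 'd X (u s) \o 'd (fun s => u s : E) s
  :> (R -> E) by exact: diff_comp.
by rewrite [LHS](congr1 (fun F : R -> E => F 1 0 j) cE) /= uE.
Qed.

Lemma diff_linear_comp (V W W' : normedModType R) (L : W -> W') (f : V -> W)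
    (x v : V) (k : R) : linear L -> (forall h, `|L h| <= k * `|h|) ->
  differentiable f x -> 'd (fun y => L (f y)) x v = L ('d f x v).
Proof.
move=> Ll Lk fd.
have Li : Cinf setT L := @Cinf_bounded_linear _ _ _ _ L k Ll Lk.
pose Lm := GRing.isLinear.Build R W W' _ L Ll.
pose LL : {linear W -> W'} := HB.pack L Lm.
have Lc : continuous LL by move=> y; exact: (Cinf_continuous Li).
have Ld : differentiable L (f x) := Cinf_differentiable Li I.
have E1 : 'd (L \o f) x = 'd L (f x) \o 'd f x :> (V -> W') by exact: diff_comp.
rewrite [LHS](congr1 (fun F => F v) E1) /=.
have E2 : 'd L (f x) = LL :> (W -> W') by exact: (@diff_lin _ _ _ LL).
exact: (congr1 (fun F => F ('d f x v)) E2).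
Qed.

Lemma diff_idE (V : normedModType R) (x v : V) : 'd (fun y : V => y) x v = v.
Proof.
have H : 'd (fun y : V => y) x = idfun :> (V -> V).
  by apply: (@diff_lin _ _ _ idfun) => y; exact: cvg_id.
exact: (congr1 (fun F => F v) H).
Qed.

Lemma diff_bounded_linear (V W : normedModType R) (L : V -> W) (x v : V)
    (k : R) : linear L -> (forall h, `|L h| <= k * `|h|) -> 'd L x v = L v.
Proof.
move=> Ll Lk; have idd : differentiable (fun y : V => y) x.
  exact: (Cinf_differentiable (@Cinf_id _ _ setT) Logic.I).
by have := diff_linear_comp v Ll Lk idd; rewrite diff_idE.
Qed.

(** Picard's equation with time rescaled to [0, 1]: for the parameter [(t, x)], the value of the
    unknown [u] at [s] is [x] plus [t] times the integral of [X (u)] from 0 to [s]. So [u s] is the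
    flow at time [t s], and [Phi] is its value at 1. Time becomes a parameter of the contraction,
    and smoothness in [(t, x)] comes with it. *)
Lemma flow_exists (X : E -> E) (O : set E) (x0 : E) :
  open O -> Cinf O X -> O x0 ->
  exists (Phi : R * E -> E) (Q : set (R * E)),
    [/\ open Q, Q (0, x0), Cinf Q Phi,
        forall z, Q z -> O (Phi z) /\ 'd Phi z (1, 0) = X (Phi z) &
        forall x, Q (0, x) -> Phi (0, x) = x].
Proof.
move=> oO Xi Ox0.
have Xc x : O x -> {for x, continuous X} := Cinf_continuous Xi.
have [I [Ilin Inorm Iprim Iuniq]] := @primitive_operator R m.
have Xd0 := Cinf_differentiable Xi Ox0.
have [r1 r10 r1P] := strictly_differentiable oO Xi Ox0 ltr01.
have [k k0 hk] := diff_norm_bound Xd0.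
have /nbhs_normP[r2 /= r20 r2P] := open_nbhs_nbhs (conj oO Ox0).
(* The first bound gives the Lipschitz estimate on the ball; the second leaves inside [O] the margin
   that [range_in] asks for. *)
pose r := Num.min (r1 / 2) (r2 / 3).
have r0 : 0 < r by rewrite lt_min !divr_gt0.
have rr1 : r < r1.
  have : r <= r1 / 2 by rewrite ge_min lexx.
  lra.
have rr2 : r + r < r2.
  have : r <= r2 / 3 by rewrite ge_min lexx orbT.
  lra.
pose L := k + 1; have L0 : 0 < L by rewrite addr_gt0.
have XL y z : `|y - x0| < r -> `|z - x0| < r -> `|X y - X z| <= L * `|y - z|.
  move=> yr zr; have := r1P z y (lt_trans zr rr1) (lt_trans yr rr1).
  have := hk (y - z); rewrite mul1r /L => H1 H2.
  rewrite -[X y - X z](subrK ('d X x0 (y - z))) mulrDl mul1r addrC.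
  by apply: le_trans (ler_normD _ _) _; apply: lerD.
pose u0 := bc_cst x0.
(* The operator of primitives has norm at most 1, so times below [1 / (2 L)] give the factor 1/2. *)
pose tau := (2 * L)^-1; have tau0 : 0 < tau by rewrite invr_gt0 mulr_gt0.
pose Om := [set z : (R * E) * C | `|z.1.1| < tau /\ `|z.2 - u0| < r].
have uOm z : Om z -> range_in O z.2.
  move=> [_ zr]; exists [set v : E | `|v - x0| <= r + r], r; split => //.
  - have -> : [set v : E | `|v - x0| <= r + r] =
       (fun v => v + x0) @` [set v : E | `|v| <= r + r].
      apply/seteqP; split => [v /= vr|_ [v /= vr <-]]; last by rewrite addrK.
      by exists (v - x0) => //; rewrite subrK.
    apply: continuous_compact; last exact: proper_rV.
    apply: continuous_subspaceT => v.
    have H := Cinf_add openT (@Cinf_id _ E setT) (@Cinf_cst _ E E setT x0).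
    exact: (Cinf_continuous H Logic.I).
  - by move=> v /= vr; apply: r2P; rewrite /= distrC; exact: le_lt_trans vr rr2.
  - move=> s y ys /=; rewrite -(subrK (z.2 s) y) -addrA.
    apply: le_trans (ler_normD _ _) _; apply: lerD => //.
    apply: le_trans (ltW zr); rewrite -(bc_cstE x0 s).
    exact: (bc_ev_le (z.2 - u0) s).
have ev z s : Om z -> `|z.2 s - x0| < r.
  move=> [_ zr]; apply: le_lt_trans zr; rewrite -(bc_cstE x0 s).
  exact: (bc_ev_le (z.2 - u0) s).
have oOm : open Om.
  have c1 : continuous (fun z : (R * E) * C => `|z.1.1|).
    move=> z; apply: (@continuous_comp _ R R (fun z => z.1.1) (fun t : R => `|t|)).
      by apply: (@continuous_comp _ _ _ fst fst z); exact: cvg_fst.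
    exact: (@norm_continuous R R).
  have c2 : continuous (fun z : (R * E) * C => `|z.2 - u0|).
    move=> z; apply: (@continuous_comp _ _ _ (fun z => z.2 - u0) Num.norm).
      by apply: cvgB; [exact: cvg_snd|exact: cvg_cst].
    exact: norm_continuous.
  rewrite (_ : Om = ((fun z => `|z.1.1|) @^-1` [set t | t < tau]) `&`
     ((fun z => `|z.2 - u0|) @^-1` [set t | t < r]))//.
  by apply: openI; (apply: open_comp; last exact: open_lt) => z _.
pose T (z : (R * E) * C) : C := bc_cst z.1.2 + z.1.1 *: I (nem X z.2).
have Nk : Cinf (range_in O) (nem X).
  by move=> j; apply: Ck_nem => //; exact: proper_rV.
have Ii (U : set C) : Cinf U I.
  by apply: (@Cinf_bounded_linear _ _ _ _ _ 1) => // u; rewrite mul1r.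
have Ci (U : set E) : Cinf U bc_cst.
  apply: (@Cinf_bounded_linear _ _ _ _ _ 1); first exact: bc_cst_linear.
  exact: bc_cst_norm.
have N2 : Cinf Om (fun z : (R * E) * C => nem X z.2).
  by apply: (@Cinf_comp _ _ _ oOm _ _ (range_in O)) => //; exact: Cinf_snd.
have I2 : Cinf Om (fun z : (R * E) * C => I (nem X z.2)).
  by apply: (@Cinf_comp _ _ _ oOm _ _ setT _ I) => //; exact: Ii.
have f1 : Cinf Om (fun z : (R * E) * C => z.1.1).
  apply: (@Cinf_comp _ _ _ oOm _ _ setT fst fst) => //.
    exact: Cinf_fst.
  exact: Cinf_fst.
have f2 : Cinf Om (fun z : (R * E) * C => z.1.2).
  apply: (@Cinf_comp _ _ _ oOm _ _ setT fst snd) => //.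
    exact: Cinf_fst.
  exact: Cinf_snd.
have C2 : Cinf Om (fun z : (R * E) * C => bc_cst z.1.2).
  by apply: (@Cinf_comp _ _ _ oOm _ _ setT _ bc_cst) => //; exact: Ci.
have TI : Cinf Om (fun z : (R * E) * C => z.1.1 *: I (nem X z.2)).
  exact: Cinf_scale.
have Ti : Cinf Om T by exact: Cinf_add.
have Om0 : Om ((0, x0), u0) by split; rewrite /= ?normr0// subrr normr0.
have T0 : T ((0, x0), u0) = u0 by rewrite /T /= scale0r addr0.
have IB u v : I (u - v) = I u - I v.
  by rewrite addrC -[- v]scaleN1r Ilin scaleN1r addrC.
have TL p v v' : Om (p, v) -> Om (p, v') ->
    `|T (p, v) - T (p, v')| <= 2^-1 * `|v - v'|.
  move=> O1 O2; have [/= pt _] := O1.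
  rewrite /T /= opprD addrACA subrr add0r -scalerBr -IB normrZ.
  have H : `|nem X v - nem X v'| <= L * `|v - v'|.
    apply: bc_le_norm => s; rewrite bc_subE.
    have E1 := nemE s Xc (uOm _ O1); have E2 := nemE s Xc (uOm _ O2).
    rewrite [X in `|X - _|]E1 [X in `|_ - X|]E2.
    apply: le_trans (XL _ _ (ev _ s O1) (ev _ s O2)) _.
    by rewrite ler_pM2l//; exact: (bc_ev_le (v - v') s).
  apply: (@le_trans _ _ (tau * (L * `|v - v'|))).
    apply: ler_pM => //; first exact: ltW.
    by apply: le_trans (Inorm _) H.
  by rewrite mulrA /tau invfM -(mulrA _ L^-1) mulVf ?mulr1// gt_eqF.
have [Q [rho [u [[oQ Q0] rho0 ui QOm uP]]]] :=
  contraction_family oOm Om0 Ti T0 TL.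
have Tfix p : Q p -> T (p, u p) = u p by move=> Qp; case: (uP p Qp).
have uQOm p : Q p -> Om (p, u p) by move=> Qp; case: (uP p Qp) => ur _ _; exact: QOm.
exists (fun p => u p 1), Q.
have Pi : Cinf Q (fun p => u p 1).
  by apply: (@Cinf_comp _ _ _ oQ _ _ setT _ (fun u : C => u 1)) => //;
    exact: bc_ev_Cinf.
split => //; last first.
  move=> x Qx; rewrite -(Tfix _ Qx) /T /= scale0r addr0.
  by rewrite bc_cstE.
move=> [t x] Qz; have Omz := uQOm _ Qz; set z := (t, x) in Qz Omz *.
have zO := uOm _ Omz; rewrite /= in zO.
split; first exact: range_in_in.
have Td := Cinf_differentiable Ti Omz.
have ud := Cinf_differentiable ui Qz.
pose du := 'd u z (1, 0).
(* [s X (u s)] solves the linearised equation, whose solution is unique. *)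
have [Nd NE] := nem_diff (@proper_rV R m) oO Xi zO.
pose g (y : E * E) := 'd X (y.1) (y.2).
have gE h s : nem g (bc_pair (u z, h)) s = 'd X (u z s) (h s).
  rewrite (@nemE _ _ _ [set y : E * E | O y.1])//.
  - by rewrite /g bc_pairE.
  - move=> y Oy; have [_ dXi] := (Cinf_tangent O X).1 Xi.
    exact: (Cinf_continuous dXi).
  - by apply: range_in_pair => //; exact: proper_rV.
have dT h : 'd T (z, u z) ((1, 0), h) =
    I (nem X (u z)) + t *: I (nem g (bc_pair (u z, h))).
  have Ad := Cinf_differentiable C2 Omz.
  have Bd := Cinf_differentiable TI Omz.
  have E1 := diffD Ad Bd.
  rewrite [LHS](congr1 (fun F => F ((1, 0), h)) E1).
  have a1 := Cinf_differentiable f1 Omz.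
  have b1 := Cinf_differentiable I2 Omz.
  have e1 : 'd (fun z : (R * E) * C => z.1.1) (z, u z) ((1, 0), h) = 1.
    have L1 : linear (fun z : (R * E) * C => z.1.1 : R) by [].
    rewrite (@diff_bounded_linear _ _ _ _ _ 1 L1)// => y.
    by rewrite mul1r; apply: le_trans (norm_fst_le y); exact: norm_fst_le.
  have e2 : 'd (fun z : (R * E) * C => bc_cst z.1.2) (z, u z) ((1, 0), h) = 0.
    have L1 : linear (fun z : (R * E) * C => bc_cst z.1.2).
      by move=> a y y'; rewrite /= bc_cst_linear.
    rewrite (@diff_bounded_linear _ _ _ _ _ 1 L1).
      by apply: bcfunP => s; rewrite bc_cstE.
    move=> y; apply: le_trans (bc_cst_norm _) _; rewrite !mul1r.
    by apply: le_trans (norm_fst_le y); exact: norm_snd_le.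
  have e3 : 'd (fun z : (R * E) * C => I (nem X z.2)) (z, u z) ((1, 0), h) =
      I (nem g (bc_pair (u z, h))).
    have nd := Cinf_differentiable N2 Omz.
    have In1 y : `|I y| <= 1 * `|y| by rewrite mul1r.
    rewrite (diff_linear_comp _ Ilin In1 nd); congr I.
    have sd : differentiable (@snd (R * E)%type C) (z, u z).
      exact: (Cinf_differentiable (@Cinf_snd _ _ _ setT)).
    have E2 : 'd (nem X \o @snd (R * E)%type C) (z, u z) =
        'd (nem X) (u z) \o 'd (@snd (R * E)%type C) (z, u z)
        :> ((R * E) * C -> C) by exact: diff_comp.
    rewrite [LHS](congr1 (fun F => F ((1, 0), h)) E2) /=.
    have E3 : 'd (@snd (R * E)%type C) (z, u z) = @snd (R * E)%type C
        :> ((R * E) * C -> C).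
      by apply: (@diff_lin _ _ _ (@snd (R * E)%type C)) => y; exact: cvg_snd.
    rewrite [X in 'd _ _ X](congr1 (fun F => F ((1, 0), h)) E3).
    exact: (congr1 (fun F => F h) NE).
  have E4 := @diff_scale _ _ _ _ _ _ (((1, 0), h) : (R * E) * C) a1 b1.
  apply: etrans (congr2 +%R e2 E4) _.
  by rewrite add0r e3 [X in _ + X *: _]e1 scale1r addrC.
have dTu : 'd T (z, u z) ((1, 0), du) = du.
  have nz : {near z, u =1 (fun p => T (p, u p))}.
    by apply: filterS (open_nbhs_nbhs (conj oQ Qz)) => p /Tfix ->.
  have pd : differentiable (fun p => (p, u p)) z by exact: differentiable_pair.
  have Tud : differentiable (T \o (fun p => (p, u p))) z.
    exact: differentiable_comp.
  have duE : du = 'd (T \o (fun p => (p, u p))) z (1, 0).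
    exact: (congr1 (fun F => F (1, 0)) (near_eq_diff nz Tud)).
  have E1 : 'd (T \o (fun p => (p, u p))) z = 'd T (z, u z) \o
    'd (fun p => (p, u p)) z :> (R * E -> C) by exact: diff_comp.
  have idd : differentiable (fun p : R * E => p) z.
    exact: (Cinf_differentiable (@Cinf_id _ _ setT) Logic.I).
  apply/esym; apply: etrans duE _.
  apply: etrans (congr1 (fun F => F (1, 0)) E1) _.
  apply: (congr1 ('d T (z, u z))).
  apply: etrans (congr1 (fun F => F (1, 0)) (diff_pair idd ud)) _.
  by congr (_, _); rewrite diff_idE.
(* The clamp is the factor [s], continued beyond [0, 1] in the way primitives are. *)
pose w0 s := clamp s *: X (u z s).
have [M XM] := continuous_bounded_range Xc zO.
pose w : C := bc_of w0.
have w0c : continuous w0.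
  move=> s; apply: (@cvgZ _ _ _ _ _ clamp (fun s => X (u z s))).
    exact: clamp_continuous.
  apply: (@continuous_comp _ _ _ (u z) X); first exact: bc_continuous.
  by apply: Xc; exact: range_in_in.
have w0M s : `|w0 s| <= M.
  have /andP[c0 c1] := clamp_in s.
  rewrite /w0 normrZ (ger0_norm c0); apply: le_trans (XM s).
  by rewrite ler_piMl.
have wE s : w s = w0 s by rewrite /w (bc_ofE w0c w0M).
have uzE s : u z s = x + t *: I (nem X (u z)) s.
  by rewrite -{1}(Tfix _ Qz) /T bc_addE bc_scaleE bc_cstE.
have w_eq : w = I (nem X (u z)) + t *: I (nem g (bc_pair (u z, w))).
  have -> : I (nem X (u z)) + t *: I (nem g (bc_pair (u z, w))) =
      I (t *: nem g (bc_pair (u z, w)) + nem X (u z)).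
    by rewrite Ilin addrC.
  have [In0 Inc Ind] := Iprim (nem X (u z)).
  apply: Iuniq; split.
  - by rewrite wE /w0 clamp_id ?lexx ?ler01// scale0r.
  - by move=> s; rewrite !wE /w0 clampK !uzE -Inc.
  (* Product rule for [s X (u s)], where the derivative of [u] in [s] is [t X (u)]. *)
  - move=> s s01 j; have /andP[s0 s1] := s01.
    have Nus := nemE s Xc zO.
    have ud1 i : is_derive s (1 : R) (fun s => u z s 0 i : R)
        ((t *: X (u z s)) 0 i).
      have D := is_deriveD (is_derive_cst (x 0 i) s 1) (is_deriveZ t (Ind s s01 i)).
      have -> : (fun s => u z s 0 i : R) =
          (fun s => x 0 i + t *: (I (nem X (u z)) s 0 i : R)).
        by apply/funext => s'; rewrite uzE !mxE.
      by rewrite mxE -Nus; move: D; rewrite add0r.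
    have Ous : O (u z s) by exact: range_in_in.
    have D2 := bc_derive_range Xi Ous ud1 j.
    have D3 : is_derive s (1 : R) (fun s => s * (X (u z s) 0 j : R))
        (s *: ('d X (u z s) (t *: X (u z s)) 0 j : R) + X (u z s) 0 j *: (1 : R)).
      exact: (is_deriveM (is_derive_id s 1) D2).
    have nE : \forall r \near s, r * (X (u z r) 0 j : R) = w r 0 j.
      have : \forall r \near s, r \in `]0, 1[ by apply: near_in_itvoo; rewrite in_itv.
      apply: filterS => r'; rewrite in_itv /= => /andP[t0 t1].
      by rewrite wE /w0 clamp_id ?mxE// !ltW.
    have D4 := near_eq_is_derive nE D3.
    apply: (is_derive_eq D4).
    rewrite bc_addE bc_scaleE gE Nus wE /w0 clamp_id ?ltW// !mxE.
    rewrite !(linearZ_LR ('d X (u z s))) !mxE /GRing.scale /=; ring.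
(* The difference is fixed by a linear map of norm at most 1/2, hence zero. *)
have wdu : w = du.
  have Tz := lipschitz_diff_snd oOm Omz (TL z) Td.
  have wT : 'd T (z, u z) ((1, 0), w) = w by rewrite dT -w_eq.
  have H : 'd T (z, u z) (0, w - du) = w - du.
    rewrite -{2}wT -{2}dTu -(linearB ('d T (z, u z))); congr ('d T _ _).
    by congr (_, _); rewrite /= subrr.
  have := Tz (w - du); rewrite H => H2; apply/eqP.
  rewrite -subr_eq0 -normr_le0; move: H2.
  by set a := `|_|; lra.
have -> : 'd (fun p => u p 1) z (1, 0) = du 1.
  have evl : linear (fun v : C => v 1).
    by move=> a v v'; rewrite bc_addE bc_scaleE.
  have evn (v : C) : `|v 1| <= 1 * `|v| by rewrite mul1r bc_ev_le.
  exact: (diff_linear_comp _ evl evn ud).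
by rewrite -wdu wE /w0 clamp_id ?scale1r// lexx ler01.
Qed.

End flow.

(** * Germs and Lie brackets *)

Section germs.
Context {R : realType}.
Implicit Types V W X : normedModType R.

(** Smoothness of germs, which composes without keeping track of domains. *)
Definition Csm V W (x : V) (f : V -> W) :=
  exists2 U : set V, open U /\ U x & Cinf U f.

Lemma Csm_open V W (x : V) (f : V -> W) : Csm x f -> \forall y \near x, Csm y f.
Proof.
move=> [U [oU Ux] fi]; apply: filterS (open_nbhs_nbhs (conj oU Ux)) => y Uy.
by exists U.
Qed.

Lemma Csm_differentiable V W (x : V) (f : V -> W) : Csm x f -> differentiable f x.
Proof. by move=> [U [_ Ux] fi]; exact: Cinf_differentiable Ux. Qed.

Lemma Csm_continuous V W (x : V) (f : V -> W) : Csm x f -> {for x, continuous f}.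
Proof. by move=> /Csm_differentiable/differentiable_continuous. Qed.

Lemma Csm_near_eq V W (x : V) (f g : V -> W) :
  {near x, f =1 g} -> Csm x g -> Csm x f.
Proof.
move=> fg [U [oU Ux] gi].
have : \forall y \near x, f y = g y by [].
rewrite /prop_near1 nbhsE => -[N [oN Nx] Nfg].
exists (U `&` N); first by split; [exact: openI|split].
apply: (@Cinf_eq _ _ _ _ _ g); first exact: openI.
  by move=> y [_ Ny]; exact: Nfg.
by apply: Cinf_sub gi => y; case.
Qed.

Lemma Csm2 V W W' (x : V) (f : V -> W) (g : V -> W') : Csm x f -> Csm x g ->
  exists U, [/\ open U, U x, Cinf U f & Cinf U g].
Proof.
move=> [U [oU Ux] fi] [N [oN Nx] gi]; exists (U `&` N); split => //.
- exact: openI.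
- by apply: Cinf_sub fi => y; case.
- by apply: Cinf_sub gi => y; case.
Qed.

Lemma Csm_comp V W X (x : V) (f : V -> W) (g : W -> X) :
  Csm x f -> Csm (f x) g -> Csm x (fun y => g (f y)).
Proof.
move=> [U [oU Ux] fi] [N [oN Nx] gi].
have oV : open (U `&` f @^-1` N).
  rewrite openE => y [Uy Ny]; rewrite /interior /=; apply: filterI.
    exact: open_nbhs_nbhs.
  by apply: (Cinf_continuous fi Uy); exact: open_nbhs_nbhs.
exists (U `&` f @^-1` N); first by split.
apply: (@Cinf_comp _ _ _ oV _ _ N) => //; first by move=> y [].
by apply: Cinf_sub fi => y; case.
Qed.

Lemma Csm_cst V W (x : V) (c : W) : Csm x (fun=> c).
Proof. by exists setT; [split; [exact: openT|]|exact: Cinf_cst]. Qed.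

Lemma Csm_id V (x : V) : Csm x (fun y => y).
Proof. by exists setT; [split; [exact: openT|]|exact: Cinf_id]. Qed.

Lemma Csm_pair V W X (x : V) (f : V -> W) (g : V -> X) :
  Csm x f -> Csm x g -> Csm x (fun y => (f y, g y)).
Proof.
move=> fs gs; have [U [oU Ux fi gi]] := Csm2 fs gs.
by exists U => //; exact: Cinf_pair.
Qed.

Lemma Csm_add V W (x : V) (f g : V -> W) :
  Csm x f -> Csm x g -> Csm x (fun y => f y + g y).
Proof.
move=> fs gs; have [U [oU Ux fi gi]] := Csm2 fs gs.
by exists U => //; exact: Cinf_add.
Qed.

Lemma Csm_sub V W (x : V) (f g : V -> W) :
  Csm x f -> Csm x g -> Csm x (fun y => f y - g y).
Proof.
move=> fs gs; have [U [oU Ux fi gi]] := Csm2 fs gs.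
by exists U => //; exact: Cinf_subr.
Qed.

Lemma Csm_scale V W (x : V) (a : V -> R) (f : V -> W) :
  Csm x a -> Csm x f -> Csm x (fun y => a y *: f y).
Proof.
move=> fs gs; have [U [oU Ux fi gi]] := Csm2 fs gs.
by exists U => //; exact: Cinf_scale.
Qed.

Lemma Csm_mul V (x : V) (a b : V -> R) :
  Csm x a -> Csm x b -> Csm x (fun y => a y * b y).
Proof. exact: Csm_scale. Qed.

Lemma Csm_inv V (x : V) (a : V -> R) : a x != 0 ->
  Csm x a -> Csm x (fun y => (a y)^-1).
Proof.
move=> a0 as_; apply: Csm_comp as_ _.
by exists [set t : R | t != 0]; [split; [exact: open_neq0|]|exact: Cinf_inv].
Qed.

Lemma Csm_diff V W X (x : V) (f : W -> X) (g h : V -> W) :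
  Csm (g x) f -> Csm x g -> Csm x h -> Csm x (fun y => 'd f (g y) (h y)).
Proof.
move=> [U [oU Ux] /Cinf_tangent[_ df]] gs hs.
have fs : Csm (g x, h x) (fun z : W * W => 'd f (z.1) (z.2)).
  by exists [set z : W * W | U z.1] => //; split => //; exact: open_fst.
exact: (Csm_comp (Csm_pair gs hs) fs).
Qed.

Lemma Csm_mxP V m n (x : V) (f : V -> 'M[R]_(m, n)) :
  (forall i j, Csm x (fun y => f y i j : R)) -> Csm x f.
Proof.
move=> fs; have /choice[U UP] (ij : 'I_m * 'I_n) : exists U : set V,
    [/\ open U, U x & Cinf U (fun y => f y ij.1 ij.2 : R)].
  by have [U [oU Ux] fi] := fs ij.1 ij.2; exists U.
pose O := [set y | forall ij, U ij y].
have oO : open O.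
  rewrite openE => y Oy.
  suff : \forall z \near y, forall ij, U ij z by [].
  by apply: filter_forall => ij; apply: open_nbhs_nbhs; split => //; case: (UP ij).
exists O; first by split=> // ij; case: (UP ij).
apply: Cinf_mxP => // i j; have [_ _ fi] := UP (i, j).
by apply: Cinf_sub fi => y Oy; exact: (Oy (i, j)).
Qed.

Lemma Csm_coord V m n (x : V) (f : V -> 'M[R]_(m, n)) i j :
  Csm x f -> Csm x (fun y => f y i j : R).
Proof. by move=> [U [oU Ux] fi]; exists U => //; exact: Cinf_coord. Qed.

Lemma Csm_linear_mx V W m n (x : V) (f : V -> 'M[R]_(m, n)) (L : 'M[R]_(m, n) -> W) :
  linear L -> Csm x f -> Csm x (fun y => L (f y)).
Proof.
move=> Ll fs; apply: Csm_comp fs _; exists setT; first by split=> //; exact: openT.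
exact: Cinf_linear_mx.
Qed.

Lemma Csm_mulmx V m n p (x : V) (f : V -> 'M[R]_(m, n)) (g : V -> 'M[R]_(n, p)) :
  Csm x f -> Csm x g -> Csm x (fun y => f y *m g y).
Proof.
move=> fs gs; have [U [oU Ux fi gi]] := Csm2 fs gs.
by exists U => //; exact: Cinf_mulmx.
Qed.

Lemma Csm_row V m n (x : V) (f : V -> 'M[R]_(m, n)) i :
  Csm x f -> Csm x (fun y => row i (f y)).
Proof. by apply: Csm_linear_mx => a u v; rewrite linearP. Qed.

Lemma unitmx_near V n (x : V) (f : V -> 'M[R]_n) : Csm x f -> f x \in unitmx ->
  \forall y \near x, f y \in unitmx.
Proof.
move=> [U [oU Ux] fi] fu.
have dc : {for x, continuous (fun y => \det (f y) : R)}.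
  exact: (Cinf_continuous (Cinf_det oU fi) Ux).
have : \forall y \near x, \det (f y) != 0.
  apply: (dc [set t | t != 0]); apply: open_nbhs_nbhs; split; first exact: open_neq0.
  by rewrite /= -unitfE -unitmxE.
by apply: filterS => y; rewrite unitmxE unitfE.
Qed.

Lemma Csm_invmx V n (x : V) (f : V -> 'M[R]_n) : f x \in unitmx ->
  Csm x f -> Csm x (fun y => invmx (f y)).
Proof.
move=> fu fs; have := unitmx_near fs fu; rewrite /prop_near1 nbhsE => -[N [oN Nx] Of].
have [U [oU Ux] fi] := fs; exists (U `&` N); first by split; [exact: openI|].
apply: Cinf_invmx; first exact: openI.
  by move=> y [_ /Of].
by apply: Cinf_sub fi => y; case.
Qed.

Lemma near_nearP V (x : V) (P : set V) : (\forall y \near x, P y) ->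
  \forall y \near x, \forall z \near y, P z.
Proof.
move=> xP; have [N [oN Nx] NP] : exists2 N, open_nbhs x N & N `<=` P.
  by move: xP; rewrite /prop_near1 nbhsE.
apply: filterS (open_nbhs_nbhs (conj oN Nx)) => y Ny.
have H := open_nbhs_nbhs (conj oN Ny); exact: (filterS NP H).
Qed.

Lemma diff_mulmx V m n p (A : V -> 'M[R]_(m, n)) (B : V -> 'M[R]_(n, p)) (x v : V) :
  differentiable A x -> differentiable B x ->
  'd (fun y => A y *m B y) x v = 'd A x v *m B x + A x *m 'd B x v.
Proof.
move=> ad bd.
have [|||sd sE] := @diff_bilinear R _ _ _
  (fun (A : 'M[R]_(m, n)) (B : 'M[R]_(n, p)) => A *m B) (A x, B x).
- by move=> b u u' w; rewrite mulmxDl scalemxAl.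
- by move=> b u w w'; rewrite mulmxDr scalemxAr.
- exists n%:R => u w; apply: mx_norm_leP.
    by rewrite !mulr_ge0.
  move=> i j; rewrite mxE; apply: le_trans (ler_norm_sum _ _ _) _.
  apply: (@le_trans _ _ (\sum_(k < n) `|u| * `|w|)).
    by apply: ler_sum => k _; rewrite normrM ler_pM// mx_coord_norm_le.
  by rewrite sumr_const card_ord -mulrA mulr_natl.
pose S (z : 'M[R]_(m, n) * 'M[R]_(n, p)) := z.1 *m z.2.
have pd : differentiable (fun y => (A y, B y)) x by exact: differentiable_pair.
have E : 'd (S \o (fun y => (A y, B y))) x =
  'd S (A x, B x) \o 'd (fun y => (A y, B y)) x :> (V -> 'M[R]_(m, p)).
  exact: diff_comp.
apply: etrans (congr1 (fun F => F v) E) _ => /=.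
have pv : 'd (fun y => (A y, B y)) x v = ('d A x v, 'd B x v).
  exact: (congr1 (fun F => F v) (diff_pair ad bd)).
rewrite pv; apply: etrans (congr1 (fun F => F ('d A x v, 'd B x v)) sE) _.
by rewrite addrC.
Qed.

Lemma diff_near_eq V W (x v : V) (f g : V -> W) : {near x, f =1 g} ->
  differentiable g x -> 'd f x v = 'd g x v.
Proof. by move=> fg gd; apply: (congr1 (fun F => F v)); exact: near_eq_diff. Qed.

Lemma diff_cstE V W (x v : V) (c : W) : 'd (fun=> c) x v = 0.
Proof. by rewrite [LHS](congr1 (fun F => F v) (diff_cst c x)). Qed.

Lemma diff_compE V W X (f : V -> W) (g : W -> X) (x v : V) :
  differentiable f x -> differentiable g (f x) ->
  'd (fun y => g (f y)) x v = 'd g (f x) ('d f x v).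
Proof.
move=> fd gd.
have E : 'd (g \o f) x = 'd g (f x) \o 'd f x :> (V -> X) by exact: diff_comp.
exact: (congr1 (fun F => F v) E).
Qed.

Lemma diff_linear_mxE W m n (L : 'M[R]_(m, n) -> W) x v : linear L -> 'd L x v = L v.
Proof.
move=> Ll; pose Lm := GRing.isLinear.Build R _ _ _ L Ll.
pose LL : {linear 'M[R]_(m, n) -> W} := HB.pack L Lm.
have Lc : continuous LL.
  by move=> y; exact: (Cinf_continuous (@Cinf_linear_mx _ _ _ _ setT _ Ll) I).
by rewrite [LHS](congr1 (fun F => F v) (@diff_lin _ _ _ LL x Lc)).
Qed.

Lemma diff_linear_mx_comp V W m n (L : 'M[R]_(m, n) -> W) (f : V -> 'M[R]_(m, n))
    (x v : V) : linear L -> differentiable f x ->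
  'd (fun y => L (f y)) x v = L ('d f x v).
Proof.
move=> Ll fd; rewrite diff_compE//; first by rewrite diff_linear_mxE.
exact: (Cinf_differentiable (@Cinf_linear_mx _ _ _ _ setT _ Ll) I).
Qed.

End germs.

(** * Lie brackets in coordinates *)

Section brackets.
Context {R : realType}.

Definition br d (X Y : 'rV[R]_d -> 'rV[R]_d) (x : 'rV[R]_d) : 'rV[R]_d :=
  'd Y x (X x) - 'd X x (Y x).

Lemma Csm_br d (X Y : 'rV[R]_d -> 'rV[R]_d) x : Csm x X -> Csm x Y -> Csm x (br X Y).
Proof. by move=> Xs Ys; apply: Csm_sub; apply: Csm_diff => //; exact: Csm_id. Qed.

Lemma brC d (X Y : 'rV[R]_d -> 'rV[R]_d) x : br X Y x = - br Y X x.
Proof. by rewrite /br opprB. Qed.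

Lemma brXX d (X : 'rV[R]_d -> 'rV[R]_d) x : br X X x = 0.
Proof. by rewrite /br subrr. Qed.

Lemma br_near_eq d (X Y X' Y' : 'rV[R]_d -> 'rV[R]_d) x :
  {near x, X =1 X'} -> {near x, Y =1 Y'} -> Csm x X' -> Csm x Y' ->
  br X Y x = br X' Y' x.
Proof.
move=> XX YY Xs Ys.
have E1 v : 'd Y x v = 'd Y' x v.
  by apply: diff_near_eq => //; exact: Csm_differentiable.
have E2 v : 'd X x v = 'd X' x v.
  by apply: diff_near_eq => //; exact: Csm_differentiable.
have XE : X x = X' x := nbhs_singleton XX.
have YE : Y x = Y' x := nbhs_singleton YY.
rewrite /br XE YE; exact: (congr2 (fun a b => a - b) (E1 (X' x)) (E2 (Y' x))).
Qed.

(** Product rule, followed by an exchange of second derivatives that leaves [h] as the fixed vector;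
    in this form the second order terms of [br_related] can be compared. *)
Lemma diff_diff_apply (V : normedModType R) m n (psi : V -> 'M[R]_(m, n)) (X : V -> V)
    (p h : V) : Csm p psi -> differentiable X p ->
  'd (fun y => 'd psi y (X y)) p h =
  'd (fun y => 'd psi y h) p (X p) + 'd psi p ('d X p h).
Proof.
move=> [U [oU Up] psi_i] Xd.
have [_ gi] := (Cinf_tangent U psi).1 psi_i.
pose g (z : V * V) := 'd psi (z.1) (z.2).
have gd z : U z.1 -> differentiable g z.
  by move=> Uz; exact: (Cinf_differentiable gi Uz).
have idd : differentiable (fun y : V => y) p.
  exact: (Cinf_differentiable (@Cinf_id _ _ setT) I).
have pd : differentiable (fun y => (y, X y)) p by exact: differentiable_pair.
have E1 : 'd (fun y => 'd psi y (X y)) p h =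
    'd g (p, X p) ('d (fun y => (y, X y)) p h).
  exact: (@diff_compE _ _ _ _ (fun y => (y, X y)) g p h pd (gd (p, X p) Up)).
have E2 : 'd (fun y => (y, X y)) p h = (h, 'd X p h).
  apply: etrans (congr1 (fun F => F h) (diff_pair idd Xd)) _.
  exact: (congr1 (fun a => (a, 'd X p h)) (diff_idE p h)).
apply: etrans E1 _; apply: etrans (congr1 ('d g (p, X p)) E2) _.
have E4 : (h, 'd X p h) = (h, 0) + (0, 'd X p h) :> V * V.
  by congr (_, _); rewrite /= ?addr0 ?add0r.
apply: etrans (congr1 ('d g (p, X p)) E4) _.
apply: etrans (linearD ('d g (p, X p)) _ _) _.
apply: congr2; last exact: (diff_tangent_snd _ _ psi_i Up).
have cd : differentiable (fun y => (y, X p)) p.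
  by apply: differentiable_pair => //; exact: differentiable_cst.
have E3 : 'd (fun y => 'd psi y (X p)) p h =
    'd g (p, X p) ('d (fun y => (y, X p)) p h).
  exact: (@diff_compE _ _ _ _ (fun y => (y, X p)) g p h cd (gd (p, X p) Up)).
apply: etrans _ (esym (schwarz h (X p) oU psi_i Up)).
apply: etrans _ (esym E3); apply: (congr1 ('d g (p, X p))).
have cE := congr1 (fun F => F h) (diff_pair idd (differentiable_cst (X p) p)).
apply: etrans _ (esym cE); congr (_, _); first exact: (esym (diff_idE _ _)).
exact: (esym (diff_cstE _ _ _)).
Qed.

(** Each half of the bracket contributes a second derivative of [psi] at the same two vectors, and
    these cancel by symmetry. It serves changes of coordinates, transition maps of charts and the
    projection [prj]. *)
Lemma br_related d e (psi : 'rV[R]_d -> 'rV[R]_e) (p : 'rV[R]_d)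
    (X' Y' : 'rV[R]_d -> 'rV[R]_d) (X Y : 'rV[R]_e -> 'rV[R]_e) :
  Csm p psi -> Csm p X' -> Csm p Y' -> Csm (psi p) X -> Csm (psi p) Y ->
  (\forall y \near p, X (psi y) = 'd psi y (X' y)) ->
  (\forall y \near p, Y (psi y) = 'd psi y (Y' y)) ->
  br X Y (psi p) = 'd psi p (br X' Y' p).
Proof.
move=> ps X's Y's Xs Ys XX YY.
have pd := Csm_differentiable ps.
have H (A' B' : 'rV[R]_d -> 'rV[R]_d) (A B : 'rV[R]_e -> 'rV[R]_e) :
    Csm p A' -> Csm p B' -> Csm (psi p) A -> Csm (psi p) B ->
    (\forall y \near p, A (psi y) = 'd psi y (A' y)) ->
    (\forall y \near p, B (psi y) = 'd psi y (B' y)) ->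
    'd A (psi p) (B (psi p)) =
    'd (fun y => 'd psi y (B' p)) p (A' p) + 'd psi p ('d A' p (B' p)).
  move=> A's B's As Bs AA BB.
  have A'd := Csm_differentiable A's.
  apply: etrans _ (diff_diff_apply (B' p) ps A'd).
  have BE : B (psi p) = 'd psi p (B' p) := nbhs_singleton BB.
  apply: etrans (congr1 ('d A (psi p)) BE) _.
  apply: etrans (esym (diff_compE _ pd (Csm_differentiable As))) _.
  apply: diff_near_eq; first exact: AA.
  by apply: Csm_differentiable; apply: Csm_diff => //; exact: Csm_id.
have [U [oU Up] psi_i] := ps.
have S := schwarz (X' p) (Y' p) oU psi_i Up.
have E1 := H Y' X' Y X Y's X's Ys Xs YY XX.
have E2 := H X' Y' X Y X's Y's Xs Ys XX YY.
apply: etrans (congr2 (fun a b => a - b) E1 E2) _.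
apply: etrans _ (esym (linearB ('d psi p) _ _)).
have Z (a b c e' : 'rV[R]_e) : a = b -> a + c - (b + e') = c - e'.
  by move=> ->; rewrite opprD addrACA subrr add0r.
exact: Z S.
Qed.

End brackets.

(** * Goursat frames *)

Section flag_algebra.
Context {R : realType} (d : nat).
Implicit Types (T : 'M[R]_d) (w : 'rV[R]_d).

(** When [w] is a row of coordinates in a frame, this says that the vector lies in the span of the
    rows 0 to [k], that is in the flag step [k - 1]. *)
Definition inS (k : nat) w := forall l : 'I_d, (k < l)%N -> w 0 l = 0.

(** The shape of a change of frame that respects every flag step from row [j0] on: triangular, with
    one full block on the rows up to [j0]. *)
Definition tri (j0 : nat) T := forall i l : 'I_d, (maxn i j0 < l)%N -> T i l = 0.

Lemma inS_leq k k' w : (k <= k')%N -> inS k w -> inS k' w.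
Proof. by move=> kk wk l kl; apply: wk; exact: leq_ltn_trans kl. Qed.

Lemma inS_mul j0 k T w : tri j0 T -> (j0 <= k)%N -> inS k w -> inS k (w *m T).
Proof.
move=> Tt jk wk l kl; rewrite mxE big1// => i _.
have [ki|ik] := ltnP k i; first by rewrite wk// mul0r.
by rewrite Tt ?mulr0// (leq_ltn_trans _ kl)// geq_max ik.
Qed.

Lemma inS_pid k w : inS k w -> w *m pid_mx k.+1 = w.
Proof.
move=> wk; apply/rowP => l; rewrite mxE (bigD1 l)//= big1 => [|i il].
  rewrite addr0 mxE eqxx/=; have [lk|kl] := leqP l k; first by rewrite ltnS lk mulr1.
  by rewrite wk// mul0r.
by rewrite mxE (negPf (_ : (i : nat) != l)) ?mulr0.
Qed.

Lemma pid_inS k (u : 'rV[R]_d) : inS k (u *m (pid_mx k.+1 : 'M[R]_d)).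
Proof.
move=> l kl; rewrite mxE big1// => i _; rewrite mxE.
case: eqP => [->|_]; last by rewrite mulr0.
by rewrite ltnS leqNgt kl mulr0.
Qed.

(** [T] maps the span of the first k + 1 coordinate vectors injectively into itself, hence onto it
    by rank, so its inverse preserves it too. *)
Lemma inS_invmx j0 k T w : T \in unitmx -> tri j0 T -> (j0 <= k)%N ->
  inS k w -> inS k (w *m invmx T).
Proof.
move=> Tu Tt jk wk; pose A : 'M[R]_d := pid_mx k.+1.
have AT : A *m T *m A = A *m T.
  apply/row_matrixP => i; rewrite !row_mul; apply: inS_pid.
  apply: (inS_mul Tt jk) => l kl; rewrite !mxE.
  by case: eqP => //= il; rewrite il ltnS leqNgt kl.
have sub : (A *m T <= A)%MS by rewrite -AT submxMl.
have /submxP[X XE] : (A <= A *m T)%MS.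
  rewrite -(mxrank_leqif_sup sub) mxrankMfree//.
  by rewrite row_free_unit.
have AinvT : A *m invmx T = X *m A by rewrite {1}XE -!mulmxA mulmxV// mulmx1.
by rewrite -(inS_pid wk) -mulmxA -/A AinvT mulmxA; exact: pid_inS.
Qed.

Lemma tri_invmx j0 T : T \in unitmx -> tri j0 T -> tri j0 (invmx T).
Proof.
move=> Tu Tt i l il.
have -> : invmx T i l = ((delta_mx 0 i : 'rV[R]_d) *m invmx T) 0 l.
  by rewrite -rowE mxE.
apply: (@inS_invmx j0 (maxn i j0)) => //; first exact: leq_maxr.
move=> l' l'i; rewrite mxE eqxx /=; case: eqP => // E.
by move: l'i; rewrite E ltnNge leq_maxl.
Qed.

Lemma invmx_mulmx (A B : 'M[R]_d) : A \in unitmx -> B \in unitmx ->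
  invmx (A *m B) = invmx B *m invmx A.
Proof.
move=> Au Bu; have ABu : A *m B \in unitmx by rewrite unitmx_mul Au.
have E : A *m B *m (invmx B *m invmx A) = 1%:M.
  by rewrite mulmxA -(mulmxA A) mulmxV// mulmx1 mulmxV.
by rewrite -[LHS]mulmx1 -E mulKmx.
Qed.

(** Multiplication by this matrix on the left replaces row [i0] of a frame [F] by [w *m F]. *)
Definition rowset (i0 : 'I_d) w : 'M[R]_d :=
  \matrix_(i, j) if i == i0 then w 0 j else (i == j)%:R.

Lemma rowset_mul n (i0 : 'I_d) w (F : 'M[R]_(d, n)) i :
  row i (rowset i0 w *m F) = if i == i0 then w *m F else row i F.
Proof.
case: eqP => [->|/eqP ii0]; rewrite row_mul; last first.
  rewrite [RHS]rowE; congr (_ *m F); apply/rowP => j.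
  by rewrite !mxE (negPf ii0) eqxx eq_sym.
by congr (_ *m F); apply/rowP => j; rewrite !mxE eqxx.
Qed.

Lemma rowset_unit (i0 : 'I_d) w : w 0 i0 != 0 -> rowset i0 w \in unitmx.
Proof.
move=> w0; rewrite -row_free_unit -kermx_eq0; apply/eqP/row_matrixP => a.
rewrite row0; set u := row a _.
have uT : u *m rowset i0 w = 0 by rewrite -row_mul mulmx_ker row0.
clearbody u; have E j : u 0 i0 * w 0 j + (if j == i0 then 0 else u 0 j) = 0.
  have uTj : (u *m rowset i0 w) 0 j = 0 by rewrite uT mxE.
  apply: etrans _ uTj; rewrite [in RHS]mxE (bigD1 i0)//= mxE eqxx.
  congr (_ + _); case: eqP => [->|/eqP ji].
    by rewrite big1// => i ii; rewrite mxE (negPf ii) mulr0.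
  rewrite (bigD1 j)//= mxE (negPf ji) eqxx mulr1 big1 ?addr0// => i /andP[ii ij].
  by rewrite mxE (negPf ii) (negPf ij) mulr0.
have u0 : u 0 i0 = 0.
  have := E i0; rewrite eqxx addr0 => /eqP.
  by rewrite mulf_eq0 (negPf w0) orbF => /eqP.
apply/rowP => j; rewrite mxE; have := E j; rewrite u0 mul0r add0r.
by case: eqP => [->|].
Qed.

Lemma rowset_tri j0 (i0 : 'I_d) w : inS (maxn i0 j0) w -> tri j0 (rowset i0 w).
Proof.
move=> wS i l il; rewrite mxE; case: eqP => [ii0|_].
  by apply: wS; rewrite -ii0.
by case: eqP => // E; move: il; rewrite E ltnNge leq_maxl.
Qed.

End flag_algebra.

(** * Structure functions of a frame *)

Section frames.
Context {R : realType}.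

Definition fld d (F : 'rV[R]_d -> 'M[R]_d) (i : 'I_d) (x : 'rV[R]_d) := row i (F x).

(** The structure functions of the frame: the coordinates in it of the bracket of its rows [i] and
    [j]. *)
Definition cfb d (F : 'rV[R]_d -> 'M[R]_d) (i j : 'I_d) (x : 'rV[R]_d) : 'rV[R]_d :=
  br (fld F i) (fld F j) x *m invmx (F x).

Lemma Csm_fld d (F : 'rV[R]_d -> 'M[R]_d) i x : Csm x F -> Csm x (fld F i).
Proof. exact: Csm_row. Qed.

Lemma Csm_cfb d (F : 'rV[R]_d -> 'M[R]_d) i j x : Csm x F -> F x \in unitmx ->
  Csm x (cfb F i j).
Proof.
move=> Fs Fu; apply: Csm_mulmx; last exact: Csm_invmx.
by apply: Csm_br; exact: Csm_fld.
Qed.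

Lemma br_comb d (F : 'rV[R]_d -> 'M[R]_d) (u v : 'rV[R]_d -> 'rV[R]_d) x :
  Csm x F -> Csm x u -> Csm x v ->
  br (fun y => u y *m F y) (fun y => v y *m F y) x =
  \sum_i \sum_k (u x 0 i * v x 0 k) *: br (fld F i) (fld F k) x +
  ('d v x (u x *m F x) - 'd u x (v x *m F x)) *m F x.
Proof.
move=> Fs us vs; have Fd := Csm_differentiable Fs.
have D (w : 'rV[R]_d -> 'rV[R]_d) (s h : 'rV[R]_d) : Csm x w -> h = s *m F x ->
    'd (fun y => w y *m F y) x h = 'd w x h *m F x +
    \sum_k \sum_i (w x 0 k * s 0 i) *: 'd (fld F k) x (fld F i x).
  move=> ws hE; apply: etrans (diff_mulmx h (Csm_differentiable ws) Fd) _.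
  congr (_ + _); rewrite [LHS]mulmx_sum_row; apply: eq_bigr => k _.
  have E1 : row k ('d F x h) = 'd (fld F k) x h.
    apply/esym; apply: (@diff_linear_mx_comp _ _ _ _ _ (fun M : 'M[R]_d => row k M)) => //.
    by move=> a A B; rewrite linearP.
  rewrite E1 hE mulmx_sum_row.
  rewrite (linear_sum ('d (fld F k) x)) scaler_sumr; apply: eq_bigr => i _.
  by rewrite (linearZ_LR ('d (fld F k) x)) scalerA.
rewrite /br.
apply: etrans (congr2 (fun a b => a - b) (D v (u x) _ vs erefl) (D u (v x) _ us erefl)) _.
rewrite opprD addrACA mulmxBl [RHS]addrC; congr (_ + _).
rewrite exchange_big -sumrB; apply: eq_bigr => i _.
rewrite -sumrB; apply: eq_bigr => k _.
by rewrite scalerBr [v x 0 k * _]mulrC.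
Qed.

Lemma diff_coord_near0 d m n (f : 'rV[R]_d -> 'M[R]_(m, n)) x h i l : Csm x f ->
  (\forall y \near x, f y i l = 0) -> ('d f x h) i l = 0.
Proof.
move=> fs f0; apply: etrans (esym (diff_coord h i l (Csm_differentiable fs))) _.
have dc : differentiable (fun=> 0 : R) x by exact: differentiable_cst.
by apply: etrans (diff_near_eq h f0 dc) _; exact: diff_cstE.
Qed.

(** In the Leibniz expansion, derivatives of [u] and [v] keep the vanishing coordinates, since these
    vanish on a whole neighbourhood. What remains are the structure functions weighted by the
    coefficients. *)
Lemma inS_br_comb d (F : 'rV[R]_d -> 'M[R]_d) (u v : 'rV[R]_d -> 'rV[R]_d) x k :
  Csm x F -> F x \in unitmx -> Csm x u -> Csm x v ->
  (\forall y \near x, inS k (u y)) -> (\forall y \near x, inS k (v y)) ->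
  (forall a b l : 'I_d, (k < l)%N -> u x 0 a * v x 0 b * cfb F a b x 0 l = 0) ->
  inS k (br (fun y => u y *m F y) (fun y => v y *m F y) x *m invmx (F x)).
Proof.
move=> Fs Fu us vs uk vk H l kl.
rewrite br_comb// mulmxDl mulmxK// mulmx_suml !mxE summxE big1 => [|a _].
  have D (f : 'rV[R]_d -> 'rV[R]_d) (h : 'rV[R]_d) : Csm x f ->
      (\forall y \near x, inS k (f y)) -> ('d f x h) 0 l = 0.
    move=> fs fk; apply: diff_coord_near0 => //.
    by apply: filterS fk => y; apply.
  by rewrite add0r !D// subr0.
rewrite mulmx_suml summxE big1// => b _; rewrite -scalemxAl mxE.
exact: H.
Qed.

Lemma tri_br d j0 (F T : 'rV[R]_d -> 'M[R]_d) x (k k' : nat) :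
  Csm x F -> F x \in unitmx -> Csm x T -> (\forall y \near x, tri j0 (T y)) ->
  (j0 <= k)%N -> (k <= k')%N ->
  (forall a b : 'I_d, (a <= k)%N -> (b <= k)%N -> inS k' (cfb F a b x)) ->
  forall i i' : 'I_d, (i <= k)%N -> (i' <= k)%N ->
    inS k' (br (fld (fun y => T y *m F y) i) (fld (fun y => T y *m F y) i') x
      *m invmx (F x)).
Proof.
move=> Fs Fu Ts Tt jk kk' H i i' ik i'k.
have E a : fld (fun y => T y *m F y) a = (fun y => row a (T y) *m F y).
  by apply/funext => y; rewrite /fld row_mul.
have TS y (a : 'I_d) : tri j0 (T y) -> (a <= k)%N -> inS k (row a (T y)).
  move=> Ty ak l kl; rewrite mxE Ty//.
  by rewrite (leq_ltn_trans _ kl)// geq_max ak.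
rewrite !E; apply: inS_br_comb => //; try exact: Csm_row.
- by apply: filterS Tt => y Ty; apply: inS_leq kk' (TS y i Ty ik).
- by apply: filterS Tt => y Ty; apply: inS_leq kk' (TS y i' Ty i'k).
- move=> a b l kl; have Tx := nbhs_singleton Tt.
  have [ka|ak] := ltnP k a; first by rewrite (TS x i Tx ik)// !mul0r.
  have [kb|bk] := ltnP k b; first by rewrite (TS x i' Tx i'k)// mulr0 mul0r.
  by rewrite (H a b ak bk l kl) mulr0.
Qed.

(* Frame form of the Goursat condition: a bracket of rows reaches at most one row
   beyond max(i, i', j0), and each row past [j0] is reached at [q].  The rows up to
   [j0] = 1 span the distribution; [j0] = 2 forgets the first flag step. *)
Definition LG (j0 d : nat) (F : 'rV[R]_d -> 'M[R]_d) (q : 'rV[R]_d) : Prop :=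
  [/\ Csm q F, F q \in unitmx,
      \forall x \near q, forall i i' : 'I_d,
        inS (maxn (maxn i i') j0).+1 (cfb F i i' x) &
      forall j : nat, (j0 <= j)%N -> (j.+1 < d)%N -> exists i i' l : 'I_d,
        [/\ (i <= j)%N, (i' <= j)%N, l = j.+1 :> nat & cfb F i i' q 0 l != 0]].

Lemma LG_leq (j0 j1 d : nat) (F : 'rV[R]_d -> 'M[R]_d) (q : 'rV[R]_d) :
  (j0 <= j1)%N -> LG j0 F q -> LG j1 F q.
Proof.
move=> jj [Fs Fu FA FB]; split => //.
  apply: filterS FA => x H i i'; apply: inS_leq (H i i').
  by rewrite ltnS geq_max leq_maxl (leq_trans jj)// leq_maxr.
by move=> j jj1; apply: FB; exact: leq_trans jj1.
Qed.

(** The upper bound on brackets is [tri_br]. The reaching condition holds by contradiction: if at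
    [q] the brackets of the new rows up to [j] stayed in their span, so would those of the old rows,
    which the inverse triangular change recovers. *)
Lemma LG_change j0 d (F T : 'rV[R]_d -> 'M[R]_d) q :
  LG j0 F q -> Csm q T -> T q \in unitmx -> (\forall x \near q, tri j0 (T x)) ->
  LG j0 (fun x => T x *m F x) q.
Proof.
move=> [Fs Fu FA FB] Ts Tu Tt.
pose F' x := T x *m F x.
have F's : Csm q F' by exact: Csm_mulmx.
have F'u : F' q \in unitmx by rewrite unitmx_mul Tu Fu.
have A' : \forall x \near q, forall i i' : 'I_d,
    inS (maxn (maxn i i') j0).+1 (cfb F' i i' x).
  have n1 := Csm_open Fs; have n2 := Csm_open Ts.
  have n3 := unitmx_near Fs Fu; have n4 := unitmx_near Ts Tu.
  have n5 := near_nearP Tt.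
  near=> x => i i'.
  have FAx : forall a b : 'I_d, inS (maxn (maxn a b) j0).+1 (cfb F a b x).
    by near: x.
  have Fsx : Csm x F by near: x.
  have Tsx : Csm x T by near: x.
  have Fux : F x \in unitmx by near: x.
  have Tux : T x \in unitmx by near: x.
  have Ttx : \forall y \near x, tri j0 (T y) by near: x.
  set k := maxn (maxn i i') j0.
  have jk : (j0 <= k)%N by exact: leq_maxr.
  rewrite /cfb /F' invmx_mulmx// mulmxA.
  apply: (@inS_invmx _ _ j0) => //; [exact: nbhs_singleton Ttx|exact: leqW|].
  apply: (@tri_br _ j0 F T x k) => //.
  - move=> a b ak bk; apply: inS_leq (FAx a b).
    by rewrite ltnS !geq_max ak bk.
  - by rewrite /k -maxnA leq_maxl.
  - by rewrite /k (maxnC i) -maxnA leq_maxl.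
split => // j jj jd; apply: contrapT => nB.
have [a [b [l [aj bj lE]]]] := FB j jj jd; apply/negP; rewrite negbK; apply/eqP.
have B0 (i i' : 'I_d) : (i <= j)%N -> (i' <= j)%N -> inS j (cfb F' i i' q).
  move=> ij i'j l' jl'; have [jl|] := ltnP j.+1 l'.
    apply: (nbhs_singleton A' i i').
    by apply: leq_ltn_trans jl; rewrite ltnS !geq_max ij i'j.
  move=> l'j; apply: contrapT => ne; apply: nB; exists i, i', l'; split => //.
    by apply/eqP; rewrite eqn_leq l'j.
  exact/eqP.
pose T' x := invmx (T x).
have T's : Csm q T' by exact: Csm_invmx.
have T't : \forall x \near q, tri j0 (T' x).
  have := unitmx_near Ts Tu; apply: filterS2 Tt => x Ttx Tux; exact: tri_invmx.
have H := @tri_br _ j0 F' T' q j j F's F'u T's T't jj (leqnn j) B0 a b aj bj.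
have FE i : {near q, fld F i =1 fld (fun y => T' y *m F' y) i}.
  by apply: filterS (unitmx_near Ts Tu) => x Tux; rewrite /fld /T' /F' mulKmx.
have Ft i : Csm q (fld (fun y => T' y *m F' y) i).
  by apply: Csm_fld; exact: Csm_mulmx.
rewrite -(br_near_eq (FE a) (FE b) (Ft a) (Ft b)) in H.
have Tq := nbhs_singleton Tt.
have := inS_mul Tq jj H.
rewrite /F' invmx_mulmx// -!mulmxA mulVmx// mulmx1; apply.
by rewrite lE.
Unshelve. all: by end_near. Qed.

End frames.

(** * Changes of coordinates and the flow box *)

Section pullback.
Context {R : realType}.

Lemma local_inverse d (f : 'rV[R]_d -> 'rV[R]_d) (p : 'rV[R]_d) :
  Csm p f -> (forall v, 'd f p v = 0 -> v = 0) ->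
  exists g : 'rV[R]_d -> 'rV[R]_d, [/\ Csm (f p) g,
    \forall x \near p, g (f x) = x & \forall z \near f p, f (g z) = z].
Proof.
move=> [U [oU Up] fi] inj.
have [N [g [[oN Np] NU oI gK gi]]] := inverse_function oU fi Up inj.
exists g; split.
- by exists (f @` N) => //; split => //; exists p.
- by apply: filterS (open_nbhs_nbhs (conj oN Np)).
- have Nfp : (f @` N) (f p) by exists p.
  apply: filterS (open_nbhs_nbhs (conj oI Nfp)) => _ [x Nx <-].
  by rewrite gK.
Qed.

Definition jac d e (f : 'rV[R]_d -> 'rV[R]_e) (x : 'rV[R]_d) : 'M[R]_(d, e) :=
  lin1_mx ('d f x).

Lemma jacE d e (f : 'rV[R]_d -> 'rV[R]_e) x v : v *m jac f x = 'd f x v.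
Proof. exact: mul_rV_lin1. Qed.

Lemma Csm_jac (V : normedModType R) d e (f : 'rV[R]_d -> 'rV[R]_e)
    (g : V -> 'rV[R]_d) y : Csm (g y) f -> Csm y g -> Csm y (fun z => jac f (g z)).
Proof.
move=> fs gs; apply: Csm_mxP => i j.
have H : Csm y (fun z => ('d f (g z) (delta_mx 0 i)) 0 j : R).
  by apply: Csm_coord; apply: Csm_diff => //; exact: Csm_cst.
by apply: Csm_near_eq H; apply: nearW => z; rewrite /jac mxE.
Qed.

Lemma diff_inverse d e (f : 'rV[R]_d -> 'rV[R]_e) (g : 'rV[R]_e -> 'rV[R]_d) x v :
  Csm x f -> Csm (f x) g -> (\forall y \near x, g (f y) = y) ->
  'd g (f x) ('d f x v) = v.
Proof.
move=> fs gs gf.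
apply: etrans (esym (diff_compE v (Csm_differentiable fs) (Csm_differentiable gs))) _.
have idd : differentiable (fun y : 'rV[R]_d => y) x.
  exact: Csm_differentiable (Csm_id x).
by apply: etrans (diff_near_eq v gf idd) _; exact: diff_idE.
Qed.

(** The frame read in the coordinates [y], where [psi] is the parametrisation and [phi] its
    inverse. *)
Definition pull d (F : 'rV[R]_d -> 'M[R]_d) (psi phi : 'rV[R]_d -> 'rV[R]_d)
    (y : 'rV[R]_d) : 'M[R]_d := F (psi y) *m jac phi (psi y).

Lemma fld_pull d (F : 'rV[R]_d -> 'M[R]_d) psi phi i y :
  fld (pull F psi phi) i y = 'd phi (psi y) (fld F i (psi y)).
Proof. by rewrite /fld /pull row_mul jacE. Qed.

Section pull.
Variables (d : nat) (psi phi : 'rV[R]_d -> 'rV[R]_d) (p : 'rV[R]_d).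
Hypotheses (psi_s : Csm p psi) (phi_s : Csm (psi p) phi).
Hypothesis phiK : \forall y \near p, phi (psi y) = y.
Hypothesis psiK : \forall z \near psi p, psi (phi z) = z.

Lemma pull_near : \forall y \near p, [/\ Csm y psi, Csm (psi y) phi,
  (forall v, 'd phi (psi y) ('d psi y v) = v),
  (forall v, 'd psi y ('d phi (psi y) v) = v) & jac phi (psi y) \in unitmx].
Proof.
have c := Csm_continuous psi_s.
have n1 := Csm_open psi_s.
have n2 : \forall y \near p, Csm (psi y) phi by exact: (c _ (Csm_open phi_s)).
have n3 := near_nearP phiK.
have n4 : \forall y \near p, \forall z \near psi y, psi (phi z) = z.
  exact: (c _ (near_nearP psiK)).
near=> y.
have ps : Csm y psi by near: y.
have phs : Csm (psi y) phi by near: y.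
have K1 : \forall z \near y, phi (psi z) = z by near: y.
have K2 : \forall z \near psi y, psi (phi z) = z by near: y.
have H1 v : 'd phi (psi y) ('d psi y v) = v by exact: diff_inverse.
have yE : phi (psi y) = y := nbhs_singleton K1.
have H2 v : 'd psi y ('d phi (psi y) v) = v.
  by have := @diff_inverse _ _ phi psi (psi y) v phs; rewrite yE; apply.
split => //.
have E : jac phi (psi y) *m jac psi y = 1%:M.
  by apply/row_matrixP => i; rewrite row_mul jacE row1 rowE jacE H2.
by have [Ju _] := mulmx1_unit E; exact: Ju.
Unshelve. all: by end_near. Qed.

Lemma pull_related (F : 'rV[R]_d -> 'M[R]_d) i :
  \forall y \near p, fld F i (psi y) = 'd psi y (fld (pull F psi phi) i y).
Proof.
by apply: filterS pull_near => y [_ _ _ H _]; rewrite fld_pull H.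
Qed.

Lemma Csm_pull (F : 'rV[R]_d -> 'M[R]_d) : Csm (psi p) F -> Csm p (pull F psi phi).
Proof.
move=> Fs; apply: Csm_mulmx; first exact: Csm_comp psi_s Fs.
exact: Csm_jac.
Qed.

(** Structure functions are scalars attached to the frame, so a change of coordinates only moves
    their argument. *)
Lemma cfb_pull (F : 'rV[R]_d -> 'M[R]_d) : Csm (psi p) F -> F (psi p) \in unitmx ->
  \forall y \near p, forall i i', cfb (pull F psi phi) i i' y = cfb F i i' (psi y).
Proof.
move=> Fs Fu; have c := Csm_continuous psi_s.
have n1 := pull_near.
have n2 : \forall y \near p, Csm (psi y) F by exact: (c _ (Csm_open Fs)).
have n3 : \forall y \near p, F (psi y) \in unitmx by exact: (c _ (unitmx_near Fs Fu)).
have n4 := Csm_open (Csm_pull Fs).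
have n5 : \forall y \near p, forall i, \forall z \near y,
    fld F i (psi z) = 'd psi z (fld (pull F psi phi) i z).
  apply: (@filter_forall 'rV[R]_d 'I_d (fun i y => \forall z \near y,
    fld F i (psi z) = 'd psi z (fld (pull F psi phi) i z)) (nbhs p) (nbhs_filter p)).
  by move=> i; exact: (near_nearP (pull_related F i)).
near=> y => i i'.
have [ps phs H1 H2 Ju] : [/\ Csm y psi, Csm (psi y) phi,
  (forall v, 'd phi (psi y) ('d psi y v) = v),
  (forall v, 'd psi y ('d phi (psi y) v) = v) & jac phi (psi y) \in unitmx].
  by near: y.
have Fys : Csm (psi y) F by near: y.
have Fyu : F (psi y) \in unitmx by near: y.
have pys : Csm y (pull F psi phi) by near: y.
have rel : forall i, \forall z \near y,
    fld F i (psi z) = 'd psi z (fld (pull F psi phi) i z) by near: y.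
have B := br_related ps (Csm_fld i pys) (Csm_fld i' pys) (Csm_fld i Fys)
  (Csm_fld i' Fys) (rel i) (rel i').
have B' : br (fld (pull F psi phi) i) (fld (pull F psi phi) i') y =
    br (fld F i) (fld F i') (psi y) *m jac phi (psi y).
  by rewrite jacE B H1.
by rewrite /cfb B' /pull invmx_mulmx// mulmxA mulmxK.
Unshelve. all: by end_near. Qed.

Lemma LG_pull j0 (F : 'rV[R]_d -> 'M[R]_d) : LG j0 F (psi p) ->
  LG j0 (pull F psi phi) p.
Proof.
move=> [Fs Fu FA FB]; have cE := cfb_pull Fs Fu; split.
- exact: Csm_pull.
- have [_ _ _ _ Ju] := nbhs_singleton pull_near.
  by rewrite /pull unitmx_mul Fu Ju.
- have n : \forall y \near p, forall i i' : 'I_d,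
      inS (maxn (maxn i i') j0).+1 (cfb F i i' (psi y)).
    exact: (Csm_continuous psi_s FA).
  by apply: filterS2 cE n => y E H i i'; rewrite E.
- move=> j jj jd; have [i [i' [l [ij i'j lE ne]]]] := FB j jj jd.
  by exists i, i', l; split => //; rewrite (nbhs_singleton cE).
Qed.

End pull.

(** [psi] follows the flow of [F_0] for the time given by the last coordinate, starting on the
    affine slice through [q] directed by the values at [q] of the other rows. Its differential at 0
    carries the coordinate vectors to the rows of [F q], hence is injective. *)
Lemma flow_box m (F : 'rV[R]_m.+1 -> 'M[R]_m.+1) q : Csm q F -> F q \in unitmx ->
  exists psi phi : 'rV[R]_m.+1 -> 'rV[R]_m.+1,
    [/\ psi 0 = q, Csm 0 psi /\ Csm q phi,
        \forall y \near (0 : 'rV[R]_m.+1), phi (psi y) = y, \forall z \near q, psi (phi z) = z &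
        \forall y \near (0 : 'rV[R]_m.+1), 'd psi y (delta_mx 0 ord_max) = fld F ord0 (psi y)].
Proof.
move=> Fs Fu; have [U [oU Uq] Xi] := Csm_fld ord0 Fs.
have [Phi [Q [oQ Q0 Phi_i PhiX Phi0]]] := flow_exists oU Xi Uq.
pose B : 'M[R]_(m, m.+1) := row' ord0 (F q).
pose s (v : 'rV[R]_m.+1) : R * 'rV[R]_m.+1 :=
  (v 0 ord_max, q + col' ord_max v *m B).
pose s1 (v : 'rV[R]_m.+1) : 'rV[R]_m.+1 := col' ord_max v *m B.
have s1l : linear s1.
  by move=> a u v; rewrite /s1 linearP mulmxDl scalemxAl.
have ss y : Csm y s.
  apply: Csm_pair; first by apply: Csm_coord; exact: Csm_id.
  apply: Csm_add; first exact: Csm_cst.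
  exact: (Csm_linear_mx s1l (Csm_id y)).
have s10 : s1 0 = 0 by rewrite /s1 linear0 mul0mx.
have s0 : s 0 = (0, q) by rewrite /s mxE -/(s1 0) s10 addr0.
have ds y h : 'd s y h = (h 0 ord_max, s1 h).
  have a1 : differentiable (fun v : 'rV[R]_m.+1 => v 0 ord_max : R) y.
    by apply: Csm_differentiable; apply: Csm_coord; exact: Csm_id.
  have b1 : differentiable s1 y.
    by apply: Csm_differentiable; exact: (Csm_linear_mx s1l (Csm_id y)).
  have b0 : differentiable (fun=> q) y by exact: differentiable_cst.
  have b2 : differentiable (fun v => q + s1 v) y by exact: differentiableD.
  apply: etrans (congr1 (fun F => F h) (diff_pair a1 b2)) _.
  congr (_, _).
    by apply: diff_linear_mxE => a u v; rewrite !mxE.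
  apply: etrans (congr1 (fun F => F h) (diffD b0 b1)) _.
  apply: etrans (congr2 +%R (diff_cstE y h q) (diff_linear_mxE y h s1l)) _.
  by rewrite add0r.
pose psi v := Phi (s v).
have Phis z : Q z -> Csm z Phi by move=> Qz; exists Q.
have psis : Csm 0 psi by apply: Csm_comp (ss 0) _; rewrite s0; exact: Phis.
have psi0 : psi 0 = q by rewrite /psi s0 Phi0.
have sQ : \forall y \near (0 : 'rV[R]_m.+1), Q (s y).
  have c := Csm_continuous (ss 0); apply: c; rewrite s0.
  exact: open_nbhs_nbhs.
have dpsi y h : Q (s y) -> 'd psi y h = 'd Phi (s y) (h 0 ord_max, s1 h).
  move=> Qs.
  have P1 := Csm_differentiable (Phis _ Qs).
  apply: etrans (diff_compE h (Csm_differentiable (ss y)) P1) _.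
  by apply: (congr1 ('d Phi (s y))).
have dPhi0 w : 'd Phi (0, q) (0, w) = w.
  pose i (x : 'rV[R]_m.+1) : R * 'rV[R]_m.+1 := (0, x).
  have i_s : Csm q i by apply: Csm_pair; [exact: Csm_cst|exact: Csm_id].
  have cd0 : differentiable (fun=> 0 : R) q by exact: differentiable_cst.
  have idd := Csm_differentiable (Csm_id q).
  have di : 'd i q w = (0, w).
    apply: etrans (congr1 (fun F => F w) (diff_pair cd0 idd)) _.
    by congr (_, _); [exact: diff_cstE|exact: diff_idE].
  have E := diff_compE w (Csm_differentiable i_s)
    (Csm_differentiable (Phis (i q) Q0)).
  apply: etrans (congr1 ('d Phi (0, q)) (esym di)) _.
  apply: etrans (esym E) _; apply: etrans _ (diff_idE q w).
  apply: diff_near_eq => //.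
  have : \forall x \near q, Q (i x).
    by apply: (Csm_continuous i_s); exact: open_nbhs_nbhs.
  by apply: filterS => x Qx; exact: Phi0.
have inj v : 'd psi 0 v = 0 -> v = 0.
  have Qs0 : Q (s 0) by rewrite s0.
  move=> H; have := dpsi 0 v Qs0; rewrite H s0 => {}H.
  have E2 : (v 0 ord_max, s1 v) = v 0 ord_max *: (1, 0) + (0, s1 v)
      :> R * 'rV[R]_m.+1.
    congr (_, _); first by rewrite /= addr0 /GRing.scale /= mulr1.
    by rewrite /= scaler0 add0r.
  have E3 : 'd Phi (0, q) (v 0 ord_max, s1 v) =
      v 0 ord_max *: fld F ord0 q + s1 v.
    apply: etrans (congr1 ('d Phi (0, q)) E2) _.
    apply: etrans (linearD ('d Phi (0, q)) _ _) _.
    apply: congr2; last exact: dPhi0.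
    apply: etrans (linearZ_LR ('d Phi (0, q)) _ _) _.
    by have [_ ->] := PhiX _ Q0; rewrite Phi0.
  (* Moves the last coordinate of [v] to the front, where the frame keeps [F_0]. *)
  pose c : 'rV[R]_m.+1 := \row_i (if unlift ord0 i is Some k
    then v 0 (lift ord_max k) else v 0 ord_max).
  have cF : c *m F q = 0.
    rewrite H E3 mulmx_sum_row big_ord_recl; congr (_ + _).
      by rewrite mxE unlift_none.
    rewrite /s1 mulmx_sum_row; apply: eq_bigr => k _.
    rewrite mxE liftK mxE; congr (_ *: _).
    by apply/rowP => j; rewrite !mxE.
  have c0 : c = 0 by rewrite -[c](mulmxK Fu) cF mul0mx.
  apply/rowP => j; rewrite mxE; case: (unliftP ord_max j) => [k ->|->].
    by have := congr1 (fun M : 'rV[R]_m.+1 => M 0 (lift ord0 k)) c0;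
      rewrite !mxE liftK.
  by have := congr1 (fun M : 'rV[R]_m.+1 => M 0 ord0) c0; rewrite !mxE unlift_none.
have [phi [phis phiK psiK]] := local_inverse psis inj.
rewrite psi0 in phis psiK.
exists psi, phi; split => //.
apply: filterS sQ => y Qs; apply: etrans (dpsi _ _ Qs) _.
apply: etrans _ (PhiX _ Qs).2; apply: (congr1 ('d Phi (s y))).
congr (_, _); first by rewrite mxE !eqxx.
rewrite /s1 (_ : col' ord_max _ = 0) ?mul0mx//.
apply/rowP => k; rewrite !mxE eqxx /=.
by rewrite (negPf (_ : lift ord_max k != ord_max)) // eq_sym neq_lift.
Qed.

End pullback.

(** * Straightening the Cauchy characteristic *)

Section characteristic.
Context {R : realType}.

Lemma near_all (V : normedModType R) (x : V) (P : set V) :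
  (forall y, P y) -> \forall y \near x, P y.
Proof. by move=> xP; apply: filterS (filterT : nbhs x setT) => y _; exact: xP. Qed.

Lemma Csm_rowset (V : normedModType R) d (i0 : 'I_d) (w : V -> 'rV[R]_d) x :
  Csm x w -> Csm x (fun y => rowset i0 (w y)).
Proof.
move=> ws; apply: Csm_mxP => i j.
case: (eqVneq i i0) => [->|ii0].
  apply: Csm_near_eq (Csm_coord 0 j ws); apply: nearW => y.
  by rewrite mxE eqxx.
apply: Csm_near_eq (Csm_cst x ((i == j)%:R : R)); apply: nearW => y.
by rewrite mxE (negPf ii0).
Qed.

Lemma cfbC d (F : 'rV[R]_d -> 'M[R]_d) i j x : cfb F i j x = - cfb F j i x.
Proof. by rewrite /cfb brC mulNmx. Qed.

Lemma cfbXX d (F : 'rV[R]_d -> 'M[R]_d) i x : cfb F i i x = 0.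
Proof. by rewrite /cfb brXX mul0mx. Qed.

(* Row 0 spans the Cauchy characteristic of the rank-three flag step. *)
Definition char_frame m (F : 'rV[R]_m.+1 -> 'M[R]_m.+1) (q : 'rV[R]_m.+1) :=
  \forall x \near q, forall i : 'I_m.+1, (i <= 2)%N -> inS 2 (cfb F ord0 i x).

Definition spans m (F F1 : 'rV[R]_m.+1 -> 'M[R]_m.+1) (q : 'rV[R]_m.+1) k :=
  \forall x \near q, forall i : 'I_m.+1, (i <= k)%N ->
    inS k (fld F i x *m invmx (F1 x)).

Lemma spans_change j0 k m (F T : 'rV[R]_m.+1 -> 'M[R]_m.+1) q : (j0 <= k)%N ->
  Csm q F -> F q \in unitmx ->
  Csm q T -> T q \in unitmx -> (\forall x \near q, tri j0 (T x)) ->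
  spans F (fun x => T x *m F x) q k.
Proof.
move=> jk Fs Fu Ts Tu Tt.
have n1 := unitmx_near Fs Fu; have n2 := unitmx_near Ts Tu.
near=> x => i ik.
have Fx : F x \in unitmx by near: x.
have Tx : T x \in unitmx by near: x.
have tx : tri j0 (T x) by near: x.
rewrite invmx_mulmx// mulmxA /fld -row_mul mulmxV// row1.
apply: (inS_invmx Tx tx jk) => l kl; rewrite mxE eqxx /=.
by case: eqP => // E; move: kl; rewrite E ltnNge ik.
Unshelve. all: by end_near. Qed.

Lemma inS_rowE k m (F G : 'M[R]_m.+1) (w : 'rV[R]_m.+1) : F \in unitmx ->
  inS k (w *m invmx F) ->
  (forall i : 'I_m.+1, (i <= k)%N -> inS k (row i F *m invmx G)) ->
  inS k (w *m invmx G).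
Proof.
move=> Fu wk H l kl; set c := w *m invmx F in wk.
have cF : c *m F = \sum_i c 0 i *: row i F by exact: mulmx_sum_row.
have -> : w *m invmx G = \sum_i c 0 i *: (row i F *m invmx G).
  rewrite -(mulmxKV Fu w) -/c cF mulmx_suml.
  by apply: eq_bigr => i _; rewrite scalemxAl.
rewrite summxE big1// => i _; rewrite mxE.
have [ki|ik] := ltnP k i; first by rewrite wk// mul0r.
by rewrite (H i ik l kl) mulr0.
Qed.

Lemma spans_trans k m (F G H : 'rV[R]_m.+1 -> 'M[R]_m.+1) q :
  Csm q G -> G q \in unitmx -> spans F G q k -> spans G H q k -> spans F H q k.
Proof.
move=> Gs Gu FG GH; have n := unitmx_near Gs Gu.
near=> x => i ik; apply: (@inS_rowE k m (G x)).
- by near: x.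
- by move: i ik; near: x; exact: FG.
- by near: x; exact: GH.
Unshelve. all: by end_near. Qed.

(** Rows 0 and 1 both lie in the full block up to [j0] = 1, so exchanging them is an admissible
    change of frame. *)
Lemma swap_frame m (F : 'rV[R]_m.+1 -> 'M[R]_m.+1) q (i1 : 'I_m.+1) :
  i1 = 1%N :> nat -> LG 1 F q ->
  let P : 'M[R]_m.+1 := perm_mx (tperm ord0 i1) in
  [/\ LG 1 (fun x => P *m F x) q, spans F (fun x => P *m F x) q 1 &
      forall x i j, F x \in unitmx -> cfb (fun x => P *m F x) i j x =
        cfb F (tperm ord0 i1 i) (tperm ord0 i1 j) x *m P].
Proof.
move=> i1E LGF P; have Pu : P \in unitmx by exact: unitmx_perm.
have Pt : tri 1 P.
  move=> i l il; rewrite !mxE; case: tpermP => [i0|ii1|/eqP i0 /eqP ii1].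
  - case: eqP => // E; move: il; rewrite -E i1E.
    by rewrite ltnNge leq_maxr.
  - by case: eqP => // E; move: il; rewrite -E /= ltn0.
  - by case: eqP => // E; move: il; rewrite E ltnNge leq_maxl.
have Ps : Csm q (fun=> P) by exact: Csm_cst.
have Ptn : \forall x \near q, tri 1 P by apply: near_all => _; exact: Pt.
have [Fs Fu _ _] := LGF; split.
- exact: (LG_change LGF Ps Pu Ptn).
- exact: (spans_change (leqnn 1) Fs Fu Ps Pu Ptn).
- move=> x i j Fx; rewrite /cfb invmx_mulmx// mulmxA.
  have PK : invmx P = P.
    by apply: (can_inj (mulKmx Pu)); rewrite mulmxV// /P -perm_mxM tperm2 perm_mx1.
  have fE k : fld (fun y => P *m F y) k = fld F (tperm ord0 i1 k).
    by apply/funext => y; apply/rowP => l; rewrite /fld /P -row_permE !mxE.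
  by rewrite PK !fE.
Qed.

Lemma frame_algebra n (a b c e s t : 'rV[R]_n) (k l p r : R) :
  (k *: a - l *: b) - ((k *: c + p *: s) - (l *: e + r *: t)) =
  k *: (a - c) - l *: (b - e) - (p *: s - r *: t).
Proof. by apply/rowP => i; rewrite !mxE; ring. Qed.

Lemma frame_coefficients n (v a b s t u w : 'rV[R]_n) (k l p r : R) :
  v = k *: a - l *: b - (p *: s - r *: t) -> forall M : 'M[R]_n,
  s *m M = u -> t *m M = w ->
  v *m M = k *: (a *m M) - l *: (b *m M) - (p *: u - r *: w).
Proof. by move=> -> M <- <-; rewrite !mulmxBl -!scalemxAl. Qed.

(** In the bracket of [be F_0 - al F_1] with [F_2] the components along [F_3] cancel, and those
    further on vanish by [LG]. As [be] is nonzero at [q], this combination can take the place of row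
    0. *)
Lemma characteristic_aux m (F : 'rV[R]_m.+1 -> 'M[R]_m.+1) q (i1 i2 i3 : 'I_m.+1) :
  i1 = 1%N :> nat -> i2 = 2%N :> nat -> i3 = 3%N :> nat -> LG 1 F q ->
  cfb F i1 i2 q 0 i3 != 0 ->
  exists F1, [/\ LG 1 F1 q, char_frame F1 q & spans F F1 q 1].
Proof.
move=> i1E i2E i3E LGF b0; have [Fs Fu FA FB] := LGF.
have [al alE] : exists al : 'rV[R]_m.+1 -> R,
    al = fun x => cfb F ord0 i2 x 0 i3 by exact: (ex_intro _ _ erefl).
have [be beE] : exists be : 'rV[R]_m.+1 -> R,
    be = fun x => cfb F i1 i2 x 0 i3 by exact: (ex_intro _ _ erefl).
have als : Csm q al by rewrite alE; apply: Csm_coord; exact: Csm_cfb.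
have bes : Csm q be by rewrite beE; apply: Csm_coord; exact: Csm_cfb.
have beq : be q != 0 by rewrite beE; exact: b0.
clear b0.
pose w x : 'rV[R]_m.+1 := be x *: delta_mx 0 ord0 - al x *: delta_mx 0 i1.
have ws : Csm q w.
  by apply: Csm_sub; apply: Csm_scale => //; exact: Csm_cst.
have wE (b a : R) (l : 'I_m.+1) :
    (b *: delta_mx 0 ord0 - a *: delta_mx 0 i1 : 'rV[R]_m.+1) 0 l =
    b * (l == ord0)%:R - a * (l == i1)%:R by rewrite !mxE.
have w0 x : w x 0 ord0 = be x.
  rewrite /w wE eqxx (_ : (ord0 == i1) = false) ?mulr1 ?mulr0 ?subr0//.
  by rewrite -val_eqE /= i1E.
have wS x : inS 1 (w x).
  move=> l l1; rewrite /w wE (_ : (l == ord0) = false); last first.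
    by rewrite -val_eqE /=; case: (l : nat) l1.
  rewrite (_ : (l == i1) = false) ?mulr0 ?subr0//.
  by rewrite -val_eqE /= i1E gtn_eqF.
pose T x := rowset ord0 (w x).
have Ts : Csm q T by exact: Csm_rowset.
have Tu : T q \in unitmx by apply: rowset_unit; rewrite w0.
have Tt x : tri 1 (T x) by apply: rowset_tri; exact: wS.
have Ttn : \forall x \near q, tri 1 (T x) by apply: near_all => x; exact: Tt.
pose F1 x := T x *m F x.
have LG1 : LG 1 F1 q := LG_change LGF Ts Tu Ttn.
exists F1; split => //; last exact: (spans_change (leqnn 1) Fs Fu Ts Tu Ttn).
have [F1s F1u F1A _] := LG1.
have n1 := Csm_open Fs; have n2 := unitmx_near Fs Fu; have n3 := unitmx_near Ts Tu.
have n4 := Csm_open als; have n5 := Csm_open bes.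
near=> x => i i_le2.
have Fx : Csm x F by near: x.
have Fxu : F x \in unitmx by near: x.
have Txu : T x \in unitmx by near: x.
have alx : Csm x al by near: x.
have bex : Csm x be by near: x.
have FAx : forall i i' : 'I_m.+1, inS (maxn (maxn i i') 1).+1 (cfb F i i' x).
  by near: x.
have F1Ax : forall i i' : 'I_m.+1, inS (maxn (maxn i i') 1).+1 (cfb F1 i i' x).
  by near: x.
(* Brackets with rows 0 and 1 are controlled by the flag; only the one with [F_2] needs the choice
   of [w]. *)
have [i_le1|] := leqP i 1.
  have -> : 2%N = (maxn (maxn (@ord0 m) i) 1).+1; last exact: F1Ax.
  by rewrite /= max0n; congr _.+1; apply/esym/maxn_idPr.
move=> i_gt1; have {}iE : i = i2.
  by apply: val_inj; apply/eqP; rewrite /= i2E eqn_leq i_le2.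
rewrite {i i_le2 i_gt1}iE.
have ne0 : (i2 == ord0) = false by rewrite -val_eqE /= i2E.
have E0 : fld F1 ord0 = (fun y => be y *: fld F ord0 y - al y *: fld F i1 y).
  apply/funext => y; rewrite /fld /F1 rowset_mul eqxx /w mulmxBl -!scalemxAl.
  by rewrite -!rowE.
have E2 : fld F1 i2 = fld F i2.
  by apply/funext => y; rewrite /fld /F1 rowset_mul ne0.
pose X := fld F ord0; pose Y := fld F i1; pose Z := fld F i2.
have Xd := Csm_differentiable (Csm_fld ord0 Fx).
have Yd := Csm_differentiable (Csm_fld i1 Fx).
have ald := Csm_differentiable alx; have bed := Csm_differentiable bex.
pose p : R := 'd be x (Z x); pose r : R := 'd al x (Z x).
have brE : br (fld F1 ord0) (fld F1 i2) x =
    be x *: br X Z x - al x *: br Y Z x - (p *: X x - r *: Y x).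
  rewrite E0 E2 /br.
  have D1 : 'd (fld F i2) x (be x *: X x - al x *: Y x) =
      be x *: 'd Z x (X x) - al x *: 'd Z x (Y x).
    apply: etrans (linearB ('d Z x) _ _) _.
    by apply: (congr2 (fun a b => a - b)); exact: (linearZ_LR ('d Z x)).
  have bX : differentiable (fun y => be y *: fld F ord0 y) x.
    by apply: Csm_differentiable; apply: Csm_scale => //; exact: Csm_fld.
  have aY : differentiable (fun y => al y *: fld F i1 y) x.
    by apply: Csm_differentiable; apply: Csm_scale => //; exact: Csm_fld.
  have D2 : 'd (fun y => be y *: fld F ord0 y - al y *: fld F i1 y) x (Z x) =
      (be x *: 'd X x (Z x) + p *: X x) - (al x *: 'd Y x (Z x) + r *: Y x).
    apply: etrans (congr1 (fun G => G (Z x)) (diffB bX aY)) _.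
    by apply: (congr2 (fun a b => a - b)); exact: diff_scale.
  apply: etrans (congr2 (fun a b => a - b) D1 D2) _.
  exact: frame_algebra.
have XE : X x *m invmx (F x) = delta_mx 0 ord0.
  by rewrite /X /fld -row_mul mulmxV// row1.
have YE : Y x *m invmx (F x) = delta_mx 0 i1.
  by rewrite /Y /fld -row_mul mulmxV// row1.
have vE (A B : 'rV[R]_m.+1) (b a p' r' : R) (l : 'I_m.+1) :
    (b *: A - a *: B - (p' *: delta_mx 0 ord0 - r' *: delta_mx 0 i1)) 0 l =
    b * A 0 l - a * B 0 l - (p' * (l == ord0)%:R - r' * (l == i1)%:R).
  by rewrite !mxE.
have vS : inS 2 (br (fld F1 ord0) (fld F1 i2) x *m invmx (F x)).
  have H : br (fld F1 ord0) (fld F1 i2) x *m invmx (F x) =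
      be x *: cfb F ord0 i2 x - al x *: cfb F i1 i2 x -
      (p *: delta_mx 0 ord0 - r *: delta_mx 0 i1) :> 'rV[R]_m.+1.
    exact: (frame_coefficients brE XE YE).
  move=> l l2.
  have l0 : (l == ord0) = false by rewrite -val_eqE /=; case: (l : nat) l2.
  have l1 : (l == i1) = false by rewrite -val_eqE /= i1E gtn_eqF// (ltn_trans _ l2).
  have G (A B : 'rV[R]_m.+1) (b a p' r' : R) : b * A 0 l - a * B 0 l = 0 ->
      (b *: A - a *: B - (p' *: delta_mx 0 ord0 - r' *: delta_mx 0 i1)) 0 l = 0.
    by move=> E; rewrite vE l0 l1 !mulr0 subrr subr0.
  have K : be x * cfb F ord0 i2 x 0 l - al x * cfb F i1 i2 x 0 l = 0.
    have MC (a b : R) : b * a - a * b = 0 by rewrite mulrC subrr.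
    have [l3|l_3] := eqVneq l i3; first by rewrite l3 alE beE; exact: MC.
    have l3 : (3 < l)%N.
      by rewrite ltn_neqAle l2 andbT -i3E eq_sym val_eqE.
    have B1 : ((maxn (maxn (@ord0 m) i2) 1).+1 < l)%N by rewrite i2E.
    have B2 : ((maxn (maxn i1 i2) 1).+1 < l)%N by rewrite i1E i2E.
    have MZ (a b A B : R) : A = 0 -> B = 0 -> b * A - a * B = 0.
      by move=> -> ->; rewrite !mulr0 subrr.
    exact: MZ (FAx ord0 i2 l B1) (FAx i1 i2 l B2).
  exact: etrans (congr1 (fun u : 'rV[R]_m.+1 => u 0 l) H) (G _ _ _ _ p r K).
rewrite /cfb /F1 invmx_mulmx// mulmxA.
exact: (inS_invmx Txu (Tt x) _ vS).
Unshelve. all: by end_near. Qed.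

(** At [q] one of [[F_0, F_2]] and [[F_1, F_2]] has a component along [F_3], for otherwise no
    bracket would reach that row; exchanging rows 0 and 1 if necessary, it is the second. *)
Lemma characteristic_frame m (F : 'rV[R]_m.+1 -> 'M[R]_m.+1) q : (2 <= m)%N ->
  LG 1 F q -> exists F1, [/\ LG 1 F1 q, char_frame F1 q & spans F F1 q 1].
Proof.
move=> m2 LGF; have [Fs Fu FA FB] := LGF.
(* In dimension three the rank-three step is the whole tangent space, and [F_0] is kept as it is. *)
have [m3|] := ltnP 2 m; last first.
  move=> m_le2; exists F; split => //.
    apply: near_all => x i _ l l2; exfalso.
    have := ltn_ord l; rewrite ltnNge => /negP; apply.
    by rewrite (leq_trans _ l2).
  have := unitmx_near Fs Fu; apply: filterS => x Fx i i1 l l1.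
  rewrite /fld -row_mul mulmxV// row1 mxE eqxx /=; case: eqP => // E.
  by move: l1; rewrite E ltnNge i1.
pose i1 : 'I_m.+1 := inord 1; pose i2 : 'I_m.+1 := inord 2.
pose i3 : 'I_m.+1 := inord 3.
have i1E : i1 = 1%N :> nat by rewrite inordK// ltnS (leq_trans _ m2).
have i2E : i2 = 2%N :> nat by rewrite inordK// ltnS.
have i3E : i3 = 3%N :> nat by rewrite inordK// ltnS.
have [b0|b0] := eqVneq (cfb F i1 i2 q 0 i3) 0; last first.
  exact: (characteristic_aux i1E i2E i3E LGF).
have a0 : cfb F ord0 i2 q 0 i3 != 0.
  apply/eqP => a0.
  have [i [i' [l [i_le i'_le lE]]]] := FB 2 isT m3; apply/negP; rewrite negbK.
  have -> : l = i3 by apply: val_inj; rewrite /= lE i3E.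
  have c01 : cfb F ord0 i1 q 0 i3 = 0.
    apply: (nbhs_singleton FA ord0 i1).
    by rewrite i3E i1E /= max0n.
  have C a b : cfb F a b q 0 i3 = 0 -> cfb F b a q 0 i3 = 0.
    by move=> H; rewrite cfbC mxE H oppr0.
  have I3 (a : 'I_m.+1) : (a <= 2)%N -> [\/ a = ord0, a = i1 | a = i2].
    case: a => [[|[|[|//]]] p] _; [apply: Or31|apply: Or32|apply: Or33];
      by apply: val_inj; rewrite /= ?i1E ?i2E.
  apply/eqP; have XX a : cfb F a a q 0 i3 = 0 by rewrite cfbXX mxE.
  case: (I3 i i_le) => ->; case: (I3 i' i'_le) => ->.
  - exact: XX.
  - exact: c01.
  - exact: a0.
  - exact: (C _ _ c01).
  - exact: XX.
  - exact: b0.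
  - exact: (C _ _ a0).
  - exact: (C _ _ b0).
  - exact: XX.
have [LGP PS PE] := swap_frame i1E LGF.
have b0' : cfb (fun x => perm_mx (tperm ord0 i1) *m F x) i1 i2 q 0 i3 != 0.
  have n20 : ord0 != i2 by rewrite -val_eqE /= i2E.
  have n21 : i1 != i2 by rewrite -val_eqE /= i1E i2E.
  have n30 : ord0 != i3 by rewrite -val_eqE /= i3E.
  have n31 : i1 != i3 by rewrite -val_eqE /= i1E i3E.
  have PP (u : 'rV[R]_m.+1) : (u *m perm_mx (tperm ord0 i1)) 0 i3 = u 0 i3.
    by rewrite -{1}tpermV -col_permE mxE tpermD.
  by rewrite PE// PP tpermR tpermD.
have [F1 [LG1 Ch1 S1]] := characteristic_aux i1E i2E i3E LGP b0'.
exists F1; split => //; apply: spans_trans PS S1.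
- by case: LGP.
- by case: LGP.
Qed.

End characteristic.

(** * Frames independent of the last coordinate *)

Section normalisation.
Context {R : realType}.

Definition ydir (m : nat) : 'rV[R]_m.+1 := delta_mx 0 ord_max.

Definition straight m (H : 'rV[R]_m.+1 -> 'M[R]_m.+1) (k : nat) :=
  (\forall x \near (0 : 'rV[R]_m.+1), fld H ord0 x = ydir m) /\
  \forall x \near (0 : 'rV[R]_m.+1), forall i : 'I_m.+1, (i <= k)%N ->
    'd (fld H i) x (ydir m) = 0.

Lemma inS_delta d (i : 'I_d) k : (i <= k)%N -> inS k (delta_mx 0 i : 'rV[R]_d).
Proof.
move=> ik l kl; rewrite mxE eqxx /=; case: eqP => // E.
by move: kl; rewrite E ltnNge ik.
Qed.

(** Once the second derivative is exchanged, differentiating the bracket along [e] only produces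
    derivatives of [X] and [Y] along [e]. *)
Lemma br_straight d (X Y : 'rV[R]_d -> 'rV[R]_d) (x e : 'rV[R]_d) : Csm x X -> Csm x Y ->
  (\forall y \near x, 'd X y e = 0) -> (\forall y \near x, 'd Y y e = 0) ->
  'd (br X Y) x e = 0.
Proof.
move=> Xs Ys X0 Y0.
have D (A B : 'rV[R]_d -> 'rV[R]_d) : Csm x A -> Csm x B ->
    (\forall y \near x, 'd A y e = 0) -> (\forall y \near x, 'd B y e = 0) ->
    'd (fun y => 'd B y (A y)) x e = 0.
  move=> As Bs A0 B0.
  apply: etrans (diff_diff_apply e Bs (Csm_differentiable As)) _.
  have E1 : 'd (fun y => 'd B y e) x (A x) = 0.
    apply: etrans (diff_near_eq (A x) B0 (differentiable_cst 0 x)) _.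
    exact: diff_cstE.
  have E2 : 'd B x ('d A x e) = 0.
    apply: etrans (congr1 ('d B x) (nbhs_singleton A0)) _.
    exact: (linear0 ('d B x)).
  by apply: etrans (congr2 (fun a b => a + b) E1 E2) _; rewrite addr0.
have Dd (A B : 'rV[R]_d -> 'rV[R]_d) : Csm x A -> Csm x B ->
    differentiable (fun y => 'd B y (A y)) x.
  by move=> As Bs; apply: Csm_differentiable; apply: Csm_diff => //; exact: Csm_id.
apply: etrans (congr1 (fun G => G e) (diffB (Dd X Y Xs Ys) (Dd Y X Ys Xs))) _.
apply: etrans (congr2 (fun a b => a - b) (D X Y Xs Ys X0 Y0) (D Y X Ys Xs Y0 X0)) _.
exact: subrr.
Qed.

(** [K] is the block of [X] cut out by the projection [P], completed by the identity; its inverse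
    turns that block of [X] into the identity. *)
Lemma normal_block m (K X P : 'M[R]_m.+1) :
  P *m P = P -> K = P *m X *m P + (1%:M - P) -> K \in unitmx ->
  P *m (invmx K *m X) *m P = P.
Proof.
move=> PP KE Ku.
have PK : P *m K = P *m X *m P.
  by rewrite KE mulmxDr !mulmxA PP mulmxBr mulmx1 PP subrr addr0.
have KP : K *m P = P *m X *m P.
  by rewrite KE mulmxDl -!mulmxA PP mulmxBl mul1mx PP subrr addr0.
have TP : invmx K *m P = P *m invmx K.
  by rewrite -[LHS](mulmxK Ku) -[_ *m P *m K]mulmxA PK -KP mulmxA mulVmx// mul1mx.
by rewrite mulmxA -TP -!mulmxA [P *m (X *m P)]mulmxA -KP mulmxA mulVmx// mul1mx.
Qed.

Lemma normal_kernel m (K X P : 'M[R]_m.+1) (c : 'rV[R]_m.+1) :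
  K = P *m X *m P + (1%:M - P) -> K \in unitmx ->
  c *m P = c -> c *m X *m P = 0 -> c = 0.
Proof.
move=> KE Ku cP cX; rewrite -[c](mulmxK Ku) KE.
by rewrite mulmxDr mulmxBr mulmx1 !mulmxA cP subrr addr0 cX mul0mx.
Qed.

Lemma normal_row m (K X P : 'M[R]_m.+1) (c : 'rV[R]_m.+1) :
  K = P *m X *m P + (1%:M - P) -> K \in unitmx ->
  c *m P = c -> c *m X = c -> c *m invmx K = c.
Proof.
move=> KE Ku cP cX; have cK : c *m K = c.
  by rewrite KE mulmxDr mulmxBr mulmx1 !mulmxA cP cX cP subrr addr0.
by rewrite -{1}cK mulmxK.
Qed.

(** The flow of a Cauchy characteristic preserves the rank-three step, so along the last coordinate
    this step is a constant subspace, and a basis of it normalised against the fixed basis [F 0] is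
    constant. Infinitesimally: the derivative [w] of a normalised row stays in the span of rows 0 to
    2, while its first three coordinates relative to [F 0] vanish; hence [w] is zero. *)
Lemma normalise m (F : 'rV[R]_m.+1 -> 'M[R]_m.+1) : (2 <= m)%N ->
  LG 1 F 0 -> char_frame F 0 ->
  (\forall x \near (0 : 'rV[R]_m.+1), fld F ord0 x = ydir m) ->
  exists G, [/\ LG 2 G 0, straight G 2 & spans F G 0 2].
Proof.
move=> m2 LGF chF F0e; have [Fs Fu FA FB] := LGF.
pose A := invmx (F 0); pose X x := F x *m A.
pose P : 'M[R]_m.+1 := pid_mx 3.
have PP : P *m P = P by exact: pid_mx_id.
(* [X] is the frame in the basis [F 0]; [K] retains its upper left block of size three. *)
pose K x := P *m X x *m P + (1%:M - P).
have Xs : Csm 0 X by apply: Csm_mulmx => //; exact: Csm_cst.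
have Ks : Csm 0 K.
  apply: Csm_add; last exact: Csm_cst.
  by do 2![apply: Csm_mulmx => //; try exact: Csm_cst].
have K0 : K 0 = 1%:M by rewrite /K /X mulmxV// mulmx1 PP addrCA subrr addr0.
have Ku : K 0 \in unitmx by rewrite K0 unitmx1.
have Kt x : tri 2 (K x).
  move=> i l il; have l2 : (2 < l)%N by apply: leq_ltn_trans il; exact: leq_maxr.
  have li : (i < l)%N by apply: leq_ltn_trans il; exact: leq_maxl.
  rewrite mxE.
  have -> : (P *m X x *m P) i l = 0.
    have := @pid_inS R m.+1 2 (row i (P *m X x)) l l2.
    by rewrite -row_mul mxE.
  rewrite !mxE add0r; case: eqP => [E|NE]; first by move: li; rewrite E ltnn.
  by rewrite (negPf (_ : (i : nat) != l)) ?subrr// neq_ltn li.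
pose T x := invmx (K x).
have Ts : Csm 0 T by exact: Csm_invmx.
have Tu : T 0 \in unitmx by rewrite unitmx_inv.
have nK := unitmx_near Ks Ku.
have Tt : \forall x \near (0 : 'rV[R]_m.+1), tri 2 (T x).
  by apply: filterS nK => x Kx; apply: tri_invmx => //; exact: Kt.
pose G x := T x *m F x.
(* The inverted block mixes rows 1 and 2, so the condition survives only from [j0] = 2 on. *)
have LGG : LG 2 G 0 by exact: (LG_change (LG_leq (leqnSn 1) LGF) Ts Tu Tt).
exists G; split => //; last exact: (spans_change (leqnn 2) Fs Fu Ts Tu Tt).
have Gs : Csm 0 G by case: LGG.
have P2 (i : 'I_m.+1) : (i <= 2)%N -> (delta_mx 0 i : 'rV[R]_m.+1) *m P = delta_mx 0 i.
  by move=> i2; apply: inS_pid; exact: inS_delta.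
split.
  apply: filterS2 (F0e) (nK) => x F0x Kx.
  rewrite /fld /G row_mul rowE (@normal_row _ (K x) (X x) P)//.
  - by rewrite -rowE.
  - exact: P2.
  - rewrite /X mulmxA -rowE [row _ _]F0x -(nbhs_singleton F0e) /fld -row_mul.
    by rewrite mulmxV// row1.
have n1 := Csm_open Fs; have n2 := unitmx_near Fs Fu; have n3 := Csm_open Ts.
have n4 := near_nearP F0e; have n5 := near_nearP Tt; have n6 := near_nearP nK.
have n7 := Csm_open Gs.
near=> x => i i2.
have Fx : Csm x F by near: x.
have Fxu : F x \in unitmx by near: x.
have Tx : Csm x T by near: x.
have Gx : Csm x G by near: x.
have F0x : \forall y \near x, fld F ord0 y = ydir m by near: x.
have Ttx : \forall y \near x, tri 2 (T y) by near: x.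
have nKx : \forall y \near x, K y \in unitmx by near: x.
have chx : forall i : 'I_m.+1, (i <= 2)%N -> inS 2 (cfb F ord0 i x) by near: x.
have [w wE] : exists w, w = 'd (fld G i) x (ydir m) by exact: (ex_intro _ _ erefl).
apply: etrans (esym wE) _.
(* The first three coordinates of the normalised row relative to [F 0] are those of a fixed basis
   vector. *)
have wAP : w *m A *m P = 0.
  have H : 'd (fun y => fld G i y *m A *m P) x (ydir m) = w *m A *m P.
    rewrite wE; apply: (@diff_linear_mx_comp R _ _ 1 m.+1
      (fun u : 'rV[R]_m.+1 => u *m A *m P) (fld G i)).
      by move=> a u v; rewrite !mulmxDl !scalemxAl.
    exact: Csm_differentiable (Csm_fld i Gx).
  apply: etrans (esym H) _.
  apply: etrans (_ : _ = 'd (fun=> delta_mx 0 i : 'rV[R]_m.+1) x (ydir m)) (diff_cstE _ _ _).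
  apply: diff_near_eq; last exact: differentiable_cst.
  apply: filterS nKx => y Ky.
  rewrite /fld /G rowE -(P2 i i2) -[in RHS](@normal_block _ (K y) (X y) P)//.
  by rewrite !mulmxA (P2 i i2) /T /X ?mulmxA.
have GE : fld G i = (fun y => row i (T y) *m F y).
  by apply/funext => y; rewrite /fld row_mul.
have F0E : fld F ord0 = (fun y => (delta_mx 0 ord0 : 'rV[R]_m.+1) *m F y).
  by apply/funext => y; rewrite /fld rowE.
have TS y : tri 2 (T y) -> inS 2 (row i (T y)).
  by move=> Ty l l2; rewrite mxE; apply: Ty; rewrite (maxn_idPr i2).
(* The bracket with [F_0] is the derivative along the last coordinate; [char_frame] keeps it in the
   rank-three step. *)
have cS : inS 2 (br (fld F ord0) (fld G i) x *m invmx (F x)).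
  rewrite GE F0E; apply: inS_br_comb => //.
  - exact: Csm_cst.
  - exact: Csm_row.
  - by apply: near_all => y; exact: inS_delta.
  - by apply: filterS Ttx => y; exact: TS.
  - move=> a b l l2; have [b2|b2] := leqP b 2; last first.
      by rewrite (TS x (nbhs_singleton Ttx) b b2) mulr0 mul0r.
    rewrite [delta_mx _ _ _ _]mxE eqxx /=; case: eqP => [->|_]; last by rewrite !mul0r.
    by rewrite (chx b b2 l l2) mulr0.
have brE : br (fld F ord0) (fld G i) x = w.
  have E1 : 'd (fld G i) x (fld F ord0 x) = w.
    by apply: etrans (congr1 ('d (fld G i) x) (nbhs_singleton F0x)) _.
  have E2 : 'd (fld F ord0) x (fld G i x) = 0.
    apply: etrans (diff_near_eq _ F0x (differentiable_cst _ x)) _.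
    exact: diff_cstE.
  by apply: etrans (congr2 (fun a b => a - b) E1 E2) _; rewrite subr0.
rewrite brE in cS; clear brE wE GE.
have c0 : w *m invmx (F x) = 0.
  apply: (@normal_kernel _ (K x) (X x) P) => //.
  - exact: nbhs_singleton nKx.
  - exact: inS_pid.
  - by rewrite /X mulmxA mulmxKV.
by rewrite -(mulmxKV Fxu w) c0 mul0mx.
Unshelve. all: by end_near. Qed.

(** Each row past the third can be replaced by a bracket of earlier rows that reaches it. Brackets
    of fields independent of the last coordinate are independent of it too. *)
Lemma straighten m (F : 'rV[R]_m.+1 -> 'M[R]_m.+1) : (2 <= m)%N ->
  LG 1 F 0 -> char_frame F 0 ->
  (\forall x \near (0 : 'rV[R]_m.+1), fld F ord0 x = ydir m) ->
  exists G, [/\ LG 2 G 0, straight G m & spans F G 0 2].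
Proof.
move=> m2 LGF chF F0e.
suff H k : (k.+2 <= m)%N -> exists G, [/\ LG 2 G 0, straight G k.+2 & spans F G 0 2].
  by case: m m2 F LGF chF F0e H => [|[|m]]// m2 F LGF chF F0e H; exact: (H m).
elim: k => [_|k IH km]; first exact: normalise.
have [G [LGG [G0 GD] FG]] := IH (ltnW km); have [Gs Gu GA GB] := LGG.
have [a [b [l [ak bk lE ne]]]] := GB k.+2 isT km.
pose w := cfb G a b.
have ws : Csm 0 w by exact: Csm_cfb.
pose T x := rowset l (w x).
have Ts : Csm 0 T by exact: Csm_rowset.
have Tu : T 0 \in unitmx by exact: rowset_unit.
have Tt : \forall x \near (0 : 'rV[R]_m.+1), tri 2 (T x).
  apply: filterS GA => x /(_ a b) H; apply: rowset_tri.
  apply: inS_leq H; rewrite lE; apply: leq_trans (leq_maxl _ _).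
  by rewrite !ltnS !geq_max ak bk.
exists (fun x => T x *m G x); split.
- exact: (LG_change LGG Ts Tu Tt).
- have E i : i != l -> fld (fun x => T x *m G x) i = fld G i.
    by move=> il; apply/funext => x; rewrite /fld rowset_mul (negPf il).
  split.
    rewrite E//; apply/eqP => E0; move: lE; rewrite -E0 //.
  have n1 := Csm_open Gs; have n2 := unitmx_near Gs Gu.
  have n3 := near_nearP GD; have n4 := near_nearP n2.
  near=> x => i ik.
  have Gx : Csm x G by near: x.
  have GDx : \forall y \near x, forall i : 'I_m.+1, (i <= k.+2)%N ->
    'd (fld G i) y (ydir m) = 0 by near: x.
  have Gux : \forall y \near x, G y \in unitmx by near: x.
  have [il|il] := eqVneq i l; last first.
    rewrite (E _ il); apply: (nbhs_singleton GDx).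
    move: ik; rewrite leq_eqVlt ltnS => /orP[/eqP ik|//].
    by case/eqP: il; apply: val_inj; rewrite /= ik lE.
  rewrite il.
  have ll : {near x, fld (fun x => T x *m G x) l =1 br (fld G a) (fld G b)}.
    apply: filterS Gux => y Gy; rewrite /fld rowset_mul eqxx /w /cfb.
    by rewrite mulmxKV.
  have ga := Csm_fld a Gx; have gb := Csm_fld b Gx.
  apply: etrans (diff_near_eq _ ll (Csm_differentiable (Csm_br ga gb))) _.
  by apply: br_straight => //; apply: filterS GDx => y; apply.
- apply: spans_trans FG _ => //.
  exact: (spans_change (leqnn 2) Gs Gu Ts Tu Tt).
Unshelve. all: by end_near. Qed.

End normalisation.

(** * Projection along the last coordinate *)

Section projection.
Context {R : realType}.
Variable m : nat.

Definition prj (x : 'rV[R]_m.+1) : 'rV[R]_m := col' ord_max x.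

Definition inj (x : 'rV[R]_m) : 'rV[R]_m.+1 :=
  \row_j (if unlift ord_max j is Some k then x 0 k else 0).

Lemma prj_linear : linear prj.
Proof. by move=> a u v; apply/rowP => i; rewrite !mxE. Qed.

Lemma inj_linear : linear inj.
Proof.
by move=> a u v; apply/rowP => i; rewrite !mxE; case: unliftP => [k _|_];
  rewrite ?mxE ?mulr0 ?addr0.
Qed.

Lemma prjK x : prj (inj x) = x.
Proof. by apply/rowP => i; rewrite !mxE liftK. Qed.

Lemma injK x : inj (prj x) = x - x 0 ord_max *: ydir m.
Proof.
apply/rowP => j; rewrite !mxE; case: (unliftP ord_max j) => [k ->|->].
  rewrite mxE eqxx (negPf (_ : lift ord_max k != ord_max)) ?mulr0 ?subr0//.
  by rewrite eq_sym neq_lift.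
by rewrite !eqxx mulr1 subrr.
Qed.

Lemma prj_ydir : prj (ydir m) = 0.
Proof.
apply/rowP => k; rewrite !mxE eqxx /=.
by rewrite (negPf (_ : lift ord_max k != ord_max)) // eq_sym neq_lift.
Qed.

Lemma inj_prj_add x : x = inj (prj x) + x 0 ord_max *: ydir m.
Proof. by rewrite injK subrK. Qed.

Lemma prj0 : prj 0 = 0. Proof. by apply/rowP => i; rewrite !mxE. Qed.

Lemma inj0 : inj 0 = 0.
Proof. by apply/rowP => i; rewrite !mxE; case: unlift => [k|]; rewrite ?mxE. Qed.

Lemma Csm_prj (V : normedModType R) (f : V -> 'rV[R]_m.+1) x :
  Csm x f -> Csm x (fun y => prj (f y)).
Proof. exact: Csm_linear_mx prj_linear. Qed.

Lemma Csm_inj (V : normedModType R) (f : V -> 'rV[R]_m) x :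
  Csm x f -> Csm x (fun y => inj (f y)).
Proof. exact: Csm_linear_mx inj_linear. Qed.

Lemma prj_near (P : set 'rV[R]_m) : (\forall z \near (0 : 'rV[R]_m), P z) ->
  \forall x \near (0 : 'rV[R]_m.+1), P (prj x).
Proof.
move=> H; have c := Csm_continuous (Csm_prj (Csm_id (0 : 'rV[R]_m.+1))).
by apply: c; rewrite prj0.
Qed.

Lemma inj_near (P : set 'rV[R]_m.+1) : (\forall z \near (0 : 'rV[R]_m.+1), P z) ->
  \forall x \near (0 : 'rV[R]_m), P (inj x).
Proof.
move=> H; have c := Csm_continuous (Csm_inj (Csm_id (0 : 'rV[R]_m))).
by apply: c; rewrite inj0.
Qed.

(** Mean value inequality with bound 0 along the segment that brings the last coordinate to 0. For
    [x] in the ball of half the radius this segment stays in the neighbourhood. *)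
Lemma straight_constant n (f : 'rV[R]_m.+1 -> 'rV[R]_n) : Csm 0 f ->
  (\forall x \near (0 : 'rV[R]_m.+1), 'd f x (ydir m) = 0) ->
  \forall x \near (0 : 'rV[R]_m.+1), f x = f (inj (prj x)).
Proof.
move=> fs f0.
have n1 := Csm_open fs.
have : \forall x \near (0 : 'rV[R]_m.+1), Csm x f /\ 'd f x (ydir m) = 0.
  by apply: filterS2 (n1) (f0) => x.
move=> /nbhs_normP[e /= e0 He].
have y1 : `|ydir m : 'rV[R]_m.+1| <= 1.
  apply: mx_norm_leP => // i j; rewrite mxE.
  by case: (_ && _); rewrite ?normr1 ?normr0.
apply/nbhs_normP; exists (e / 2); first by rewrite /= divr_gt0.
move=> x /=; rewrite sub0r normrN => xe.
rewrite injK.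
have seg (t : R) : 0 <= t <= 1 ->
    Csm (x + t *: (- (x 0 ord_max *: ydir m))) f /\
    'd f (x + t *: (- (x 0 ord_max *: ydir m))) (ydir m) = 0.
  move=> /andP[t0 t1]; apply: He; rewrite /= sub0r normrN.
  apply: le_lt_trans (ler_normD _ _) _.
  have h : `|t *: (- (x 0 ord_max *: ydir m)) : 'rV[R]_m.+1| <= `|x|.
    rewrite normrZ normrN normrZ (ger0_norm t0) -[leRHS]mul1r ler_pM//.
    by rewrite -[leRHS]mulr1 ler_pM// mx_coord_norm_le.
  by rewrite [e]splitr ltrD// (le_lt_trans h).
have M := @mean_value_norm R _ n f x (- (x 0 ord_max *: ydir m)) 0.
apply/eqP; rewrite eq_sym -subr_eq0 -normr_le0; apply: M => t t01.
  by have [s _] := seg t t01; exact: Csm_differentiable.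
have [_ d0] := seg t t01.
have L := linearZ_LR ('d f (x + t *: (- (x 0 ord_max *: ydir m)))).
have E : 'd f (x + t *: (- (x 0 ord_max *: ydir m))) (- (x 0 ord_max *: ydir m)) = 0.
  apply: etrans (linearN ('d f _) _) _.
  apply: etrans (congr1 (fun u => - u) (L _ _)) _.
  apply: etrans (congr1 (fun u => - (x 0 ord_max *: u)) d0) _.
  by rewrite scaler0 oppr0.
by rewrite E normr0.
Qed.

(** Row 0 projects to zero and is dropped with the last coordinate; the other rows are read on the
    slice where that coordinate is 0. *)
Definition prjM (H : 'rV[R]_m.+1 -> 'M[R]_m.+1) (x : 'rV[R]_m) : 'M[R]_m :=
  row' ord0 (col' ord_max (H (inj x))).

Lemma row'_linear p q i : linear (@row' R p q i).
Proof. by move=> a A B; apply/matrixP => k l; rewrite !mxE. Qed.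

Lemma col'_linear p q i : linear (@col' R p q i).
Proof. by move=> a A B; apply/matrixP => k l; rewrite !mxE. Qed.

Lemma unit_minor (A : 'M[R]_m.+1) : row ord0 A = ydir m -> A \in unitmx ->
  row' ord0 (col' ord_max A) \in unitmx.
Proof.
move=> A0; rewrite !unitmxE (expand_det_row A ord0) (bigD1 ord_max)//= big1.
  have -> : A ord0 ord_max = 1.
    have := congr1 (fun u : 'rV[R]_m.+1 => u 0 ord_max) A0.
    by rewrite !mxE !eqxx.
  rewrite mul1r addr0 /cofactor unitrM => /andP[_].
  by rewrite (_ : row' _ _ = col' ord_max (row' ord0 A))//; apply/matrixP => i j; rewrite !mxE.
move=> j jm; have := congr1 (fun u : 'rV[R]_m.+1 => u 0 j) A0.
by rewrite !mxE (negPf jm) andbF => ->; rewrite mul0r.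
Qed.

(** The projection kills row 0 exactly, so the coordinates in the projected frame are the old ones
    without the first. *)
Lemma prj_coef (A : 'M[R]_m.+1) (w : 'rV[R]_m.+1) : row ord0 A = ydir m ->
  A \in unitmx ->
  prj w *m invmx (row' ord0 (col' ord_max A)) = col' ord0 (w *m invmx A).
Proof.
move=> A0 Au; have Bu := unit_minor A0 Au; set B := row' ord0 _ in Bu *.
apply: (canLR (mulmxK Bu)).
rewrite -{1}(mulmxKV Au w); set c := w *m invmx A.
apply/rowP => j; rewrite !mxE big_ord_recl.
have -> : A ord0 (lift ord_max j) = 0.
  have := congr1 (fun u : 'rV[R]_m.+1 => u 0 (lift ord_max j)) A0.
  rewrite !mxE eqxx (negPf (_ : lift ord_max j != ord_max)) ?andbF//.
  by rewrite eq_sym neq_lift.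
by rewrite mulr0 add0r; apply: eq_bigr => k _; rewrite !mxE.
Qed.

Lemma straight_inj (H : 'rV[R]_m.+1 -> 'M[R]_m.+1) : Csm 0 H -> straight H m ->
  \forall x \near (0 : 'rV[R]_m.+1), H x = H (inj (prj x)).
Proof.
move=> Hs [_ HD].
have : \forall x \near (0 : 'rV[R]_m.+1), forall i, fld H i x = fld H i (inj (prj x)).
    apply: (@filter_forall 'rV[R]_m.+1 'I_m.+1 (fun i x =>
      fld H i x = fld H i (inj (prj x))) (nbhs (0 : 'rV[R]_m.+1)) (nbhs_filter _)) => i.
    apply: straight_constant; first exact: Csm_fld.
    by apply: filterS HD => x; apply; rewrite -ltnS.
by apply: filterS => x Hx; apply/row_matrixP => i; exact: Hx.
Qed.

(** The rows of [H] are [prj]-related to the projected ones, so structure functions agree up to a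
    shift of the indices by one, which turns [LG 2] into [LG 1]. Row 0 commutes with all rows at the
    base point, so no row was reached through it. *)
Lemma LG_project (H : 'rV[R]_m.+1 -> 'M[R]_m.+1) : (0 < m)%N ->
  LG 2 H 0 -> straight H m -> LG 1 (prjM H) 0.
Proof.
move=> m0 [Hs Hu HA HB] [H0 HD].
pose Z := prjM H.
have Zs : Csm 0 Z.
  apply: (@Csm_linear_mx R _ _ _ _ 0 (fun x => col' ord_max (H (inj x))) (row' ord0)).
    exact: row'_linear.
  apply: (@Csm_linear_mx R _ _ _ _ 0 (fun x => H (inj x)) (col' ord_max)).
    exact: col'_linear.
  by apply: Csm_comp; [exact: Csm_inj (Csm_id _)|rewrite inj0].
have Zu : Z 0 \in unitmx.
  by apply: unit_minor; rewrite inj0//; exact: nbhs_singleton H0.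
have Hc := straight_inj Hs (conj H0 HD).
have rel : \forall x \near (0 : 'rV[R]_m.+1), forall a,
    fld Z a (prj x) = 'd prj x (fld H (lift ord0 a) x).
  apply: filterS Hc => x Hx a.
  apply: etrans _ (esym (diff_linear_mxE x _ prj_linear)).
  by rewrite /fld /Z /prjM -Hx; apply/rowP => j; rewrite !mxE.
have cfbZ : \forall x \near (0 : 'rV[R]_m.+1), forall a b,
    cfb Z a b (prj x) = col' ord0 (cfb H (lift ord0 a) (lift ord0 b) x).
  have n1 := near_nearP rel; have n2 := Csm_open Hs; have n3 := unitmx_near Hs Hu.
  have n4 := prj_near (Csm_open Zs).
  near=> x => a b.
  have Hx : Csm x H by near: x.
  have Zx : Csm (prj x) Z by near: x.
  have Hxu : H x \in unitmx by near: x.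
  have relx : \forall y \near x, forall a,
    fld Z a (prj y) = 'd prj y (fld H (lift ord0 a) y) by near: x.
  have relxa a' : \forall y \near x,
    fld Z a' (prj y) = 'd prj y (fld H (lift ord0 a') y).
    by apply: filterS relx => y; apply.
  have E := br_related (Csm_prj (Csm_id x)) (Csm_fld (lift ord0 a) Hx)
    (Csm_fld (lift ord0 b) Hx) (Csm_fld a Zx) (Csm_fld b Zx) (relxa a) (relxa b).
  have E2 : br (fld Z a) (fld Z b) (prj x) =
      prj (br (fld H (lift ord0 a)) (fld H (lift ord0 b)) x).
    exact: etrans E (diff_linear_mxE x _ prj_linear).
  have HE : H x = H (inj (prj x)) by near: x.
  have H0x : fld H ord0 x = ydir m by near: x.
  have G := prj_coef (br (fld H (lift ord0 a)) (fld H (lift ord0 b)) x) H0x Hxu.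
  apply: etrans (congr2 (fun u (M : 'M[R]_m) => u *m invmx M) E2 _) G.
  by rewrite /Z /prjM -HE.
have cc (w : 'rV[R]_m.+1) (l : 'I_m) : (col' ord0 w : 'rV[R]_m) 0 l = w 0 (lift ord0 l).
  by rewrite mxE.
split => //.
  apply: filterS2 (inj_near cfbZ) (inj_near HA) => x; rewrite prjK => E A a b l abl.
  apply: etrans (congr1 (fun u : 'rV[R]_m => u 0 l) (E a b)) _.
  apply: etrans (cc _ l) _; apply: A.
  by move: abl; rewrite /= /bump !add1n !maxnSS.
move=> j j1 jm.
have [a [b [l [aj bj lE ne]]]] := HB j.+1 j1 jm.
have anz (c : 'I_m.+1) : (c <= j.+1)%N -> cfb H ord0 c 0 = 0 /\ cfb H c ord0 0 = 0.
  move=> cj; suff E : cfb H ord0 c 0 = 0 by split => //; rewrite cfbC E oppr0.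
  have n0 := nbhs_singleton H0.
  have D1 : 'd (fld H c) 0 (fld H ord0 0) = 0.
    apply: etrans (congr1 ('d (fld H c) 0) n0) _.
    by apply: (nbhs_singleton HD); rewrite -ltnS.
  have D2 : 'd (fld H ord0) 0 (fld H c 0) = 0.
    apply: etrans (diff_near_eq _ H0 (differentiable_cst _ _)) _.
    exact: diff_cstE.
  have D3 : br (fld H ord0) (fld H c) 0 = 0.
    by apply: etrans (congr2 (fun a b => a - b) D1 D2) _; rewrite subrr.
  by rewrite /cfb D3 mul0mx.
case: (unliftP ord0 a) => [a' aE|aE]; last first.
  by move: ne; rewrite aE (anz b bj).1 mxE eqxx.
case: (unliftP ord0 b) => [b' bE|bE]; last first.
  by move: ne; rewrite bE (anz a aj).2 mxE eqxx.
case: (unliftP ord0 l) => [l' lE'|lE']; last by move: lE; rewrite lE'.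
exists a', b', l'; split.
- by move: aj; rewrite aE /= /bump add1n ltnS.
- by move: bj; rewrite bE /= /bump add1n ltnS.
- by move: lE; rewrite lE' /= /bump add1n => -[].
- have E := nbhs_singleton cfbZ a' b'; rewrite prj0 in E.
  by rewrite -/Z E cc -aE -bE -lE'.
Unshelve. all: by end_near. Qed.

End projection.

(** * Adding a trailer *)

Section angle_function.
Context {R : realType}.

Lemma Csm_real (V : normedModType R) (x : V) (g : V -> R) (h : R -> R) :
  Cinf setT h -> Csm x g -> Csm x (fun y => h (g y)).
Proof.
move=> hi gs; apply: Csm_comp gs _; exists setT => //; split => //; exact: openT.
Qed.

Lemma sin_cos_atan (A B : R) : B != 0 -> sin (atan (A / B)) * B = cos (atan (A / B)) * A.
Proof.
move=> B0; have c0 : cos (atan (A / B)) != 0.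
  by rewrite gt_eqF// cos_gt0_pihalf// atan_gtNpi2 atan_ltpi2.
have : sin (atan (A / B)) / cos (atan (A / B)) = A / B by exact: atanK.
move=> /(congr1 (fun t => t * cos (atan (A / B)) * B)).
by rewrite divfK// => ->; rewrite mulrAC divfK// mulrC.
Qed.

(** The angle of the direction of [(B, A)], determined up to a half turn. One of the two quotients
    is defined near [x], and the arctangent of either gives the angle. *)
Lemma angle_exists (V : normedModType R) (x : V) (A B : V -> R) :
  Csm x A -> Csm x B -> (A x != 0) || (B x != 0) ->
  exists al : V -> R, Csm x al /\
    \forall y \near x, sin (al y) * B y = cos (al y) * A y.
Proof.
have near0 (g : V -> R) : Csm x g -> g x != 0 -> \forall y \near x, g y != 0.
  move=> gs g0; have gc : {for x, continuous g} := Csm_continuous gs.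
  apply: (gc [set t | t != 0]).
  by apply: open_nbhs_nbhs; split; [exact: open_neq0|].
move=> As Bs; have [A0 /= B0|A0 _] := eqVneq (A x) 0.
  exists (fun y => atan (A y / B y)); split.
    by apply: (Csm_real Cinf_atan); apply: Csm_mul => //; exact: Csm_inv.
  by apply: filterS (near0 B Bs B0) => y; exact: sin_cos_atan.
exists (fun y => pi / 2 - atan (B y / A y)); split.
  apply: Csm_sub; first exact: Csm_cst.
  by apply: (Csm_real Cinf_atan); apply: Csm_mul => //; exact: Csm_inv.
apply: filterS (near0 A As A0) => y Ay.
set t := atan _; have -> : pi / 2 - t = - (t - pi / 2) by rewrite opprB.
by rewrite sinN cosN sinBpihalf cosBpihalf opprK; apply/esym; exact: sin_cos_atan.
Qed.

Lemma dependent_pairs (A B A' B' : R) : A * B' = B * A' ->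
  exists k l, [/\ (k != 0) || (l != 0), k * A + l * A' = 0 & k * B + l * B' = 0].
Proof.
move=> E; have [B0|B0] := eqVneq B 0; have [B'0|B'0] := eqVneq B' 0.
- have [A'0|A'0] := eqVneq A' 0.
    by exists 0, 1; rewrite oner_eq0 orbT A'0 B'0 !mul0r mulr0 addr0.
  exists A', (- A); rewrite A'0 B0 B'0 !mulr0 addr0; split => //.
  by rewrite mulNr mulrC subrr.
- exists B', (- B); rewrite B'0 !mulNr -E; split => //; first by rewrite mulrC subrr.
  by rewrite mulrC subrr.
- exists B', (- B); rewrite oppr_eq0 B0 orbT !mulNr -E; split => //.
    by rewrite mulrC subrr.
  by rewrite mulrC subrr.
- exists B', (- B); rewrite B'0 !mulNr -E; split => //; first by rewrite mulrC subrr.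
  by rewrite mulrC subrr.
Qed.

Lemma sin_cos_independent (t A B A' B' : R) : sin t * B = cos t * A ->
  sin t * B' = cos t * A' -> A * B' = B * A'.
Proof.
move=> E E'; have [s0|s0] := eqVneq (sin t) 0.
  have c0 : cos t != 0.
    apply/eqP => c0; have := cos2Dsin2 t; rewrite s0 c0 expr0n addr0 => /eqP.
    by rewrite eq_sym oner_eq0.
  have Z x y : sin t * x = cos t * y -> y = 0.
    by rewrite s0 mul0r => /esym/eqP; rewrite mulf_eq0 (negPf c0) => /eqP.
  by rewrite (Z _ _ E) (Z _ _ E') mul0r mulr0.
by apply: (mulfI s0); rewrite mulrCA E' [RHS]mulrA E mulrCA mulrA.
Qed.

(** [r] is the inner product with the unit vector of angle [t]. It may be negative, since the angle
    only fixes a line. *)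
Lemma polar (t A B : R) : sin t * B = cos t * A ->
  exists r, A = r * sin t /\ B = r * cos t.
Proof.
move=> E; exists (A * sin t + B * cos t); have C := cos2Dsin2 t.
split; apply/eqP; rewrite -subr_eq0; apply/eqP.
  transitivity (cos t * (cos t * A - sin t * B) -
    (cos t ^+ 2 + sin t ^+ 2 - 1) * A); first by ring.
  by rewrite C E !subrr mulr0 mul0r subrr.
transitivity (sin t * (sin t * B - cos t * A) -
  (cos t ^+ 2 + sin t ^+ 2 - 1) * B); first by ring.
by rewrite C E !subrr mulr0 mul0r subrr.
Qed.

End angle_function.

(** * The model with one more angle *)

Section model_step.
Context {R : realType}.

(** [o] is the angle from which the new one is measured: that of the preceding trailer, or 0 over
    the plane. *)
Definition next_model m (N : 'rV[R]_m -> 'M[R]_(2, m)) (o : 'rV[R]_m -> R)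
    (z : 'rV[R]_m.+1) : 'M[R]_(2, m.+1) :=
  let a := z 0 ord_max - o (prj z) in
  \matrix_(i < 2) (if i == 0 then ydir m else
    inj (sin a *: row 0 (N (prj z)) + cos a *: row 1 (N (prj z)))).

Lemma linear_inS_sub d e p k (L : {linear 'rV[R]_d -> 'rV[R]_e}) (A : 'M[R]_d)
    (M : 'M[R]_(p, e)) (w : 'rV[R]_d) : A \in unitmx -> inS k (w *m invmx A) ->
  (forall i : 'I_d, (i <= k)%N -> (L (row i A) <= M)%MS) -> (L w <= M)%MS.
Proof.
move=> Au wk H; rewrite -(mulmxKV Au w) mulmx_sum_row linear_sum.
apply: summx_sub => i _; rewrite linearZ_LR; have [ki|ik] := ltnP k i.
  by rewrite wk// scale0r sub0mx.
by apply: scalemx_sub; exact: H.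
Qed.

Lemma diff_prj_comp (W : normedModType R) m (g : 'rV[R]_m -> W) (x v : 'rV[R]_m.+1) :
  Csm (prj x) g -> 'd (fun y => g (prj y)) x v = 'd g (prj x) (prj v).
Proof.
move=> gs; apply: etrans (diff_compE v _ (Csm_differentiable gs)) _.
  exact: Csm_differentiable (Csm_prj (Csm_id x)).
by apply: (congr1 ('d g (prj x))); exact: diff_linear_mxE _ _ (@prj_linear R m).
Qed.

Lemma diff_prj_ydir (W : normedModType R) m (g : 'rV[R]_m -> W) (x : 'rV[R]_m.+1) :
  Csm (prj x) g -> 'd (fun y => g (prj y)) x (ydir m) = 0.
Proof.
move=> gs; apply: etrans (diff_prj_comp _ gs) _.
by apply: etrans (congr1 ('d g (prj x)) (@prj_ydir R m)) _; exact: (linear0 ('d g _)).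
Qed.

(* Coordinates of [s] in the basis [N z] are smooth: they are read off through a
   right inverse of [N] at the base point. *)
Lemma row_free_coordinates (V : normedModType R) p m (x : V) (N : V -> 'M[R]_(p, m))
    (s : V -> 'rV[R]_m) : Csm x N -> row_free (N x) -> Csm x s ->
  (\forall y \near x, (s y <= N y)%MS) ->
  exists u : V -> 'rV[R]_p, Csm x u /\ \forall y \near x, s y = u y *m N y.
Proof.
move=> Ns /row_freeP[C NC] ss sN.
have NCs : Csm x (fun y => N y *m C) by apply: Csm_mulmx => //; exact: Csm_cst.
have NCu : N x *m C \in unitmx by rewrite NC unitmx1.
exists (fun y => s y *m C *m invmx (N y *m C)); split.
  by apply: Csm_mulmx; [apply: Csm_mulmx => //; exact: Csm_cst|exact: Csm_invmx].
apply: filterS2 (sN) (unitmx_near NCs NCu) => y /submxP[c ->] yu.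
by rewrite -(mulmxA c) mulmxK.
Qed.

End model_step.

(** * The angle of the projected field as a new coordinate *)

Section core.
Context {R : realType}.
Variables (m : nat) (N : 'rV[R]_m -> 'M[R]_(2, m)) (o : 'rV[R]_m -> R).
Hypotheses (Ns : forall z, Csm z N) (Nf : forall z, row_free (N z)).
Hypothesis os : forall z, Csm z o.

Lemma row0_next (z : 'rV[R]_m.+1) : row 0 (next_model N o z) = ydir m.
Proof. by rewrite /next_model rowK. Qed.

Lemma row1_next (z : 'rV[R]_m.+1) : let a := z 0 ord_max - o (prj z) in
  row 1 (next_model N o z) =
    inj (sin a *: row 0 (N (prj z)) + cos a *: row 1 (N (prj z))).
Proof. by rewrite /= /next_model rowK. Qed.

Lemma ydir_next (z : 'rV[R]_m.+1) c : (c *: ydir m <= next_model N o z)%MS.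
Proof. by apply: scalemx_sub; rewrite -(row0_next z) row_sub. Qed.

Lemma mul_row2 p (u : 'rV[R]_2) (M : 'M[R]_(2, p)) :
  u *m M = u 0 0 *: row 0 M + u 0 1 *: row 1 M.
Proof.
rewrite mulmx_sum_row !big_ord_recl big_ord0 addr0.
by rewrite (_ : lift ord0 ord0 = 1)//; exact: val_inj.
Qed.

Lemma row_invmx d (A : 'M[R]_d) i : A \in unitmx -> row i A *m invmx A = delta_mx 0 i.
Proof. by move=> Au; rewrite -row_mul mulmxV// row1. Qed.

Lemma combination_mulmx d (M : 'M[R]_d) (a b c a' b' c' : 'rV[R]_d) (k l p : R) :
  k *: a + l *: b = p *: c -> a *m M = a' -> b *m M = b' -> c *m M = c' ->
  k *: a' + l *: b' = p *: c'.
Proof. by move=> E <- <- <-; rewrite !scalemxAl -mulmxDl E. Qed.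

Lemma zero_products (a b c d : R) : a = 0 -> b = 0 -> a * c = b * d.
Proof. by move=> -> ->; rewrite !mul0r. Qed.

(* Differentiating the relation between the angle and the two coordinates along
   the last direction shows that a stationary angle forces the coordinate vector
   and its derivative to be dependent. *)
Lemma angle_moves (V : normedModType R) (x v : V) (A B al : V -> R) :
  Csm x A -> Csm x B -> Csm x al ->
  (\forall y \near x, sin (al y) * B y = cos (al y) * A y) ->
  'd al x v = 0 -> A x * 'd B x v = B x * 'd A x v.
Proof.
move=> As Bs als E al0.
have sc : Cinf setT (@sin R) /\ Cinf setT (@cos R) by apply: Cinf_sin_cos; exact: openT.
have ss : Csm x (fun y => sin (al y)) := Csm_real sc.1 als.
have cs : Csm x (fun y => cos (al y)) := Csm_real sc.2 als.
have d0 (h : R -> R) : Cinf setT h -> 'd (fun y => h (al y)) x v = 0.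
  move=> hi; have hd : differentiable h (al x) by exact: (Cinf_differentiable hi I).
  apply: etrans (diff_compE v (Csm_differentiable als) hd) _.
  by apply: etrans (congr1 ('d h (al x)) al0) _; exact: (linear0 ('d h _)).
have M (g k : V -> R) : Csm x g -> Csm x k -> 'd g x v = 0 ->
    'd (fun y => g y * k y) x v = g x * 'd k x v.
  move=> gs ks g0.
  apply: etrans (diff_scale v (Csm_differentiable gs) (Csm_differentiable ks)) _.
  apply: etrans (congr1 (fun t => g x *: 'd k x v + t *: k x) g0) _.
  by rewrite scale0r addr0.
apply: (@sin_cos_independent R (al x)); first exact: nbhs_singleton E.
apply: etrans (esym (M _ _ ss Bs (d0 _ sc.1))) _.
apply: etrans _ (M _ _ cs As (d0 _ sc.2)).
by apply: diff_near_eq E _; apply: Csm_differentiable; exact: Csm_mul.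
Qed.

Variables (F : 'rV[R]_m.+1 -> 'M[R]_m.+1) (Z : 'rV[R]_m -> 'M[R]_m).
Variables (g : 'rV[R]_m -> 'rV[R]_m) (i1 : 'I_m.+1).
Hypotheses (m2 : (2 <= m)%N) (i1E : i1 = 1%N :> nat).
Hypotheses (LGF : LG 1 F 0)
  (F0e : \forall x \near (0 : 'rV[R]_m.+1), fld F ord0 x = ydir m)
  (Zs : Csm 0 Z) (Zu : Z 0 \in unitmx)
  (FZ : \forall x \near (0 : 'rV[R]_m.+1),
    inS 1 (prj (fld F i1 x) *m invmx (Z (prj x)))).
Hypotheses (gs : Csm 0 g) (ginj : forall v, 'd g 0 v = 0 -> v = 0)
  (gZ : \forall z \near (0 : 'rV[R]_m), forall i : 'I_m, (i <= 1)%N ->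
    ('d g z (fld Z i z) <= N (g z))%MS).

Let psi x := g (prj x).
Let s x := 'd g (prj x) (prj (fld F i1 x)).

Let Fs : Csm 0 F. Proof. by case: LGF. Qed.

Let gs_near : \forall x \near (0 : 'rV[R]_m.+1), Csm (prj x) g.
Proof. exact: prj_near (Csm_open gs). Qed.

Let gs0 : Csm (prj (0 : 'rV[R]_m.+1)) g. Proof. by rewrite prj0. Qed.

Let psis : Csm 0 psi.
Proof. exact: Csm_comp (Csm_prj (Csm_id _)) gs0. Qed.

Let ss : Csm 0 s.
Proof.
apply: Csm_diff gs0 _ _; first exact: Csm_prj (Csm_id _).
exact: Csm_prj (Csm_fld i1 Fs).
Qed.

Let sN : \forall x \near (0 : 'rV[R]_m.+1), (s x <= N (psi x))%MS.
Proof.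
apply: filterS3 (FZ) (prj_near gZ) (prj_near (unitmx_near Zs Zu)) => x Fx Zx Zxu.
exact: (@linear_inS_sub R _ _ _ 1 ('d g (prj x)) (Z (prj x))).
Qed.

(** [psi] does not depend on the last coordinate, so differentiating [s] along it only
    differentiates [F_1]. *)
Let ds0 : 'd s 0 (ydir m) = 'd g 0 (prj ('d (fld F i1) 0 (ydir m))).
Proof.
have F1s := Csm_fld i1 Fs.
have E : {near (0 : 'rV[R]_m.+1), s =1 fun x => 'd psi x (fld F i1 x)}.
  by apply: filterS gs_near => x gx; apply/esym; exact: diff_prj_comp.
apply: etrans (diff_near_eq _ E _) _.
  by apply: Csm_differentiable; apply: Csm_diff => //; exact: Csm_id.
apply: etrans (diff_diff_apply _ psis (Csm_differentiable F1s)) _.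
have E1 : 'd (fun y => 'd psi y (ydir m)) 0 (fld F i1 0) = 0.
  apply: etrans (diff_near_eq _ _ (differentiable_cst 0 _)) _.
    by apply: filterS gs_near => x gx; exact: diff_prj_ydir.
  exact: diff_cstE.
have E2 v : 'd psi 0 v = 'd g 0 (prj v).
  by apply: etrans (diff_prj_comp v gs0) _; rewrite prj0.
by apply: etrans (congr2 (fun a b => a + b) E1 (E2 _)) _; rewrite add0r.
Qed.

Let s0E : s 0 = 'd g 0 (prj (fld F i1 0)).
Proof. by rewrite /s prj0. Qed.

(** The derivative of [F_1] along the last coordinate is [[F_0, F_1]]. A relation would put a
    combination of [F_1] and this bracket on the line of [F_0], whereas the bracket has a nonzero
    component along [F_2]. *)
Let independent (k l : R) : k *: s 0 + l *: 'd s 0 (ydir m) = 0 -> (k == 0) && (l == 0).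
Proof.
set f1 := fld F i1 0; have [b bE] : exists b, b = 'd (fld F i1) 0 (ydir m).
  exact: (ex_intro _ _ erefl).
move=> E; have {}E : 'd g 0 (prj (k *: f1 + l *: b)) = 0.
  apply: etrans _ E; have -> : prj (k *: f1 + l *: b) = k *: prj f1 + l *: prj b.
    by apply/rowP => i; rewrite !mxE.
  apply: etrans (linearD ('d g 0) _ _) _.
  apply: (congr2 (fun a b => a + b)).
    apply: etrans (linearZ_LR ('d g 0) _ _) _.
    by rewrite s0E.
  apply: etrans (linearZ_LR ('d g 0) _ _) _.
  by rewrite ds0 bE.
have {}E := ginj E.
have Fu : F 0 \in unitmx by case: LGF.
set w := k *: f1 + l *: b in E.
have wE : w = w 0 ord_max *: ydir m.
  by rewrite {1}[w]inj_prj_add E inj0 add0r.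
have n0 := nbhs_singleton F0e.
have bbr : br (fld F ord0) (fld F i1) 0 = b.
  have D1 : 'd (fld F i1) 0 (fld F ord0 0) = b by rewrite bE n0.
  have D2 : 'd (fld F ord0) 0 (fld F i1 0) = 0.
    apply: etrans (diff_near_eq _ F0e (differentiable_cst _ _)) _.
    exact: diff_cstE.
  by apply: etrans (congr2 (fun a b => a - b) D1 D2) _; rewrite subr0.
have bc : b *m invmx (F 0) = cfb F ord0 i1 0 by rewrite -bbr.
have fc : f1 *m invmx (F 0) = delta_mx 0 i1 := row_invmx i1 Fu.
have ec : ydir m *m invmx (F 0) = delta_mx 0 ord0.
  exact: etrans (congr1 (fun v => v *m invmx (F 0)) (esym n0)) (row_invmx ord0 Fu).
have K : k *: delta_mx 0 i1 + l *: cfb F ord0 i1 0 = w 0 ord_max *: delta_mx 0 ord0.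
  exact: combination_mulmx wE fc bc ec.
have [_ _ FA FB] := LGF.
(* At [j] = 1 the only bracket that can reach row 2 is [[F_0, F_1]], up to sign. *)
have [a [c [i2 [a1 c1 i2E ne]]]] := FB 1%N isT m2.
have c01 : cfb F ord0 i1 0 0 i2 != 0.
  have I2 (j : 'I_m.+1) : (j <= 1)%N -> j = ord0 \/ j = i1.
    by case: j => [[|[|//]] p] _; [left|right]; apply: val_inj; rewrite /= ?i1E.
  have [aE|aE] := I2 a a1; have [cE|cE] := I2 c c1; rewrite aE cE in ne.
  - by rewrite cfbXX mxE eqxx in ne.
  - exact: ne.
  - by rewrite cfbC mxE oppr_eq0 in ne.
  - by rewrite cfbXX mxE eqxx in ne.
have KE (x y c' : R) (u : 'rV[R]_m.+1) (j : 'I_m.+1) :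
    x *: delta_mx 0 i1 + y *: u = c' *: delta_mx 0 ord0 ->
    x * (j == i1)%:R + y * u 0 j = c' * (j == ord0)%:R.
  move=> /(congr1 (fun u : 'rV[R]_m.+1 => u 0 j)).
  by rewrite !mxE.
have l0 : l = 0.
  have := KE _ _ _ _ i2 K; rewrite (_ : (i2 == i1) = false); last first.
    by rewrite -val_eqE /= i2E i1E.
  rewrite (_ : (i2 == ord0) = false); last by rewrite -val_eqE /= i2E.
  by rewrite !mulr0 add0r => /eqP; rewrite mulf_eq0 (negPf c01) orbF => /eqP.
have := KE _ _ _ _ i1 K; rewrite eqxx (_ : (i1 == ord0) = false); last first.
  by rewrite -val_eqE /= i1E.
by rewrite l0 mul0r mulr0 mulr1 addr0 => ->; rewrite eqxx.
Qed.

(** [A] and [B] are the coordinates in the model of the projected [F_1], and [al] is its angle.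
    Taking [th] as last coordinate makes [th - o] equal to [al], so [F_1] falls on a line with row 1
    of the next model, up to a multiple of row 0. The differential is injective because that of [g]
    is and [al] moves along the last coordinate. *)
Lemma core_step : exists f : 'rV[R]_m.+1 -> 'rV[R]_m.+1,
  [/\ Csm 0 f, forall v, 'd f 0 v = 0 -> v = 0 &
      \forall x \near (0 : 'rV[R]_m.+1), forall i : 'I_m.+1, (i <= 1)%N ->
        ('d f x (fld F i x) <= next_model N o (f x))%MS].
Proof.
have Nps : Csm 0 (fun x => N (psi x)) by apply: Csm_comp psis _.
have [u [us uE]] := row_free_coordinates Nps (Nf _) ss sN.
pose A x : R := u x 0 0; pose B x : R := u x 0 1.
have As : Csm 0 A by exact: Csm_coord.
have Bs : Csm 0 B by exact: Csm_coord.
have du0 : 'd s 0 (ydir m) = 'd u 0 (ydir m) *m N (psi 0).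
  apply: etrans (diff_near_eq _ uE (Csm_differentiable (Csm_mulmx us Nps))) _.
  have dd := diff_mulmx (ydir m) (Csm_differentiable us) (Csm_differentiable Nps).
  apply: etrans dd _.
  have gN : Csm (prj (0 : 'rV[R]_m.+1)) (fun z => N (g z)) by exact: Csm_comp gs0 _.
  have E0 : 'd (fun x => N (psi x)) 0 (ydir m) = 0 := diff_prj_ydir gN.
  by rewrite E0 mulmx0 addr0.
have dA : 'd A 0 (ydir m) = 'd u 0 (ydir m) 0 0.
  exact: (diff_coord (ydir m) 0 0 (Csm_differentiable us)).
have dB : 'd B 0 (ydir m) = 'd u 0 (ydir m) 0 1.
  exact: (diff_coord (ydir m) 0 1 (Csm_differentiable us)).
(* A zero Wronskian would make [s] and its derivative dependent, the frame [N] at [psi] being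
   constant along the last coordinate. *)
have W : A 0 * 'd B 0 (ydir m) <> B 0 * 'd A 0 (ydir m).
  move=> /dependent_pairs[k [l [kl kA kB]]].
  suff /independent/andP[/eqP k0 /eqP l0] : k *: s 0 + l *: 'd s 0 (ydir m) = 0.
    by move: kl; rewrite k0 l0 eqxx.
  rewrite du0 (nbhs_singleton uE) !scalemxAl -mulmxDl.
  rewrite dA in kA; rewrite dB in kB.
  set u' := 'd u 0 (ydir m) in kA kB *.
  have -> : k *: u 0 + l *: u' = 0; last by rewrite mul0mx.
  clearbody u'; apply/rowP => j; rewrite !mxE.
  have [j0|j1] : j = 0 \/ j = 1.
    by case: j => [[|[|//]] p]; [left|right]; apply: val_inj.
  - by rewrite j0.
  - by rewrite j1.
have [al [als alE]] : exists al, Csm (0 : 'rV[R]_m.+1) al /\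
    \forall y \near (0 : 'rV[R]_m.+1), sin (al y) * B y = cos (al y) * A y.
  apply: (angle_exists As Bs); apply/negPn/negP; rewrite negb_or !negbK.
  by move=> /andP[/eqP A0 /eqP B0]; exact: (W (zero_products _ _ A0 B0)).
have al1 : 'd al 0 (ydir m) != 0.
  by apply/eqP => al0; apply: W; exact: (angle_moves As Bs als alE al0).
have ops : Csm 0 (fun x => o (psi x)) by apply: Csm_comp psis _.
pose th x := o (psi x) + al x.
have ths : Csm 0 th by exact: Csm_add.
have dth : 'd th 0 (ydir m) = 'd al 0 (ydir m).
  have gO : Csm (prj (0 : 'rV[R]_m.+1)) (fun z => o (g z)) by exact: Csm_comp gs0 _.
  have E0 : 'd (fun x => o (psi x)) 0 (ydir m) = 0 := diff_prj_ydir gO.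
  apply: etrans (congr1 (fun G => G (ydir m))
    (diffD (Csm_differentiable ops) (Csm_differentiable als))) _.
  by apply: etrans (congr1 (fun t => t + _) E0) _; rewrite add0r.
pose f x := inj (psi x) + th x *: ydir m.
have fs : Csm 0 f.
  apply: Csm_add; first exact: Csm_inj psis.
  exact: (Csm_scale ths (Csm_cst _ _)).
have df : \forall x \near (0 : 'rV[R]_m.+1), forall v,
    'd f x v = inj ('d g (prj x) (prj v)) + 'd th x v *: ydir m.
  apply: filterS3 (Csm_open psis) (Csm_open ths) (gs_near) => x px tx gx v.
  have d1 : differentiable (fun x => inj (psi x)) x.
    exact: Csm_differentiable (Csm_inj px).
  have d2 : differentiable (fun x => th x *: ydir m) x.
    exact: (Csm_differentiable (Csm_scale tx (Csm_cst _ _))).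
  apply: etrans (congr1 (fun G => G v) (diffD d1 d2)) _.
  apply: (congr2 (fun a b => a + b)).
    apply: etrans (diff_linear_mx_comp v (@inj_linear R m) (Csm_differentiable px)) _.
    exact: (congr1 (@inj R m) (diff_prj_comp v gx)).
  apply: etrans (diff_scale v (Csm_differentiable tx) (differentiable_cst _ x)) _.
  apply: etrans (congr1 (fun t => th x *: t + 'd th x v *: ydir m) (diff_cstE _ _ _)) _.
  by rewrite scaler0 add0r.
have injmax (z : 'rV[R]_m) : inj z 0 ord_max = 0 by rewrite mxE unlift_none.
have prjf x : prj (f x) = psi x.
  rewrite /f; have -> : prj (inj (psi x) + th x *: ydir m) =
    prj (inj (psi x)) + th x *: prj (ydir m) by apply/rowP => i; rewrite !mxE.
  by rewrite prjK prj_ydir scaler0 addr0.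
have fmax x : f x 0 ord_max = th x.
  by rewrite /f mxE injmax add0r mxE mxE !eqxx mulr1.
exists f; split; [exact: fs| |].
  move=> v /(etrans (esym (nbhs_singleton df v))).
  rewrite prj0 => E.
  have p0 : prj v = 0.
    apply: ginj; rewrite -[LHS]prjK.
    have := congr1 (@prj R m) E.
    have -> (x : 'rV[R]_m) (t : R) : prj (inj x + t *: ydir m) = prj (inj x).
      rewrite -[RHS]addr0 -(scaler0 _ t) -(@prj_ydir R m).
      by apply/rowP => i; rewrite !mxE.
    by rewrite prj0.
  have vE : v = v 0 ord_max *: ydir m by rewrite {1}[v]inj_prj_add p0 inj0 add0r.
  have E0 : 'd th 0 v = 0.
    have := congr1 (fun u : 'rV[R]_m.+1 => u 0 ord_max) E.
    by rewrite mxE injmax add0r mxE mxE !eqxx mulr1 mxE.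
  have : v 0 ord_max * 'd al 0 (ydir m) = 0.
    rewrite -dth; apply: etrans _ E0; apply/esym.
    apply: etrans (congr1 ('d th 0) vE) _.
    exact: (linearZ_LR ('d th 0)).
  move=> /eqP; rewrite mulf_eq0 (negPf al1) orbF => /eqP v0.
  by rewrite vE v0 scale0r.
apply: filterS3 (df) (alE) (filterI F0e uE) => x dfx alx [F0x ux] i i_le.
rewrite dfx; apply: addmx_sub; last exact: ydir_next.
have [iE|iE] : i = ord0 \/ i = i1.
  by case: i i_le => [[|[|//]] p] _; [left|right]; apply: val_inj; rewrite /= ?i1E.
- rewrite iE F0x prj_ydir.
  have -> : 'd g (prj x) 0 = 0 by exact: (linear0 ('d g _)).
  by rewrite inj0 sub0mx.
- rewrite iE; have -> : 'd g (prj x) (prj (fld F i1 x)) = u x *m N (psi x) by exact: ux.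
  rewrite mul_row2 -/(A x) -/(B x).
  have [r [-> ->]] := polar alx.
  have -> : inj ((r * sin (al x)) *: row 0 (N (psi x)) +
      (r * cos (al x)) *: row 1 (N (psi x))) =
      r *: row 1 (next_model N o (f x)).
    rewrite row1_next prjf fmax /th [X in X - o _]addrC addrK.
    rewrite -!scalerA -scalerDr.
    by apply/rowP => j; rewrite !mxE; case: unlift => [k|]; rewrite ?mxE ?mulr0.
  by apply: scalemx_sub; exact: row_sub.
Qed.

End core.

(** * Induction over the trailers *)

Section local_models.
Context {R : realType}.

(** The point [f q] is left free and only an inclusion into the plane of the model is required; both
    choices make the property pass from [N] to the next model. *)
Definition locally_modelled m (N : 'rV[R]_m -> 'M[R]_(2, m)) :=
  forall (F : 'rV[R]_m -> 'M[R]_m) (q : 'rV[R]_m), LG 1 F q ->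
  exists f : 'rV[R]_m -> 'rV[R]_m,
    [/\ Csm q f, forall v, 'd f q v = 0 -> v = 0 &
        \forall x \near q, forall i : 'I_m, (i <= 1)%N ->
          ('d f x (fld F i x) <= N (f x))%MS].

Section step.
Variables (m : nat) (N : 'rV[R]_m -> 'M[R]_(2, m)) (o : 'rV[R]_m -> R).
Hypotheses (Ns : forall z, Csm z N) (Nf : forall z, row_free (N z)).
Hypothesis os : forall z, Csm z o.

Lemma Csm_next_model z : Csm z (next_model N o).
Proof.
have sc : Cinf setT (@sin R) /\ Cinf setT (@cos R) by apply: Cinf_sin_cos; exact: openT.
have Np : Csm z (fun z => N (prj z)).
  by apply: Csm_comp (Csm_prj (Csm_id z)) _.
have as_ : Csm z (fun z => z 0 ord_max - o (prj z)).
  apply: Csm_sub; first exact: Csm_coord (Csm_id _).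
  by apply: Csm_comp (Csm_prj (Csm_id z)) _.
apply: Csm_mxP => i j; case: (eqVneq i 0) => [->|i0].
  apply: Csm_near_eq (Csm_cst z (ydir m 0 j)).
  by apply: near_all => y; rewrite mxE.
have H : Csm z (fun z => inj (sin (z 0 ord_max - o (prj z)) *: row 0 (N (prj z)) +
    cos (z 0 ord_max - o (prj z)) *: row 1 (N (prj z)))).
  apply: Csm_inj; apply: Csm_add; apply: Csm_scale.
  - exact: (Csm_real sc.1 as_).
  - exact: Csm_row.
  - exact: (Csm_real sc.2 as_).
  - exact: Csm_row.
apply: Csm_near_eq (Csm_coord 0 j H).
by apply: near_all => y; rewrite mxE (negPf i0).
Qed.

(** Row 0 alone has a last coordinate, and row 1 combines the independent rows of [N] with
    coefficients that do not both vanish. *)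
Lemma row_free_next_model z : row_free (next_model N o z).
Proof.
rewrite -kermx_eq0; apply/eqP/row_matrixP => k; rewrite row0; set c := row k _.
have cN : c *m next_model N o z = 0 by rewrite -row_mul mulmx_ker row0.
clearbody c; move: cN; rewrite mul_row2 row0_next row1_next /=.
set a := _ - _; set w := sin a *: _ + _ => E.
have c0 : c 0 0 = 0.
  have := congr1 (fun u : 'rV[R]_m.+1 => u 0 ord_max) E.
  by rewrite !mxE unlift_none !eqxx mulr1 mulr0 addr0.
have [C NC] := row_freeP (Nf (prj z)).
pose u : 'rV[R]_2 := \row_(i < 2) (if i == 0 then sin a else cos a).
have wE : w = u *m N (prj z) by rewrite mul_row2 !mxE.
have cu : c 0 1 *: u = 0.
  have H : c 0 1 *: w = 0.
    have := congr1 (@prj R m) E; rewrite c0 scale0r add0r => H.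
    rewrite -[RHS](@prj0 R m) -H.
    by apply/rowP => j; rewrite !mxE liftK ?mxE.
  by rewrite -[LHS]mulmx1 -NC mulmxA -scalemxAl -wE H mul0mx.
have c1 : c 0 1 = 0.
  have cs := congr1 (fun u : 'rV[R]_2 => u 0 0) cu.
  have cc := congr1 (fun u : 'rV[R]_2 => u 0 1) cu.
  rewrite /= !mxE /= in cs cc.
  rewrite -[c 0 1]mulr1 -(cos2Dsin2 a) mulrDr !expr2 !mulrA cs cc.
  by rewrite !mul0r addr0.
apply/rowP => j; rewrite mxE.
have [->|->] // : j = 0 \/ j = 1.
by case: j => [[|[|//]] p]; [left|right]; apply: val_inj.
Qed.

Lemma locally_modelled_next : (2 <= m)%N -> locally_modelled N ->
  locally_modelled (next_model N o).
Proof.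
move=> m2 loc F q LGF.
have [F1 [LG1 chF1 FF1]] := characteristic_frame m2 LGF.
have [F1s F1u _ _] := LG1.
have [psi [phi [psi0 [psis phis] phiK psiK psiX]]] := flow_box F1s F1u.
have phis' : Csm (psi 0) phi by rewrite psi0.
have psiK' : \forall z \near psi 0, psi (phi z) = z by rewrite psi0.
have phi0 : phi q = 0 by rewrite -psi0; exact: nbhs_singleton phiK.
pose F2 := pull F1 psi phi.
have LG2 : LG 1 F2 0 by apply: LG_pull => //; rewrite psi0.
have [F2s F2u _ _] := LG2.
have F1s' : Csm (psi 0) F1 by rewrite psi0.
have F1u' : F1 (psi 0) \in unitmx by rewrite psi0.
have cE := cfb_pull psis phis' phiK psiK' F1s' F1u'.
have psic := Csm_continuous psis.
have chF2 : char_frame F2 0.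
  have n : \forall y \near (0 : 'rV[R]_m.+1), forall i : 'I_m.+1, (i <= 2)%N ->
      inS 2 (cfb F1 ord0 i (psi y)).
    have H : \forall z \near psi 0, forall i : 'I_m.+1, (i <= 2)%N ->
      inS 2 (cfb F1 ord0 i z) by rewrite psi0.
    exact: (psic _ H).
  by apply: filterS2 (cE) (n) => y E H i i2; rewrite E; exact: H.
have pn := pull_near psis phis' phiK psiK'.
have F2e : \forall x \near (0 : 'rV[R]_m.+1), fld F2 ord0 x = ydir m.
  apply: filterS2 (pn) (psiX) => y [_ _ H _ _] E.
  apply: etrans (fld_pull _ _ _ _ _) _.
  by apply: etrans (congr1 ('d phi (psi y)) (esym E)) _; exact: H.
have [G [LGG stG F2G]] := straighten m2 LG2 chF2 F2e.
have LGZ : LG 1 (prjM G) 0 := LG_project (ltnW m2) LGG stG.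
have [Zs Zu _ _] := LGZ; have [Gs Gu _ _] := LGG.
have [g [gs ginj gZ]] := loc _ _ LGZ.
pose i1 : 'I_m.+1 := inord 1.
have i1E : i1 = 1%N :> nat by rewrite inordK// ltnS ltnW.
(* [F_1] lies in the span of rows 0 to 2 of the normalised frame and row 0 projects to zero, so its
   projection lies in the span of the first two projected rows. *)
have FZ : \forall x \near (0 : 'rV[R]_m.+1),
    inS 1 (prj (fld F2 i1 x) *m invmx (prjM G (prj x))).
  apply: filterS3 (F2G) (filterI (straight_inj Gs stG) stG.1) (unitmx_near Gs Gu).
  move=> x H [Gx G0x] Gxu; rewrite /prjM -Gx prj_coef// => l l1.
  by rewrite mxE; apply: H; rewrite ?i1E.
have [f [fs finj fF]] := core_step Ns Nf os m2 i1E LG2 F2e Zs Zu FZ gs ginj gZ.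
have fs' : Csm (phi q) f by rewrite phi0.
have phic := Csm_continuous phis.
have dfp : \forall x \near q, forall v, 'd (fun y => f (phi y)) x v = 'd f (phi x) ('d phi x v).
  have fn : \forall x \near q, Csm (phi x) f := phic _ (Csm_open fs').
  apply: filterS2 (Csm_open phis) (fn) => x px fx v.
  exact: diff_compE v (Csm_differentiable px) (Csm_differentiable fx).
exists (fun x => f (phi x)); split.
- exact: Csm_comp phis fs'.
- move=> v /(etrans (esym (nbhs_singleton dfp v))); rewrite phi0 => /finj E.
  have [_ _ _ H _] := nbhs_singleton pn.
  have := H v; rewrite psi0 => <-.
  by apply: etrans (congr1 ('d psi 0) E) _; exact: (linear0 ('d psi 0)).
- have fF' : \forall x \near q, forall i : 'I_m.+1, (i <= 1)%N ->
      ('d f (phi x) (fld F2 i (phi x)) <= next_model N o (f (phi x)))%MS.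
    have H : \forall y \near phi q, forall i : 'I_m.+1, (i <= 1)%N ->
      ('d f y (fld F2 i y) <= next_model N o (f y))%MS by rewrite phi0.
    exact: (phic _ H).
  apply: filterS3 (FF1) (filterI fF' dfp) (filterI psiK (unitmx_near F1s F1u)).
  move=> x FFx [fFx dx] [xK F1x] i i_le.
  rewrite dx.
  apply: (@linear_inS_sub R _ _ _ 1 ('d f (phi x) \o 'd phi x) (F1 x)) => //.
    exact: FFx.
  move=> j j1.
  have E : 'd phi x (row j (F1 x)) = fld F2 j (phi x).
    exact: etrans (esym (congr1 (fun y => 'd phi y (fld F1 j y)) xK))
      (esym (fld_pull F1 psi phi j (phi x))).
  exact: (eq_ind_r (fun v => ('d f (phi x) v <= _)%MS) (fFx j j1) E).
Qed.

End step.

Definition trailer_frame n (z : 'rV[R]_n.+3) : 'M[R]_(2, n.+3) :=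
  \matrix_(i < 2) (if i == 0 then (trailer_coord R n).1 z else (trailer_coord R n).2 z).

Definition plane_frame (z : 'rV[R]_2) : 'M[R]_(2, 2) :=
  \matrix_(i < 2) (if i == 0 then delta_mx 0 1 else delta_mx 0 0).

(** The plane with the frame of its xi_2 and xi_1 directions, in this order, takes the place of a
    preceding trailer. *)
Lemma trailer_frame0 : trailer_frame (n := 0) = next_model plane_frame (fun=> 0).
Proof.
apply/funext => z; apply/row_matrixP => i; rewrite !rowK; case: eqP => // _ /=.
rewrite subr0 /plane_frame ?rowK /=; apply/rowP => j; rewrite !mxE.
case: unliftP => [k ->|->]; last by rewrite !mulr0 addr0.
by case: k => [[|[|//]] p]; rewrite !mxE.
Qed.

Lemma trailer_frameS n :
  trailer_frame (n := n.+1) = next_model (@trailer_frame n) (fun z => z 0 ord_max).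
Proof.
apply/funext => z; apply/row_matrixP => i; rewrite !rowK; case: eqP => // _ /=.
rewrite /trailer_frame ?rowK /=; apply/rowP => j; rewrite !mxE.
by case: unliftP => [k _|_]; rewrite ?mxE /= ?mulr0 ?addr0.
Qed.

Lemma plane_frame_unit z : plane_frame z \in unitmx.
Proof.
have E : plane_frame z *m plane_frame z = 1%:M.
  apply/matrixP => i j; rewrite mxE !big_ord_recl big_ord0 addr0 !mxE /=.
  by case: i j => [[|[|//]] p] [[|[|//]] p']; rewrite !mxE /= ?mulr0 ?mul0r ?mulr1 ?addr0 ?add0r.
by case: (mulmx1_unit E).
Qed.

Lemma locally_modelled_plane : locally_modelled plane_frame.
Proof.
move=> F q _; exists (fun x => x); split.
- exact: Csm_id.
- by move=> v; rewrite diff_idE.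
- apply: near_all => x i _; apply: submx_full.
  by rewrite row_full_unit plane_frame_unit.
Qed.

Lemma trailer_model n : [/\ forall z, Csm z (@trailer_frame n),
  forall z, row_free (@trailer_frame n z) & locally_modelled (@trailer_frame n)].
Proof.
elim: n => [|n [Ns Nf loc]].
  rewrite trailer_frame0.
  have Ns z : Csm z plane_frame by exact: Csm_cst.
  have Nf z : row_free (plane_frame z) by rewrite row_free_unit plane_frame_unit.
  have os (z : 'rV[R]_2) : Csm z (fun=> 0 : R) by exact: Csm_cst.
  split => [z|z|]; [exact: Csm_next_model|exact: row_free_next_model|].
  exact: (locally_modelled_next Ns Nf os (leqnn 2) locally_modelled_plane).
rewrite trailer_frameS.
have os (z : 'rV[R]_n.+3) : Csm z (fun z => z 0 ord_max : R).
  exact: Csm_coord (Csm_id _).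
split => [z|z|]; [exact: Csm_next_model|exact: row_free_next_model|].
exact: (locally_modelled_next Ns Nf os _ loc).
Qed.

End local_models.

(** * Fields and distributions in charts *)

Section charts.
Context {R : realType} {d : nat} {M : manifold R d}.
Implicit Types (c : chart R d M) (x : M) (X Y : M -> 'rV[R]_d).

Lemma chart_nbhs c x : cdom c x -> \forall z \near x, cdom c z.
Proof. by move=> cx; apply: open_nbhs_nbhs; split => //; exact: open_cdom. Qed.

Lemma chart_image_nbhs c x : cdom c x -> \forall y \near c x, (c @` cdom c) y.
Proof.
by move=> cx; apply: open_nbhs_nbhs; split; [exact: open_cmap|exists x].
Qed.

Lemma cinv_continuous c x : cdom c x -> {for c x, continuous (cinv c)}.
Proof. by move=> cx; apply: continuous_cinv; exists x. Qed.

Lemma cinv_near c x (P : set M) : cdom c x -> (\forall z \near x, P z) ->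
  \forall y \near c x, P (cinv c y).
Proof.
move=> cx xP; have H : nbhs (cinv c (c x)) P by rewrite cmapK.
exact: (cinv_continuous cx H).
Qed.

Lemma cmap_cinv c y : (c @` cdom c) y -> c (cinv c y) = y /\ cdom c (cinv c y).
Proof. by move=> [x cx <-]; rewrite cmapK. Qed.

Lemma chart_image_open c (V : set M) : open V -> open (c @` (cdom c `&` V)).
Proof.
move=> oV; rewrite openE => _ [x [cx Vx] <-]; rewrite /interior /=.
have n : \forall z \near x, V z by exact: open_nbhs_nbhs.
apply: filterS2 (chart_image_nbhs cx) (cinv_near cx n) => y [z cz zE] Vy.
by exists z => //; split => //; move: Vy; rewrite -zE cmapK.
Qed.

Lemma Csm_transition c c' x : atlas c -> atlas c' -> cdom c x -> cdom c' x ->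
  Csm (c x) (c' \o cinv c).
Proof.
move=> ac ac' cx c'x; have o := @chart_image_open c _ (@open_cdom _ _ _ c').
exists (c @` (cdom c `&` cdom c')); first by split=> //; exists x.
by apply: smooth_on_Cinf => //; exact: atlas_compatible.
Qed.

Lemma diff_cmap_cinv c x v : cdom c x -> 'd (c \o cinv c) (c x) v = v.
Proof.
move=> cx; have idd : differentiable (fun y : 'rV[R]_d => y) (c x).
  exact: Csm_differentiable (Csm_id _).
apply: etrans (diff_near_eq v _ idd) (diff_idE _ _).
by apply: filterS (chart_image_nbhs cx) => y /cmap_cinv[].
Qed.

Lemma diff_transition c0 c c' x v : atlas c0 -> atlas c -> atlas c' ->
  cdom c0 x -> cdom c x -> cdom c' x ->
  'd (c' \o cinv c) (c x) ('d (c \o cinv c0) (c0 x) v) = 'd (c' \o cinv c0) (c0 x) v.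
Proof.
move=> a0 ac ac' c0x cx c'x.
have s1 := Csm_transition a0 ac c0x cx; have s2 := Csm_transition ac ac' cx c'x.
have E : (c \o cinv c0) (c0 x) = c x by rewrite /= cmapK.
have s2' : Csm ((c \o cinv c0) (c0 x)) (c' \o cinv c) by rewrite E.
have H := diff_compE v (Csm_differentiable s1) (Csm_differentiable s2').
rewrite E in H; apply: etrans (esym H) _.
apply: diff_near_eq; last exact: Csm_differentiable (Csm_transition a0 ac' c0x c'x).
by apply: filterS (cinv_near c0x (chart_nbhs cx)) => y cy; rewrite /= cmapK.
Qed.

Lemma tangent_change c c' x v : atlas c -> atlas c' -> cdom c x -> cdom c' x ->
  'd (c' \o cinv c) (c x) (tangent_in c x v) = tangent_in c' x v.
Proof.
move=> ac ac' cx c'x.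
exact: diff_transition (chart_at_atlas x) ac ac' (chart_at_dom x) cx c'x.
Qed.

Lemma tangent_in_at x v : tangent_in (chart_at x) x v = v.
Proof. exact: diff_cmap_cinv (chart_at_dom x). Qed.

Lemma tangent_in_linear c x : linear (tangent_in c x).
Proof. by move=> a u v; rewrite /tangent_in; exact: (linearP ('d _ _)). Qed.

Lemma tangent_in_inj c x v : atlas c -> cdom c x -> tangent_in c x v = 0 -> v = 0.
Proof.
move=> ac cx v0; rewrite -(tangent_in_at x v).
have H := tangent_change v ac (chart_at_atlas x) cx (chart_at_dom x).
by apply: etrans (esym H) _; rewrite v0; exact: (linear0 ('d _ _)).
Qed.

Definition vf_smooth X := forall c x, atlas c -> cdom c x -> Csm (c x) (local_rep c X).

Lemma smooth_vf_smooth X : smooth_vf_on [set: M] X -> vf_smooth X.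
Proof.
move=> Xs c x ac cx; have o := @chart_image_open c _ openT.
exists (c @` (cdom c `&` [set: M])); first by split=> //; exists x.
by apply: smooth_on_Cinf => //; exact: Xs.
Qed.

Lemma local_rep_at c X x : cdom c x -> local_rep c X (c x) = tangent_in c x (X x).
Proof. by move=> cx; rewrite /local_rep cmapK. Qed.

Lemma local_rep_change c c' X x : atlas c -> atlas c' -> cdom c x -> cdom c' x ->
  \forall y \near c x,
    local_rep c' X ((c' \o cinv c) y) = 'd (c' \o cinv c) y (local_rep c X y).
Proof.
move=> ac ac' cx c'x.
apply: filterS2 (chart_image_nbhs cx) (cinv_near cx (chart_nbhs c'x)).
move=> _ [z cz <-]; rewrite cmapK// => c'z.
rewrite (local_rep_at _ cz) /= cmapK// (local_rep_at _ c'z).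
by apply/esym; exact: tangent_change.
Qed.

(** [lie_bracket] is computed at each point in the chart chosen there. A field read in two charts
    gives fields related by the transition map, so every chart yields the same bracket. *)
Lemma tangent_lie_bracket c X Y x : atlas c -> cdom c x -> vf_smooth X -> vf_smooth Y ->
  tangent_in c x (lie_bracket X Y x) = br (local_rep c X) (local_rep c Y) (c x).
Proof.
move=> ac cx Xs Ys.
have [a0 c0x] : atlas (chart_at x) /\ cdom (chart_at x) x.
  by split; [exact: chart_at_atlas|exact: chart_at_dom].
have ts := Csm_transition a0 ac c0x cx.
have E : (c \o cinv (chart_at x)) (chart_at x x) = c x by rewrite /= cmapK.
have Xs' : Csm ((c \o cinv (chart_at x)) (chart_at x x)) (local_rep c X).
  by rewrite E; exact: Xs.
have Ys' : Csm ((c \o cinv (chart_at x)) (chart_at x x)) (local_rep c Y).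
  by rewrite E; exact: Ys.
have H := br_related ts (Xs _ _ a0 c0x) (Ys _ _ a0 c0x) Xs' Ys'
  (local_rep_change X a0 ac c0x cx) (local_rep_change Y a0 ac c0x cx).
by rewrite E in H; exact: esym H.
Qed.

Lemma local_rep_lie c X Y x : atlas c -> cdom c x -> vf_smooth X -> vf_smooth Y ->
  \forall y \near c x,
    local_rep c (lie_bracket X Y) y = br (local_rep c X) (local_rep c Y) y.
Proof.
move=> ac cx Xs Ys; apply: filterS (chart_image_nbhs cx) => _ [z cz <-].
by rewrite local_rep_at//; exact: tangent_lie_bracket.
Qed.

Lemma vf_smooth_lie X Y : vf_smooth X -> vf_smooth Y -> vf_smooth (lie_bracket X Y).
Proof.
move=> Xs Ys c x ac cx; apply: Csm_near_eq (local_rep_lie ac cx Xs Ys) _.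
by apply: Csm_br; [exact: Xs|exact: Ys].
Qed.

Lemma Csm_smooth_on (V W : normedModType R) (S : set V) (f : V -> W) :
  (forall y, S y -> Csm y f) -> smooth_on S f.
Proof.
move=> H vs y Sy; have [U [oU Uy] fi] := H y Sy.
exact: (Cinf_smooth_on oU fi vs Uy).
Qed.

Lemma Csm_sum (V W : normedModType R) (I : finType) (y : V) (f : I -> V -> W) :
  (forall i, Csm y (f i)) -> Csm y (fun z => \sum_i f i z).
Proof.
move=> fs; suff H (r : seq I) : Csm y (fun z => \sum_(i <- r) f i z) by exact: H.
elim: r => [|i r IH].
  by apply: Csm_near_eq (Csm_cst y 0); apply: nearW => z; rewrite big_nil.
apply: Csm_near_eq (Csm_add (fs i) IH); apply: nearW => z.
by rewrite big_cons.
Qed.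

Lemma smooth_function_Csm (f : M -> R) c x : smooth_function f -> atlas c -> cdom c x ->
  Csm (c x) (f \o cinv c : 'rV[R]_d -> R^o).
Proof.
move=> fs ac cx; exists (c @` cdom c); first by split; [exact: open_cmap|exists x].
by apply: smooth_on_Cinf; [exact: open_cmap|exact: fs].
Qed.

Lemma derived_flag_smooth (D : M -> {vspace 'rV[R]_d}) i X :
  derived_flag D i X -> vf_smooth X.
Proof.
elim: i X => [|i IH] X; first by move=> [Xs _]; exact: smooth_vf_smooth.
move=> [Y [m [f [A [B [YS fs AS BS XE]]]]]] c x ac cx.
have E : {near c x, local_rep c X =1 fun y => local_rep c Y y +
    \sum_j (f j \o cinv c) y *: local_rep c (lie_bracket (A j) (B j)) y}.
  apply: near_all => y; rewrite /local_rep XE.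
  have L := tangent_in_linear c (cinv c y).
  pose Lm := GRing.isLinear.Build R _ _ _ (tangent_in c (cinv c y)) L.
  pose T : {linear 'rV[R]_d -> 'rV[R]_d} := HB.pack (tangent_in c (cinv c y)) Lm.
  have -> u : tangent_in c (cinv c y) u = T u by [].
  rewrite linearD linear_sum; congr (_ + _); apply: eq_bigr => j _.
  by rewrite linearZ.
apply: Csm_near_eq E _; apply: Csm_add; first exact: IH YS c x ac cx.
apply: Csm_sum => j; apply: Csm_scale; first exact: smooth_function_Csm.
by apply: vf_smooth_lie ac cx; [exact: IH (AS j)|exact: IH (BS j)].
Qed.

Lemma derived_flag_leq (D : M -> {vspace 'rV[R]_d}) i k X : (i <= k)%N ->
  derived_flag D i X -> derived_flag D k X.
Proof.
move=> /subnKC <-; elim: (k - i)%N => [|m IH] Xi; first by rewrite addn0.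
rewrite addnS; exists X, 0%N, (fun=> fun=> 0), (fun=> X), (fun=> X).
split => //; try by [exact: IH Xi | case].
by move=> x; rewrite big_ord0 addr0.
Qed.

Lemma derived_flag0 (D : M -> {vspace 'rV[R]_d}) i : derived_flag D i (fun=> 0).
Proof.
apply: (@derived_flag_leq D 0 i) => //; split; last by move=> x; exact: mem0v.
move=> c ac; apply: Csm_smooth_on => y _.
have -> : local_rep c (fun=> 0) = fun=> 0; last exact: Csm_cst.
by apply/funext => z; exact: (linear0 ('d _ _)).
Qed.

Lemma smooth_function1 : smooth_function ((fun=> 1) : M -> R).
Proof. by move=> c ac; apply: Csm_smooth_on => y _; exact: Csm_cst. Qed.

Lemma derived_flag_bracket (D : M -> {vspace 'rV[R]_d}) i X Y :
  derived_flag D i X -> derived_flag D i Y -> derived_flag D i.+1 (lie_bracket X Y).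
Proof.
move=> Xi Yi.
exists (fun=> 0), 1%N, (fun=> fun=> 1), (fun=> X), (fun=> Y); split.
- exact: derived_flag0.
- by move=> _; exact: smooth_function1.
- by move=> _; exact: Xi.
- by move=> _; exact: Yi.
- by move=> x; rewrite big_ord1 scale1r add0r.
Qed.

End charts.

(** * Dimension counts for flags *)

Section flag_dimension.
Context {R : realType} (d : nat).
Implicit Types (V : {vspace 'rV[R]_d}) (G : 'M[R]_d).

Lemma inS_add k (u v : 'rV[R]_d) : inS k u -> inS k v -> inS k (u + v).
Proof. by move=> uk vk l kl; rewrite mxE uk// vk// addr0. Qed.

Lemma inS_scale k a (u : 'rV[R]_d) : inS k u -> inS k (a *: u).
Proof. by move=> uk l kl; rewrite mxE uk// mulr0. Qed.

Lemma inS_sum k (I : finType) (u : I -> 'rV[R]_d) :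
  (forall i, inS k (u i)) -> inS k (\sum_i u i).
Proof. by move=> uk l kl; rewrite summxE big1// => i _; exact: uk. Qed.

Definition basis_matrix V : 'M[R]_(\dim V, d) := \matrix_(i < \dim V) (vbasis V)`_i.

Lemma sub_basis_matrix V v : v \in V -> (v <= basis_matrix V)%MS.
Proof.
move=> vV; rewrite (coord_vbasis vV); apply: summx_sub => i _.
apply: scalemx_sub; rewrite (_ : (vbasis V)`_i = row i (basis_matrix V)).
  exact: row_sub.
by rewrite rowK.
Qed.

Lemma basis_matrix_free V : row_free (basis_matrix V).
Proof.
rewrite -kermx_eq0; apply/eqP/row_matrixP => k; rewrite row0; set c := row k _.
have cB : c *m basis_matrix V = 0 by rewrite -row_mul mulmx_ker row0.
clearbody c; have /freeP fr := basis_free (vbasisP V).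
apply/rowP => i; rewrite [RHS]mxE; apply: (fr (fun i => c 0 i)).
apply: etrans _ cB; rewrite mulmx_sum_row; apply: eq_bigr => j _.
by rewrite rowK.
Qed.

(** The first k + 1 rows of an invertible matrix are independent, so by dimension they span [V]. *)
Lemma flag_span V G k : G \in unitmx -> (k < d)%N -> \dim V = k.+1 ->
  (forall a : 'I_d, (a <= k)%N -> row a G \in V) ->
  forall v, v \in V -> inS k (v *m invmx G).
Proof.
move=> Gu kd Vk GV v vV.
have sub : ((pid_mx k.+1 : 'M[R]_d) *m G <= basis_matrix V)%MS.
  apply/row_subP => a; rewrite row_mul; have [ak|ka] := leqP a k.
    have -> : row a (pid_mx k.+1 : 'M[R]_d) = delta_mx 0 a.
      by apply/rowP => j; rewrite !mxE ltnS eqxx ak andbT val_eqE eq_sym.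
    by rewrite -rowE; apply: sub_basis_matrix; exact: GV.
  have -> : row a (pid_mx k.+1 : 'M[R]_d) = 0.
    by apply/rowP => j; rewrite !mxE ltnS leqNgt ka andbF.
  by rewrite mul0mx sub0mx.
have sup : (basis_matrix V <= (pid_mx k.+1 : 'M[R]_d) *m G)%MS.
  rewrite -(mxrank_leqif_sup sub) eqn_leq mxrankS//=.
  apply: leq_trans (rank_leq_row _) _; rewrite Vk.
  rewrite mxrankMfree ?row_free_unit// rank_pid_mx//.
have /submxP[u ->] := submx_trans (sub_basis_matrix vV) sup.
by rewrite mulmxA mulmxK//; exact: pid_inS.
Qed.

Lemma flag_dim V G k : G \in unitmx -> (forall v, v \in V -> inS k (v *m invmx G)) ->
  (\dim V <= k.+1)%N.
Proof.
move=> Gu H; rewrite -(eqP (basis_matrix_free V)).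
apply: (@leq_trans (\rank ((pid_mx k.+1 : 'M[R]_d) *m G))).
  apply: mxrankS; apply/row_subP => i; rewrite rowK; set b := _`_i.
  have bV : b \in V by apply: vbasis_mem; apply: mem_nth; rewrite size_tuple.
  have <- : b *m invmx G *m (pid_mx k.+1 : 'M[R]_d) *m G = b.
    by rewrite inS_pid ?mulmxKV//; exact: H.
  by rewrite -mulmxA submxMl.
apply: leq_trans (mxrankM_maxl _ _) _.
have [kd|dk] := leqP k.+1 d; first by rewrite rank_pid_mx.
by apply: leq_trans (rank_leq_row _) _; exact: ltnW.
Qed.

End flag_dimension.

(** * From a Goursat structure to a frame *)

Section goursat_frame.
Context {R : realType} {n : nat} {M : manifold R n.+3}.
Variables (D : M -> {vspace 'rV[R]_n.+3}) (q : M).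
Hypothesis gD : goursat D.
Let c := chart_at q.

Lemma goursat_dim i x : (i <= n.+1)%N ->
  exists V : {vspace 'rV[R]_n.+3}, \dim V = i.+2 /\
    forall v, v \in V <-> exists2 X, derived_flag D i X & X x = v.
Proof.
move=> i_n; have [_ _ H] := gD; have [|V [VE Vd]] := H i x; first by rewrite subn2.
exists V; split; first by rewrite Vd addn2.
move=> v; have -> : (v \in V) <-> [set` V] v by [].
by rewrite VE; split.
Qed.

(** The values at [q] are chosen one at a time: the flag step [a.-1] has dimension larger than [a],
    so the [a] vectors already chosen do not exhaust it. Fields 0 and 1 both come from [D] itself,
    whence the truncated predecessor. *)
Lemma adapted_fields : exists X : nat -> M -> 'rV[R]_n.+3,
  (forall a, (a < n.+3)%N -> derived_flag D a.-1 (X a)) /\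
  forall b : nat -> R, \sum_(a < n.+3) b a *: X a q = 0 ->
    forall a, (a < n.+3)%N -> b a = 0.
Proof.
suff H k : (k <= n.+3)%N -> exists X : nat -> M -> 'rV[R]_n.+3,
    (forall a, (a < k)%N -> derived_flag D a.-1 (X a)) /\
    forall b : nat -> R, \sum_(a < k) b a *: X a q = 0 ->
      forall a, (a < k)%N -> b a = 0 by exact: H.
elim: k => [_|k IH kn]; first by exists (fun=> fun=> 0); split.
have [X [XD Xf]] := IH (ltnW kn).
have [|V [Vd VP]] := @goursat_dim k.-1 q; first by case: (k) kn.
have [v [vV vX]] : exists v, v \in V /\
    forall b : nat -> R, v <> \sum_(a < k) b a *: X a q.
  apply: contrapT => nv.
  have sub : (V <= <<[seq X a q | a : 'I_k]>>)%VS.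
    apply/subvP => v vV; apply: contrapT => vX; apply: nv; exists v; split => //.
    move=> b E; apply: vX; rewrite E; apply: memv_suml => a _.
    by apply/memvZ/memv_span/mapP; exists a => //; rewrite mem_enum.
  have := dimvS sub; rewrite Vd => h.
  have := leq_trans h (dim_span _); rewrite size_map size_enum_ord.
  by case: (k) => [|m]; rewrite ?ltnn// ltnn.
have [Y YD Yq] := (VP v).1 vV.
exists (fun a => if a == k then Y else X a); split.
  move=> a; rewrite ltnS leq_eqVlt; case: eqP => [->|_ /=] //; exact: XD.
move=> b; rewrite big_ord_recr /= eqxx => E.
have E' : \sum_(a < k) b a *: (if (a : nat) == k then Y else X a) q =
    \sum_(a < k) b a *: X a q.
  by apply: eq_bigr => a _; rewrite ltn_eqF.
rewrite E' Yq in E.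
have bk : b k = 0.
  apply: contrapT => /eqP bk; apply: (vX (fun a => - (b k)^-1 * b a)).
  under eq_bigr do rewrite -scalerA.
  rewrite -scaler_sumr; move/eqP: E; rewrite addr_eq0 => /eqP ->.
  by rewrite scalerN scaleNr opprK scalerA mulVf// scale1r.
move=> a; rewrite ltnS leq_eqVlt => /orP[/eqP -> //|].
by apply: Xf; move: E; rewrite bk scale0r addr0.
Qed.

Variable X : nat -> M -> 'rV[R]_n.+3.
Hypothesis XD : forall a, (a < n.+3)%N -> derived_flag D a.-1 (X a).
Hypothesis Xf : forall b : nat -> R, \sum_(a < n.+3) b a *: X a q = 0 ->
  forall a, (a < n.+3)%N -> b a = 0.

Definition frame_rep (y : 'rV[R]_n.+3) : 'M[R]_n.+3 :=
  \matrix_(a < n.+3) local_rep c (X a) y.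

(** The same frame with tangent vectors at [x] written in the chart attached to [x], as in
    [derived_flag]; [frame_coefficient] shows that coordinates in it and in [frame_rep] agree. *)
Definition frame_at (x : M) : 'M[R]_n.+3 := \matrix_(a < n.+3) X a x.

Let ac : atlas c. Proof. exact: chart_at_atlas. Qed.
Let cq : cdom c q. Proof. exact: chart_at_dom. Qed.

Let XDord (a : 'I_n.+3) : derived_flag D a.-1 (X a).
Proof. exact: XD (ltn_ord a). Qed.

Lemma fld_frame_rep (a : 'I_n.+3) : fld frame_rep a = local_rep c (X a).
Proof. by apply/funext => y; rewrite /fld rowK. Qed.

Lemma frame_rep_at x : cdom c x ->
  frame_rep (c x) = frame_at x *m jac (c \o cinv (chart_at x)) (chart_at x x).
Proof.
move=> cx; apply/row_matrixP => a; rewrite row_mul !rowK jacE.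
exact: local_rep_at.
Qed.

Lemma frame_coefficient x v : cdom c x -> frame_rep (c x) \in unitmx ->
  tangent_in c x v *m invmx (frame_rep (c x)) = v *m invmx (frame_at x).
Proof.
move=> cx; rewrite frame_rep_at// unitmx_mul => /andP[Gu Ju].
rewrite invmx_mulmx// /tangent_in -(jacE (c \o cinv (chart_at x))).
by rewrite mulmxA mulmxK.
Qed.

Lemma frame_at_unit x : cdom c x -> frame_rep (c x) \in unitmx -> frame_at x \in unitmx.
Proof. by move=> cx; rewrite frame_rep_at// unitmx_mul => /andP[]. Qed.

Lemma frame_rep_unit : frame_rep (c q) \in unitmx.
Proof.
have -> : frame_rep (c q) = frame_at q.
  apply/row_matrixP => a; rewrite !rowK.
  by apply: etrans (local_rep_at _ cq) _; exact: tangent_in_at.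
rewrite -row_free_unit -kermx_eq0; apply/eqP/row_matrixP => k; rewrite row0.
set b := row k _.
have bG : b *m frame_at q = 0 by rewrite -row_mul mulmx_ker row0.
clearbody b; apply/rowP => a; rewrite mxE.
have := Xf (b := fun a => b 0 (inord a)).
rewrite (_ : \sum_(a < _) _ = 0) => [/(_ erefl a (ltn_ord a))|]; first by rewrite inord_val.
apply: etrans _ bG; rewrite mulmx_sum_row; apply: eq_bigr => j _.
by rewrite rowK inord_val.
Qed.

Lemma frame_smooth : Csm (c q) frame_rep.
Proof.
apply: Csm_mxP => a j.
have H := Csm_coord 0 j (derived_flag_smooth (XDord a) ac cq).
by apply: Csm_near_eq H; apply: near_all => y; rewrite mxE.
Qed.

(** The Goursat dimensions hold at every point, so near [q] the rows up to [k] fill the flag step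
    [k.-1]. *)
Lemma flag_coefficient x k A : cdom c x -> frame_rep (c x) \in unitmx ->
  (0 < k)%N -> (k < n.+3)%N -> derived_flag D k.-1 A ->
  inS k (A x *m invmx (frame_at x)).
Proof.
move=> cx Fu k0 kn AD.
have [|V [Vd VP]] := @goursat_dim k.-1 x; first by case: k k0 kn AD.
apply: (@flag_span R _ V _ k (frame_at_unit cx Fu) kn); first by rewrite Vd prednK.
  move=> a ak; apply/VP; exists (X a); last by rewrite rowK.
  by apply: derived_flag_leq (XDord a); case: (a : nat) k k0 ak {kn AD Vd VP} => [|?] [|?].
by apply/VP; exists A.
Qed.

(** Brackets of sections of a flag step belong to the next one, which bounds the rows they reach. If
    no bracket of rows up to [j] reached row [j.+1] at [q], the next flag step at [q] would stay in
    the span of the rows up to [j], one dimension short. *)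
Lemma goursat_LG : LG 1 frame_rep (c q).
Proof.
have Fs := frame_smooth; have Fu := frame_rep_unit.
have FA : \forall y \near c q, forall i i' : 'I_n.+3,
    inS (maxn (maxn i i') 1).+1 (cfb frame_rep i i' y).
  apply: filterS2 (chart_image_nbhs cq) (unitmx_near Fs Fu) => _ [x cx <-] Fxu i i'.
  set k := maxn _ 1; have k0 : (0 < k)%N by exact: leq_maxr.
  (* When [k.+1] exceeds the last index there is no coordinate left to kill. *)
  have [kn|kn] := ltnP k.+1 n.+3; last first.
    move=> l kl; have : (n.+3 <= l)%N by apply: leq_trans kn _; exact: ltnW.
    by rewrite leqNgt ltn_ord.
  have lieD : derived_flag D k.+1.-1 (lie_bracket (X i) (X i')).
    rewrite /= -(prednK k0); apply: derived_flag_bracket.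
      apply: derived_flag_leq (XDord i); rewrite -!subn1 leq_sub2r//.
      by rewrite /k -maxnA leq_maxl.
    apply: derived_flag_leq (XDord i'); rewrite -!subn1 leq_sub2r//.
    by rewrite /k (maxnC i) -maxnA leq_maxl.
  have C := flag_coefficient cx Fxu (ltn0Sn k) kn lieD.
  rewrite -(frame_coefficient _ cx Fxu) in C.
  rewrite (tangent_lie_bracket ac cx) in C; last exact: derived_flag_smooth (XDord i').
    by rewrite /cfb !fld_frame_rep; exact: C.
  exact: derived_flag_smooth (XDord i).
split => // j j1 jn; apply: contrapT => nB.
have cS (a b : 'I_n.+3) : (a <= j)%N -> (b <= j)%N -> inS j (cfb frame_rep a b (c q)).
  move=> aj bj l jl; have [jl'|l_j] := ltnP j.+1 l.
    apply: (nbhs_singleton FA a b); apply: leq_ltn_trans jl'.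
    by rewrite ltnS !geq_max aj bj.
  apply: contrapT => ne; apply: nB; exists a, b, l; split => //.
    by apply/eqP; rewrite eqn_leq l_j.
  exact/eqP.
(* Modulo the span of the rows up to [j], a bracket of sections is a combination of brackets of
   these rows, so what is assumed on rows extends to it. *)
have lieS A B : derived_flag D j.-1 A -> derived_flag D j.-1 B ->
    inS j (lie_bracket A B q *m invmx (frame_at q)).
  move=> AD BD; rewrite -(frame_coefficient _ cq Fu).
  have As := derived_flag_smooth AD; have Bs := derived_flag_smooth BD.
  rewrite (tangent_lie_bracket ac cq As Bs).
  pose u (E : M -> 'rV[R]_n.+3) y := local_rep c E y *m invmx (frame_rep y).
  have us E : vf_smooth E -> Csm (c q) (u E).
    by move=> Es; apply: Csm_mulmx; [exact: Es|exact: Csm_invmx].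
  have uE E : \forall y \near c q, local_rep c E y = u E y *m frame_rep y.
    by apply: filterS (unitmx_near Fs Fu) => y Fyu; rewrite /u mulmxKV.
  have uS E : derived_flag D j.-1 E -> \forall y \near c q, inS j (u E y).
    move=> ED; apply: filterS2 (chart_image_nbhs cq) (unitmx_near Fs Fu).
    move=> _ [x cx <-] Fxu; rewrite /u local_rep_at// frame_coefficient//.
    by apply: flag_coefficient => //; exact: ltnW.
  have uFs E : vf_smooth E -> Csm (c q) (fun y => u E y *m frame_rep y).
    by move=> Es; apply: Csm_mulmx => //; exact: us.
  rewrite (br_near_eq (uE A) (uE B) (uFs A As) (uFs B Bs)).
  apply: inS_br_comb => //; [exact: us|exact: us|exact: uS|exact: uS|].
  move=> a b l jl; have [ja|aj] := ltnP j a.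
    by rewrite (nbhs_singleton (uS A AD) a ja) !mul0r.
  have [jb|bj] := ltnP j b.
    by rewrite (nbhs_singleton (uS B BD) b jb) mulr0 mul0r.
  by rewrite (cS a b aj bj l jl) mulr0.
have [|V [Vd VP]] := @goursat_dim j q; first by rewrite -ltnS.
suff : (\dim V <= j.+1)%N by rewrite Vd ltnn.
apply: (@flag_dim R _ V _ j (frame_at_unit cq Fu)) => v /VP[Z ZD <-].
move: ZD; rewrite -(prednK j1) => -[Y [m [f [A [B [YD fs AD BD ZE]]]]]].
rewrite ZE (prednK j1) mulmxDl mulmx_suml; apply: inS_add.
  exact: (@flag_coefficient q j Y cq Fu j1 (ltnW jn) YD).
by apply: inS_sum => k; rewrite -scalemxAl; apply: inS_scale; exact: (lieS _ _ (AD k) (BD k)).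
Qed.

End goursat_frame.

(** * From the local model to the configuration space *)

Section diffeomorphisms.
Context {R : realType}.

(** Shrinks a germ to a bijection between open sets; [P] and [Q] carry what has to hold at all
    points of the source and of the target. *)
Lemma diffeo_germ d (f : 'rV[R]_d -> 'rV[R]_d) y0 (P Q : set 'rV[R]_d) :
  Csm y0 f -> (forall v, 'd f y0 v = 0 -> v = 0) ->
  (\forall y \near y0, P y) -> (\forall w \near f y0, Q w) ->
  exists (g : 'rV[R]_d -> 'rV[R]_d) (U W : set 'rV[R]_d),
    [/\ open U /\ U y0, open W /\ W (f y0),
        forall y, U y -> [/\ W (f y), g (f y) = y, Csm y f, P y &
          forall v, 'd f y v = 0 -> v = 0] &
        forall w, W w -> [/\ U (g w), f (g w) = w, Csm w g & Q w]].
Proof.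
move=> fs finj Py Qw; have [g [gs gK fK]] := local_inverse fs finj.
have fc := Csm_continuous fs.
have n1 := Csm_open fs; have n2 := near_nearP gK.
have n3 : \forall y \near y0, Csm (f y) g := fc _ (Csm_open gs).
have [B [oB By0] BP] : exists2 B, open_nbhs y0 B & B `<=` [set y |
    [/\ Csm y f, \forall z \near y, g (f z) = z, Csm (f y) g & P y]].
  have : \forall y \near y0,
      [/\ Csm y f, \forall z \near y, g (f z) = z, Csm (f y) g & P y].
    by near=> y; split; near: y.
  by rewrite /prop_near1 nbhsE.
have [N [oN Ny0] NP] : exists2 N, open_nbhs (f y0) N & N `<=` [set w |
    [/\ f (g w) = w, Csm w g & Q w]].
  have : \forall w \near f y0, [/\ f (g w) = w, Csm w g & Q w].
    by have n4 := Csm_open gs; near=> w; split; near: w.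
  by rewrite /prop_near1 nbhsE.
exists g, (B `&` f @^-1` N), (N `&` g @^-1` B); split.
- split; last by split.
  rewrite openE => y [Oy Ny]; rewrite /interior /=; apply: filterI.
    exact: open_nbhs_nbhs.
  have [ys _ _ _] := BP y Oy; have yc := Csm_continuous ys.
  exact: (yc _ (open_nbhs_nbhs (conj oN Ny))).
- split; last by split => //; rewrite /preimage /= (nbhs_singleton gK).
  rewrite openE => w [Nw Ow]; rewrite /interior /=; apply: filterI.
    exact: open_nbhs_nbhs.
  have [_ ws _] := NP w Nw; have wc := Csm_continuous ws.
  exact: (wc _ (open_nbhs_nbhs (conj oB Ow))).
- move=> y [By Ny]; have [ys yK fys Pyy] := BP y By.
  have yE := nbhs_singleton yK; split; [|exact: yE|exact: ys|exact: Pyy|].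
    by split; [exact: Ny|rewrite /preimage /= yE; exact: By].
  move=> v v0; apply: etrans (esym (diff_inverse v ys fys yK)) _.
  by apply: etrans (congr1 ('d g (f y)) v0) _; exact: (linear0 ('d g _)).
- move=> w [Nw Ow]; have [wK ws Qww] := NP w Nw; split; [|exact: wK|exact: ws|exact: Qww].
  by split; [exact: Ow|rewrite /preimage /= wK; exact: Nw].
Unshelve. all: by end_near. Qed.

(** One pair of charts covers [U] and its image; any other pair is reached through transition
    maps. *)
Lemma smooth_map_local d e (M : manifold R d) (N : manifold R e) (U : set M)
    (c : chart R d M) (c' : chart R e N) (f : M -> N) (h : 'rV[R]_d -> 'rV[R]_e) :
  open U -> atlas c -> atlas c' -> U `<=` cdom c ->
  (forall x, U x -> [/\ cdom c' (f x), c' (f x) = h (c x) & Csm (c x) h]) ->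
  smooth_map_on U f.
Proof.
move=> oU ac ac' Uc H.
have fE x : U x -> f x = cinv c' (h (c x)).
  by move=> /H[c'x <- _]; rewrite cmapK.
split=> [x Ux|c1 c1' a1 a1'].
  have [c'x E hs] := H x Ux.
  have xc : {for x, continuous c} := continuous_cmap (Uc x Ux).
  have hc := Csm_continuous hs.
  have ic : {for h (c x), continuous (cinv c')} by rewrite -E; exact: cinv_continuous.
  move=> A; rewrite (fE x Ux) => HA.
  have H1 : \forall y \near c x, A (cinv c' (h y)) := hc _ (ic _ HA).
  have H2 : \forall z \near x, A (cinv c' (h (c z))) := xc _ H1.
  have H3 : \forall z \near x, U z by apply: open_nbhs_nbhs.
  suff : \forall z \near x, A (f z) by [].
  by apply: filterS2 (H2) (H3) => z Az Uz; rewrite fE.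
apply: Csm_smooth_on => _ [x [[c1x Ux] c1'x] <-].
have [c'x E hs] := H x Ux; have cx := Uc x Ux.
have H3 : \forall z \near x, U z by apply: open_nbhs_nbhs.
have e1 : (c \o cinv c1) (c1 x) = c x by rewrite /= cmapK.
have s1 := Csm_transition a1 ac c1x cx.
have hs' : Csm ((c \o cinv c1) (c1 x)) h by rewrite e1.
have s2 := Csm_comp s1 hs'.
have s3 : Csm (h ((c \o cinv c1) (c1 x))) (c1' \o cinv c').
  by rewrite e1 -E; exact: Csm_transition.
apply: Csm_near_eq _ (Csm_comp s2 s3).
by apply: filterS (cinv_near c1x H3) => y Uy; rewrite /= fE.
Qed.

End diffeomorphisms.

(** * Periodicity of the trailer model *)

Section trailer_periodicity.
Context {R : realType}.

Lemma next_model_eq m (N : 'rV[R]_m -> 'M[R]_(2, m)) (o : 'rV[R]_m -> R)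
    (v w : 'rV[R]_m.+1) :
  N (prj v) = N (prj w) ->
  sin (v 0 ord_max - o (prj v)) = sin (w 0 ord_max - o (prj w)) ->
  cos (v 0 ord_max - o (prj v)) = cos (w 0 ord_max - o (prj w)) ->
  next_model N o v = next_model N o w.
Proof. by move=> E1 E2 E3; rewrite /next_model E1 E2 E3. Qed.

(** Angles enter through sines and cosines of an angle or of a difference of two, hence only through
    their points on the circle. The indices past 1 are those of the angles. *)
Lemma trailer_frame_periodic n (v w : 'rV[R]_n.+3) :
  (forall i : 'I_n.+3, (1 < i)%N ->
    cos (v 0 i) = cos (w 0 i) /\ sin (v 0 i) = sin (w 0 i)) ->
  trailer_frame v = trailer_frame w.
Proof.
elim: n v w => [|n IH] v w H.
  have [E1 E2] := H ord_max isT.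
  by rewrite trailer_frame0; apply: next_model_eq => //; rewrite !subr0.
have H' (i : 'I_n.+3) : (1 < i)%N -> cos (prj v 0 i) = cos (prj w 0 i) /\
    sin (prj v 0 i) = sin (prj w 0 i).
  by move=> i1; rewrite !mxE; apply: H; rewrite lift_max.
have [E1 E2] := H ord_max isT; have [E3 E4] := H' ord_max isT.
rewrite trailer_frameS; apply: next_model_eq; first exact: IH.
  by rewrite !sinB E1 E2 E3 E4.
by rewrite !cosB E1 E2 E3 E4.
Qed.

Lemma config_inv_frame n (v w : 'rV[R]_n.+3) : config_inv v = config_inv w ->
  trailer_frame v = trailer_frame w.
Proof.
move=> E; apply: trailer_frame_periodic => i i1.
have := congr1 (fun x : config R n => set_val (x.2 ord0 (inord (i - 2)))) E.
rewrite /= !mxE /=.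
rewrite (_ : rshift 2 (inord (i - 2) : 'I_n.+1) = i) => [[]//|].
apply: val_inj; rewrite /= inordK ?subnKC//.
by rewrite ltn_subLR// add2n.
Qed.

Lemma circle_pt_shift (t a b : R) : circle_pt a = circle_pt b ->
  circle_pt (t + (a - b)) = circle_pt t.
Proof.
move=> /(congr1 set_val) => -[ca sa].
have c1 : cos (a - b) = 1 by rewrite cosB ca sa -!expr2 cos2Dsin2.
have s0 : sin (a - b) = 0 by rewrite sinB ca sa mulrC subrr.
by apply: val_inj; rewrite /= cosD c1 s0 sinD c1 s0 !mulr1 !mulr0 subr0 addr0.
Qed.

(** [v] and the chart value of its configuration lie over the same configuration, so they differ by
    full turns in the angles; [config_inv] does not see a translation by that difference. *)
Lemma config_shift n (b : {ffun 'I_n.+1 -> bool}) (v : 'rV[R]_n.+3) :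
  config_dom b (config_inv v) ->
  exists s, config_map b (config_inv v) = v + s /\
    forall w, config_inv (w + s) = config_inv w.
Proof.
move=> vb; pose s : 'rV[R]_(2 + n.+1) := config_map b (config_inv v) - v.
have dE (A B : 'rV[R]_(2 + n.+1)) j : (A - B) 0 j = A 0 j - B 0 j by rewrite !mxE.
have s1 i : s 0 (lshift n.+1 i) = 0.
  by rewrite (dE (config_map b (config_inv v))) row_mxEl mxE subrr.
have s2 i : s 0 (rshift 2 i) =
    angle (b i) (circle_pt (v 0 (rshift 2 i))) - v 0 (rshift 2 i).
  by rewrite (dE (config_map b (config_inv v))) row_mxEr !mxE.
exists s; split; first by rewrite /s addrC subrK.
move=> w; congr pair; apply/rowP => i.
  by rewrite [LHS]mxE [RHS]mxE [LHS]mxE s1 addr0.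
rewrite [LHS]mxE [RHS]mxE.
have -> : rsubmx (w + s : 'rV[R]_(2 + n.+1)) ord0 i =
    w 0 (rshift 2 i) + s 0 (rshift 2 i) by rewrite [LHS]mxE [LHS]mxE.
have -> : rsubmx (w : 'rV[R]_(2 + n.+1)) ord0 i = w 0 (rshift 2 i) by rewrite mxE.
rewrite s2.
by apply: circle_pt_shift; apply: angleK; have := vb i; rewrite !mxE.
Qed.

Lemma config_translation n (b b' : {ffun 'I_n.+1 -> bool}) (v : 'rV[R]_n.+3) :
  config_image b v -> config_dom b' (config_inv v) ->
  exists s, \forall w \near v, config_map b' (config_inv w) = w + s.
Proof.
move=> vb vb'.
have h i : exists a, \forall u \near (v : 'rV[R]_(2 + n.+1)) ord0 (rshift 2 i),
    angle (b' i) (circle_pt u) = u + a.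
  by apply: (@angle_change _ (b i)); [exact: vb|have := vb' i; rewrite !mxE].
have /choice[a aP] := h.
exists (row_mx 0 (\row_i a i)).
have := @filter_forall 'rV[R]_(2 + n.+1) 'I_n.+1 (fun i w =>
  angle (b' i) (circle_pt (w ord0 (rshift 2 i))) = w ord0 (rshift 2 i) + a i)
  (nbhs v) (nbhs_filter v).
move=> /(_ (fun i => @row_entry_continuous R (2 + n.+1) (rshift 2 i) v _ (aP i))).
apply: (@filterS _ _ (nbhs_filter _)) => w wa /=.
rewrite -[in RHS](@hsubmxK _ 1 2 n.+1 w) add_row_mx addr0 /config_map /=.
apply: (congr1 (row_mx (lsubmx (w : 'rV[R]_(2 + n.+1))))).
by apply/rowP => i; rewrite !mxE wa.
Qed.

Lemma diff_config_transition n (b b' : {ffun 'I_n.+1 -> bool}) (v h : 'rV[R]_n.+3) :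
  config_image b v -> config_dom b' (config_inv v) ->
  'd (config_map b' \o @config_inv R n) v h = h.
Proof.
move=> vb vb'; have [s sE] := config_translation vb vb'.
have ds : differentiable (fun w : 'rV[R]_n.+3 => w + s) v.
  by apply: Csm_differentiable; apply: Csm_add; [exact: Csm_id|exact: Csm_cst].
apply: etrans (diff_near_eq h sE ds) _.
have d1 : differentiable (fun w : 'rV[R]_n.+3 => w) v.
  exact: Csm_differentiable (Csm_id _).
apply: etrans (congr1 (fun G => G h) (diffD d1 (differentiable_cst s v))) _.
apply: etrans (congr2 (fun a b => a + b) (diff_idE v h) (diff_cstE v h s)) _.
exact: addr0.
Qed.

End trailer_periodicity.

(** * Normal form of a Goursat structure in a chart *)

Section normal_form.
Context {R : realType} {n : nat} {M : manifold R n.+3}.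
Variables (D : M -> {vspace 'rV[R]_n.+3}) (q : M).
Hypothesis gD : goursat D.
Let c := chart_at q.

Lemma goursat_rank x : \dim (D x) = 2.
Proof. by have [_ [H _] _] := gD. Qed.

(** By the Goursat condition at step 0 the values of global sections at [x] already have dimension
    two, so they fill [D x]: every vector extends to a global section without a cut-off function. *)
Lemma distribution_section x v : v \in D x -> exists2 Z, derived_flag D 0 Z & Z x = v.
Proof.
have [V [Vd VP]] := goursat_dim gD x (leq0n n.+1).
have sub : (V <= D x)%VS by apply/subvP => u /VP[Z [_ ZD] <-].
suff -> : D x = V by move=> /VP.
by apply/esym/eqP; rewrite eqEdim sub Vd goursat_rank.
Qed.

Lemma goursat_normal_form : exists f : 'rV[R]_n.+3 -> 'rV[R]_n.+3,
  [/\ Csm (c q) f, forall v, 'd f (c q) v = 0 -> v = 0 &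
      \forall y \near c q, forall v, v \in D (cinv c y) ->
        ('d f y (tangent_in c (cinv c y) v) <= trailer_frame (f y))%MS].
Proof.
have [X [XD Xf]] := adapted_fields q gD.
have LGF := goursat_LG gD XD Xf; have [Fs Fu _ _] := LGF.
have [_ _ loc] := @trailer_model R n.
have [f [fs finj fF]] := loc _ _ LGF.
exists f; split => //.
apply: filterS3 (fF) (chart_image_nbhs (chart_at_dom q)) (unitmx_near Fs Fu).
move=> y fFy yc Fyu v vD; have [x cx xE] := yc.
rewrite -xE in fFy Fyu vD *; rewrite cmapK// in vD *.
have [Z ZD Zx] := distribution_section vD.
have C := flag_coefficient gD XD cx Fyu (ltn0Sn 0) isT ZD.
rewrite Zx -(frame_coefficient v cx Fyu) in C.
apply: (@linear_inS_sub R _ _ _ 1 ('d f (c x)) (frame_rep q X (c x))) => //.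
Qed.

End normal_form.

(** * Transport of the distribution to the configuration space *)

Section pushforward.
Context {R : realType} {n : nat} {M : manifold R n.+3}.
Variables (c : chart R n.+3 M) (f : 'rV[R]_n.+3 -> 'rV[R]_n.+3).
Variables (b : {ffun 'I_n.+1 -> bool}) (x : M).
Hypotheses (ac : atlas c) (cx : cdom c x) (fs : Csm (c x) f).
Hypothesis fb : config_image b (f (c x)).

Let phi : M -> trailer_space R n := fun z => config_inv (f (c z)).

Let fE : (f \o (c \o cinv (chart_at x))) (chart_at x x) = f (c x).
Proof. by rewrite /= cmapK//; exact: chart_at_dom. Qed.

(** The chart attached to [phi x] and the chart of [b] differ by a translation near this point, so
    the tangent map read in the former is that of [f]. *)
Lemma tangent_map_trailer v : tangent_map phi x v = 'd f (c x) (tangent_in c x v).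
Proof.
have ax := chart_at_atlas x; have xx := chart_at_dom x.
have ts := Csm_transition ax ac xx cx.
have tE : (c \o cinv (chart_at x)) (chart_at x x) = c x by rewrite /= cmapK.
have fs' : Csm ((c \o cinv (chart_at x)) (chart_at x x)) f by rewrite tE.
have fts := Csm_comp ts fs'.
pose e : chart R n.+3 (trailer_space R n) := config_chart R b.
have ae : @atlas _ _ (trailer_space R n) e by exists b.
have ep : cdom e (phi x) by exact: config_inv_dom.
have eE : e (phi x) = f (c x) by exact: config_invK.
have s3 : Csm (f (c x)) (chart_at (phi x) \o cinv e).
  have := Csm_transition ae (chart_at_atlas (phi x)) ep (chart_at_dom (phi x)).
  by rewrite eE.
have s3' : Csm (f ((c \o cinv (chart_at x)) (chart_at x x))) (chart_at (phi x) \o cinv e).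
  by rewrite tE.
apply: etrans (diff_compE v (Csm_differentiable fts) (Csm_differentiable s3')) _.
rewrite tE.
apply: etrans (diff_config_transition _ fb (@config_chart_at_dom R n (phi x))) _.
apply: etrans (diff_compE v (Csm_differentiable ts) (Csm_differentiable fs')) _.
by rewrite tE.
Qed.

Variable V : {vspace 'rV[R]_n.+3}.
Hypotheses (V2 : \dim V = 2) (finj : forall v, 'd f (c x) v = 0 -> v = 0).
Hypothesis fV : forall v, v \in V ->
  ('d f (c x) (tangent_in c x v) <= trailer_frame (f (c x)))%MS.

(** The inclusion is [fV]. It is an equality because the injective image of [V] has dimension 2, and
    two vectors span at most that. *)
Lemma push_trailer :
  (linfun (tangent_map phi x) @: V)%VS = trailer_distribution (phi x).
Proof.
have LE v : linfun (tangent_map phi x) v = 'd f (c x) (tangent_in c x v).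
  apply: etrans _ (tangent_map_trailer v).
  exact: (lfunE ('d (chart_at (phi x) \o phi \o cinv (chart_at x)) (chart_at x x))).
have kL : lker (linfun (tangent_map phi x)) = 0%VS.
  apply/eqP/lker0P => u v /eqP; rewrite -subr_eq0 -linearB => /eqP.
  move=> /(etrans (esym (LE _)))/finj/(tangent_in_inj ac cx)/eqP.
  by rewrite subr_eq0 => /eqP.
apply/eqP; rewrite eqEdim; apply/andP; split; last first.
  rewrite limg_dim_eq; last by rewrite kL capv0.
  by rewrite V2; exact: dim_span.
apply/subvP => _ /memv_imgP[v vV ->]; rewrite LE.
have zE : trailer_frame (f (c x)) =
    trailer_frame (@config_chart_at R n (phi x) (phi x)).
  apply: config_inv_frame; apply/esym.
  exact: (@config_mapK R n _ (phi x) (@config_chart_at_dom R n (phi x))).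
have /submxP[u ->] := fV vV.
rewrite zE mul_row2 !rowK /=.
by apply: rpredD; apply: memvZ; apply: memv_span; rewrite !inE eqxx ?orbT.
Qed.

End pushforward.

Lemma chart_preimage_open (R : realType) (d : nat) (M : manifold R d) (c : chart R d M)
    (U : set 'rV[R]_d) : open U -> open (cdom c `&` c @^-1` U).
Proof.
move=> oU; rewrite openE => x [cx Ux]; rewrite /interior /=; apply: filterI.
  exact: chart_nbhs.
exact: (continuous_cmap cx (open_nbhs_nbhs (conj oU Ux))).
Qed.

Theorem theorem3p2 (R : realType) (n : nat) (M : manifold R n.+3)
    (D : M -> {vspace 'rV[R]_n.+3}) (q : M) :
  goursat D ->
  exists (p : trailer_space R n) (U : set M) (W : set (trailer_space R n))
      (phi : M -> trailer_space R n) (psi : trailer_space R n -> M),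
    [/\ open U /\ U q, open W /\ W p, diffeo_on U W phi psi, phi q = p &
        forall w, W w -> push_distribution phi psi D w = trailer_distribution w].
Proof.
move=> gD; pose c := chart_at q.
have ac : atlas c := chart_at_atlas q; have cq : cdom c q := chart_at_dom q.
have [f0 [f0s f0inj f0D]] := goursat_normal_form q gD.
pose p : trailer_space R n := config_inv (f0 (c q)).
pose b : {ffun 'I_n.+1 -> bool} := [ffun i => (set_val (p.2 ord0 i)).1 < 0].
pose e : chart R n.+3 (trailer_space R n) := config_chart R b.
have ae : @atlas _ _ (trailer_space R n) e by exists b.
have ep : config_dom b p by exact: config_chart_at_dom.
(* The real angles given by [f0] at [q] may lie outside the image of the chart at [p]; the shift [s]
   by full turns brings them into it. *)
have [s [sE sP]] := config_shift ep.
pose f y := f0 y + s.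
have fsm y : Csm y f0 -> Csm y f by move=> H; apply: Csm_add => //; exact: Csm_cst.
have df y v : Csm y f0 -> 'd f y v = 'd f0 y v.
  move=> H.
  apply: etrans (congr1 (fun G => G v)
    (diffD (Csm_differentiable H) (differentiable_cst s y))) _.
  apply: etrans (congr1 (fun t => 'd f0 y v + t) (diff_cstE y v s)) _.
  exact: addr0.
(* By periodicity the shift leaves the model frame unchanged. *)
have fD : \forall y \near c q, (c @` cdom c) y /\ forall v, v \in D (cinv c y) ->
    ('d f y (tangent_in c (cinv c y) v) <= trailer_frame (f y))%MS.
  apply: filterS3 (f0D) (Csm_open f0s) (chart_image_nbhs cq) => y H ys cy.
  split => // v vD; rewrite df// (config_inv_frame (sP (f0 y))); exact: H.
have finj v : 'd f (c q) v = 0 -> v = 0 by rewrite df//; exact: f0inj.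
have fq : f (c q) = config_map b p by rewrite sE.
have nb : \forall w \near f (c q), config_image b w.
  apply: open_nbhs_nbhs; split; first exact: config_image_open.
  by rewrite fq; exact: config_map_image.
(* After shrinking, the inclusion and the image of [c] hold on all of [U], and [W] lies in the image
   of the chart [e]. *)
have [g [U [W [[oU Uq] [oW Wq] HU HW]]]] := diffeo_germ (fsm _ f0s) finj fD nb.
pose phi : M -> trailer_space R n := fun x => config_inv (f (c x)).
pose psi : trailer_space R n -> M := fun w => cinv c (g (e w)).
have phiq : phi q = p by rewrite /phi sP.
pose UM := cdom c `&` c @^-1` U; pose WT := cdom e `&` e @^-1` W.
have phiU x : UM x -> [/\ WT (phi x), e (phi x) = f (c x) & psi (phi x) = x].
  move=> [cx Ux]; have [Wf gf _ _ _] := HU _ Ux; have [_ _ _ fb] := HW _ Wf.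
  have eE : e (phi x) = f (c x) by exact: config_invK.
  split => //; first by split; [exact: config_inv_dom|exact: (eq_ind_r W Wf eE)].
  by rewrite /psi eE gf cmapK.
have psiW w : WT w -> [/\ UM (psi w), c (psi w) = g (e w) & phi (psi w) = w].
  move=> [ew Ww]; have [Ug fg _ _] := HW _ Ww; have [_ _ _ [cg _] _] := HU _ Ug.
  have [cE cd] := cmap_cinv cg.
  split => //; first by split => //; rewrite /preimage /= /psi cE.
  by rewrite /phi /psi cE fg; exact: config_mapK.
exists p, UM, WT, phi, psi; split => //.
- by split; [exact: chart_preimage_open|split].
- split; first exact: (@chart_preimage_open R n.+3 (trailer_space R n) e W).
  by have [H _ _] := phiU q (conj cq Uq); rewrite phiq in H.
- split.
  + apply/seteqP; split=> [_ [x Ux <-]|w Ww]; first by case: (phiU x Ux).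
    by have [Ux _ E] := psiW w Ww; exists (psi w).
  + by move=> x /phiU[].
  + apply: (@smooth_map_local R _ _ M (trailer_space R n) UM c e phi f) => //.
    * exact: chart_preimage_open.
    * by move=> x [].
    * move=> x Ux; have [[ew _] eE _] := phiU x Ux.
      by case: Ux => _ /HU[].
  + apply: (@smooth_map_local R _ _ (trailer_space R n) M WT e c psi g) => //.
    * exact: (@chart_preimage_open R n.+3 (trailer_space R n) e W).
    * by move=> w [].
    * move=> w Ww; have [[cw _] cE _] := psiW w Ww.
      by case: Ww => _ /HW[].
- move=> w Ww; have [[cx Ux] _ pw] := psiW w Ww.
  have [Wf _ fs [_ fV] finjx] := HU _ Ux; have [_ _ _ fb] := HW _ Wf.
  rewrite /push_distribution -[in RHS]pw.
  apply: (push_trailer ac cx fs fb (goursat_rank gD _) finjx).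
  by move=> v vD; have := fV v; rewrite cmapK//; exact.
Qed.
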